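(* Let $R>0$ and let $\mathrm{B}_R$ be the open ball of radius $R$ in $\mathbb{R}^n$ centred at the origin. Then every minimiser realising the infimum $$\Lambda_\infty^{\mathrm{H}}(\mathrm{B}_R)=\inf_{u\in\mathcal{W}^{2,\infty}_{\mathrm{H}}(\mathrm{B}_R)\setminus\{0\}}\frac{\|\Delta u\|_{L^\infty(\mathrm{B}_R)}}{\|u\|_{L^\infty(\mathrm{B}_R)}}$$ is a nonzero multiple of the function $$u_\infty(x)=\frac1{2n}\,(R^2-|x|^2),$$ and $$\Lambda_\infty^{\mathrm{H}}(\mathrm{B}_R)=\frac{2n}{R^2}.$$
   Context: $n\in\mathbb{N}$. For a bounded domain $\Omega\subseteq\mathbb{R}^n$ with $C^{1,1}$ boundary, $\mathcal{W}^{2,\infty}_{\mathrm{H}}(\Omega)=\bigcap_{1<p<\infty}\{u\in W^{2,p}(\Omega)\cap W^{1,p}_0(\Omega):\Delta u\in L^\infty(\Omega)\}$ (hinged space). *)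

(* Defs.v *)
From HB Require Import structures.
From mathcomp Require Import all_boot all_order all_algebra.
From mathcomp Require Import all_classical all_reals all_analysis.

Set Implicit Arguments.
Unset Strict Implicit.
Unset Printing Implicit Defensive.
Import Order.TTheory GRing.Theory Num.Theory.
Import numFieldNormedType.Exports.

Local Open Scope classical_set_scope.
Local Open Scope ring_scope.

(* The sigma-algebra on R^n generated by the coordinate functions, i.e., the
   Borel sets; it mirrors the library's structure on [n.-tuple T]. *)
Definition measure_rV_display : measure_display -> measure_display.
Proof. exact. Qed.

Section measurable_rV.
Context (R : realType) (n : nat).

Let coord (i : 'I_n) (x : 'rV[R]_n) : R := x ord0 i.

Let rV_set0 : g_sigma_preimage coord set0.
Proof. exact: sigma_algebra0. Qed.

Let rV_setC A : g_sigma_preimage coord A -> g_sigma_preimage coord (~` A).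
Proof. exact: sigma_algebraC. Qed.

Let rV_bigcup (F : (set 'rV[R]_n)^nat) :
  (forall i, g_sigma_preimage coord (F i)) ->
  g_sigma_preimage coord (\bigcup_i (F i)).
Proof. exact: sigma_algebra_bigcup. Qed.

HB.instance Definition _ := @isMeasurable.Build
  (measure_rV_display default_measure_display)
  'rV[R]_n (g_sigma_preimage coord) rV_set0 rV_setC rV_bigcup.

Lemma measurable_rV_coord (i : 'I_n) :
  measurable_fun [set: 'rV[R]_n] (fun x : 'rV[R]_n => x ord0 i).
Proof.
move=> _ Y mY; rewrite setTI; apply: sub_sigma_algebra => /=.
rewrite -bigcup_seq/=; exists i => /=; first by rewrite mem_index_enum.
by exists Y => //; rewrite setTI.
Qed.

Lemma measurable_fun_rV d (T : measurableType d) (f : T -> 'rV[R]_n) :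
  (forall i, measurable_fun [set: T] (fun x => f x ord0 i)) ->
  measurable_fun [set: T] f.
Proof.
move=> mf; suff H : g_sigma_preimage (fun i => coord i \o f) `<=` measurable.
  by move=> _ A mA; apply: H; rewrite g_sigma_preimage_comp; exists A.
apply: smallest_sub; first exact: sigma_algebra_measurable.
rewrite -bigcup_seq; apply: bigcup_sub => i _.
by move=> A [B mB <-]; exact: mf.
Qed.

End measurable_rV.

Section lebesgue_rV.
Context (R : realType).

Section cons.
Context (n : nat).

Definition rV_cons (p : R * 'rV[R]_n) : 'rV[R]_n.+1 :=
  \row_i (if unlift ord0 i is Some j then p.2 ord0 j else p.1).

Definition rV_uncons (x : 'rV[R]_n.+1) : R * 'rV[R]_n :=
  (x ord0 ord0, \row_j x ord0 (lift ord0 j)).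

Lemma rV_consK : cancel rV_uncons rV_cons.
Proof.
move=> x; apply/rowP => i; rewrite mxE.
by case: unliftP => [j|] -> /=; rewrite ?mxE.
Qed.

Lemma rV_unconsK : cancel rV_cons rV_uncons.
Proof.
move=> [t x]; rewrite /rV_uncons mxE unlift_none; congr pair.
by apply/rowP => j; rewrite !mxE liftK.
Qed.

Lemma measurable_rV_cons : measurable_fun [set: R * 'rV[R]_n] rV_cons.
Proof.
apply: measurable_fun_rV => i; under eq_fun do rewrite mxE.
case: unliftP => [j _|_]; last exact: measurable_fst.
exact: (measurableT_comp (measurable_rV_coord j) measurable_snd).
Qed.

Lemma measurable_rV_uncons : measurable_fun [set: 'rV[R]_n.+1] rV_uncons.
Proof.
apply: measurable_fun_pair; first exact: measurable_rV_coord.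
apply: measurable_fun_rV => i; under eq_fun do rewrite mxE.
exact: measurable_rV_coord.
Qed.

Variable m : {sigma_finite_measure set 'rV[R]_n -> \bar R}.

Definition lebesgue_cons : set 'rV[R]_n.+1 -> \bar R :=
  pushforward (@lebesgue_measure R \x m)%E rV_cons.

Let lebesgue_cons0 : lebesgue_cons set0 = 0%E.
Proof. by rewrite /lebesgue_cons /pushforward preimage_set0 measure0. Qed.

Let lebesgue_cons_ge0 A : (0 <= lebesgue_cons A)%E.
Proof.
exact: (measure_ge0 (@lebesgue_measure R \x m)%E (rV_cons @^-1` A)).
Qed.

Let lebesgue_cons_sigma_additive : semi_sigma_additive lebesgue_cons.
Proof.
move=> F mF tF mUF; rewrite /lebesgue_cons /pushforward preimage_bigcup.
apply: measure_semi_sigma_additive.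
- by move=> k; rewrite -[X in measurable X]setTI; exact: measurable_rV_cons.
- apply/trivIsetP => /= i j _ _ ij; rewrite -preimage_setI.
  by move/trivIsetP : tF => /(_ _ _ _ _ ij) ->//; rewrite preimage_set0.
- by rewrite -preimage_bigcup -[X in measurable X]setTI;
    exact: measurable_rV_cons.
Qed.

HB.instance Definition _ := isMeasure.Build _ _ _ lebesgue_cons
  lebesgue_cons0 lebesgue_cons_ge0 lebesgue_cons_sigma_additive.

Let lebesgue_cons_sigma_finite : sigma_finite setT lebesgue_cons.
Proof.
have /sigma_finiteP[F [FT Fnd Ffin]] := sigma_finiteT (@lebesgue_measure R).
have /sigma_finiteP[G [GT Gnd Gfin]] := sigma_finiteT m.
exists (fun k => rV_uncons @^-1` (F k `*` G k)).
  rewrite -preimage_bigcup (_ : \bigcup_i _ = setT) ?preimage_setT//.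
  apply/seteqP; split => // -[t x] _.
  have [k _ Fk] : (\bigcup_i F i) t by rewrite -FT.
  have [l _ Gl] : (\bigcup_i G i) x by rewrite -GT.
  exists (maxn k l) => //; split => /=.
    by move: t Fk; exact/subsetPset/Fnd/leq_maxl.
  by move: x Gl; exact/subsetPset/Gnd/leq_maxr.
move=> k; have [mF Fk] := Ffin k; have [mG Gk] := Gfin k; split.
  rewrite -[X in measurable X]setTI; apply: measurable_rV_uncons => //.
  exact: measurableX.
rewrite /lebesgue_cons /pushforward -comp_preimage.
rewrite (_ : rV_uncons \o rV_cons = id); last first.
  by apply/funext => p /=; rewrite rV_unconsK.
by rewrite preimage_id product_measure1E// lte_mul_pinfty// ge0_fin_numE.
Qed.

HB.instance Definition _ := @Measure_isSigmaFinite.Build _ _ _ lebesgue_cons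
  lebesgue_cons_sigma_finite.

End cons.

(* Lebesgue measure on the Borel sets of R^n: the n-fold product of the
   one-dimensional Lebesgue measure (R^0 being a single point of mass 1). *)
Fixpoint lebesgue_rV n : {sigma_finite_measure set 'rV[R]_n -> \bar R} :=
  match n with
  | 0 => \d_(0 : 'rV[R]_0)
  | k.+1 => lebesgue_cons (lebesgue_rV k)
  end.

Lemma lebesgue_rV_box n (a b : 'I_n -> R) : (forall i, a i <= b i) ->
  lebesgue_rV n [set x | forall i, x ord0 i \in `[a i, b i]] =
  (\prod_(i < n) (b i - a i))%:E.
Proof.
elim: n a b => [|n IH] a b ab.
  by rewrite big_ord0 /= diracE mem_set// => -[].
have -> : lebesgue_rV n.+1 [set x | forall i, x ord0 i \in `[a i, b i]] =
    (@lebesgue_measure R \x lebesgue_rV n)%E (`[a ord0, b ord0]%classic `*`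
      [set x : 'rV[R]_n | forall j : 'I_n,
         x ord0 j \in `[a (lift ord0 j), b (lift ord0 j)]]).
  rewrite /= /lebesgue_cons /pushforward; congr product_measure1.
  apply/seteqP; split => [[t x] h|[t x] [/= h0 h] i]; last first.
    by rewrite mxE; case: unliftP => [j|] ->.
  split => [|j] /=.
    by have := h ord0; rewrite mxE unlift_none.
  by have := h (lift ord0 j); rewrite mxE liftK.
rewrite product_measure1E//=; last first.
  rewrite (_ : mkset _ = \bigcap_(j in [set: 'I_n])
      ((fun x : 'rV[R]_n => x ord0 j) @^-1`
        `[a (lift ord0 j), b (lift ord0 j)]%classic)).
    apply: fin_bigcap_measurable => // j _.
    by rewrite -[X in measurable X]setTI; exact: measurable_rV_coord.
  by apply/seteqP; split => [x h j _|x h j]; [exact: h|exact: (h j I)].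
rewrite IH// lebesgue_measure_itv/= big_ord_recl EFinM; congr (_ * _)%E.
rewrite lte_fin lt_neqAle ab andbT -EFinB.
by case: eqVneq => //= ->; rewrite subrr.
Qed.

End lebesgue_rV.

Section sobolev.
Context (R : realType) (n : nat).
Implicit Types (Omega : set 'rV[R]_n) (u v g phi : 'rV[R]_n -> R).

Local Notation mu := (lebesgue_rV R n).

(* Euclidean norm; the norm of the library on ['rV[R]_n] is the sup norm. *)
Definition enorm (x : 'rV[R]_n) : R := Num.sqrt (\sum_i x ord0 i ^+ 2).

Definition eball (r : R) : set 'rV[R]_n := [set x | enorm x < r].

Definition partial (i : 'I_n) u : 'rV[R]_n -> R :=
  fun x => 'D_('e_i) u x.

(* Higher-order derivatives are indexed by lists of directions, the order of
   differentiation being the length of the list. *)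
Definition partials (s : seq 'I_n) u : 'rV[R]_n -> R := foldr partial u s.

Definition smooth u : Prop := forall s : seq 'I_n,
  continuous (partials s u) /\
  forall i x, derivable (partials s u) x 'e_i.

Definition support u : set 'rV[R]_n := closure [set x | u x != 0].

Definition test_function Omega phi : Prop :=
  [/\ smooth phi, compact (support phi) & support phi `<=` Omega].

Definition loc_integrable Omega u : Prop :=
  measurable_fun Omega u /\
  forall K, compact K -> K `<=` Omega -> mu.-integrable K (EFin \o u).

Definition is_weak_derivative Omega (s : seq 'I_n) u g : Prop :=
  [/\ loc_integrable Omega u, loc_integrable Omega g &
    forall phi, test_function Omega phi ->
      \int[mu]_(x in Omega) (u x * partials s phi x) =
      (-1) ^+ size s * \int[mu]_(x in Omega) (g x * phi x)].

(* A representative of the weak derivative, which is unique up to null sets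
   (junk if there is none). *)
Definition weak_derivative Omega (s : seq 'I_n) u : 'rV[R]_n -> R :=
  xget (cst 0) [set g | is_weak_derivative Omega s u g].

Definition weak_laplacian Omega u : 'rV[R]_n -> R :=
  fun x => \sum_(i < n) weak_derivative Omega [:: i; i] u x.

Definition Lp_norm Omega (p : \bar R) u : \bar R :=
  'N[mu]_p[(EFin \o u) \_ Omega].

Definition Lp Omega (p : \bar R) : set ('rV[R]_n -> R) :=
  [set u | measurable_fun Omega u /\ (Lp_norm Omega p u < +oo)%E].

Definition sobolev Omega (k : nat) (p : \bar R) : set ('rV[R]_n -> R) :=
  [set u | Lp Omega p u /\ forall s : seq 'I_n, (size s <= k)%N ->
     exists2 g, is_weak_derivative Omega s u g & Lp Omega p g].

(* The closure of the test functions in the Sobolev space. *)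
Definition sobolev0 Omega (k : nat) (p : \bar R) : set ('rV[R]_n -> R) :=
  [set u | sobolev Omega k p u /\
     exists2 phi : nat -> 'rV[R]_n -> R, forall j, test_function Omega (phi j) &
     forall s : seq 'I_n, (size s <= k)%N ->
       Lp_norm Omega p (partials s (phi j) \- weak_derivative Omega s u)
         @[j --> \oo] --> 0%E].

Definition W2oo_hinged Omega : set ('rV[R]_n -> R) :=
  \bigcap_(p in [set p : R | 1 < p])
    [set u | [/\ sobolev Omega 2 p%:E u, sobolev0 Omega 1 p%:E u &
                 Lp Omega +oo%E (weak_laplacian Omega u)]].

(* Functions are identified when they agree almost everywhere in [Omega]. *)
Definition W2oo_hinged_neq0 Omega : set ('rV[R]_n -> R) :=
  W2oo_hinged Omega `\` [set u | u = cst 0 %[ae mu in Omega]].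

Definition hinged_quotient Omega u : \bar R :=
  (Lp_norm Omega +oo (weak_laplacian Omega u) / Lp_norm Omega +oo u)%E.

Definition Lambda_hinged Omega : \bar R :=
  ereal_inf [set hinged_quotient Omega u | u in W2oo_hinged_neq0 Omega].

Definition hinged_minimiser Omega u : Prop :=
  W2oo_hinged_neq0 Omega u /\ hinged_quotient Omega u = Lambda_hinged Omega.

Definition u_infty (r : R) : 'rV[R]_n -> R :=
  fun x => (2 * n%:R)^-1 * (r ^+ 2 - enorm x ^+ 2).

End sobolev.

Arguments eball {R} n r.

(* Main.v *)
Require Import Defs.
From mathcomp Require Import all_boot all_order all_algebra.
From mathcomp Require Import all_classical all_reals all_analysis.
From mathcomp Require Import measurable_realfun ess_sup_inf ring lra.
Set Implicit Arguments.
Unset Strict Implicit.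
Unset Printing Implicit Defensive.
Import Order.TTheory GRing.Theory Num.Theory.
Import numFieldNormedType.Exports.
Local Open Scope classical_set_scope.
Local Open Scope ring_scope.

(* Let M = ||Delta u||_oo and U = u_infty, so that -Delta U = 1 and U vanishes on
   the sphere. For sigma = 1 and sigma = -1 the gap M U - sigma u is weakly
   superharmonic and is an H^1 limit of test functions, hence nonnegative by the
   weak maximum principle: |u| <= M U <= M r^2 / (2n), which is the lower bound for
   the quotient, and U attains it.
   For uniqueness, the means of a nonnegative superharmonic function against
   rescalings of a radial kernel increase as the scale shrinks; hence each gap
   either vanishes almost everywhere or is bounded below by a positive constant
   near the centre. If neither gap vanishes, then |u| <= M U - c near the centre
   while M U stays away from its maximum elsewhere, so that
   ||u||_oo < M r^2 / (2n) and u is not a minimiser. *)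

(** * The smooth function exp(-1/t) *)

(** What shapes the whole argument: a hinged function is known only up to null sets, with neither
    pointwise values nor classical derivatives, so every comparison is made by testing against
    smooth functions. The negative part of a gap would be the natural test function for the weak
    principle, but it is neither smooth nor compactly supported; smooth functions of the
    approximating test functions take its place, and the error they introduce is an energy that
    tends to 0. Uniqueness needs a positive lower bound on a whole ball about the centre: the sup
    norm does not see what happens at the centre alone. The single profile exp(-1/t) supplies the
    cutoffs, the substitute for the negative part and, through its derivative, the kernel of the
    means. *)

(* The case [p = 1] is exp(-1/t) extended by 0 to t <= 0. The general [p] makes the
   family stable under differentiation, see [bumpf_derive]. *)
Definition bumpf {R : realType} (p : {poly R}) (t : R) : R :=
  if 0 < t then p.[t^-1] * expR (- t^-1) else 0.

Section bumpf.
Context {R : realType}.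
Implicit Types (p : {poly R}) (t s : R).

Lemma bumpf_gt0 p t : 0 < t -> bumpf p t = p.[t^-1] * expR (- t^-1).
Proof. by rewrite /bumpf => ->. Qed.

Lemma bumpf_le0 p t : t <= 0 -> bumpf p t = 0.
Proof. by rewrite /bumpf leNgt => /negbTE ->. Qed.

(** The exponential dominates the single term s^k / k! of its series. *)
Lemma expR_ge_pow (k : nat) s : 0 <= s -> s ^+ k * expR (- s) <= k`!%:R.
Proof.
move=> s0; rewrite expRN ler_pdivrMr ?expR_gt0// mulrC -ler_pdivrMr ?ltr0n ?fact_gt0//.
case: k => [|k]; first by rewrite expr0 divr1 -expR0 ler_expR.
by apply: le_trans (expR_ge1Dxn k s0); rewrite lerDr.
Qed.

(** In s = 1/t each monomial of [p] times exp(-s) is at most a factorial times its coefficient, so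
    the exponential absorbs the blow-up of p(1/t) at t = 0. *)
Lemma bumpf_bounded p : exists2 C : R, 0 <= C & forall t, `|bumpf p t| <= C.
Proof.
exists (\sum_(i < size p) `|p`_i| * (i : nat)`!%:R).
  by apply: sumr_ge0 => i _; rewrite mulr_ge0.
move=> t; have [t0|t0] := ltP 0 t; last first.
  by rewrite bumpf_le0// normr0; apply: sumr_ge0 => i _; rewrite mulr_ge0.
have s0 : 0 <= t^-1 by rewrite invr_ge0 ltW.
rewrite bumpf_gt0// normrM (gtr0_norm (expR_gt0 _)) horner_coef.
apply: le_trans (_ : (\sum_(i < size p) `|p`_i * t^-1 ^+ i|) * expR (- t^-1) <= _).
  by rewrite ler_wpM2r ?expR_ge0// ler_norm_sum.
rewrite mulr_suml; apply: ler_sum => i _.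
rewrite normrM -mulrA ler_wpM2l// ger0_norm ?exprn_ge0//.
exact: expR_ge_pow.
Qed.

(** Each factor t extracted costs a factor X of the polynomial; as every [bumpf] is bounded, this
    gives vanishing of any order at 0. *)
Lemma bumpfMX p t : 0 < t -> bumpf p t = t * bumpf ('X * p) t.
Proof. by move=> t0; rewrite !bumpf_gt0// hornerM hornerX !mulrA divff ?gt_eqF// mul1r. Qed.

(** The chain rule for p(1/t) exp(-1/t): the derivative of 1/t is -X^2 evaluated at 1/t. *)
Definition dbump p := 'X^2 * (p - p^`()).

Lemma bumpf_derive p t : is_derive t 1 (bumpf p) (bumpf (dbump p) t).
Proof.
have [t0|t0|t0] := ltgtP t 0.
- rewrite [X in is_derive _ _ _ X]bumpf_le0 ?(ltW t0)//.
  suff H : \near t, cst (0 : R) t = bumpf p t.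
    exact: near_eq_is_derive H (is_derive_cst 0 t 1).
  by near=> s; rewrite bumpf_le0// ltW//; near: s; exact: lt_nbhsl.
- rewrite [X in is_derive _ _ _ X]bumpf_gt0//.
  suff H : \near t, p.[t^-1] * expR (- t^-1) = bumpf p t.
    apply: (near_eq_is_derive H).
    have d1 : is_derive t 1 (fun s => s^-1) (- t ^- 2).
      have := @is_deriveV R id t 1 1 (lt0r_neq0 t0) (is_derive_id _ _).
      by rewrite scaler1.
    have d2 := is_derive1_comp (is_derive_poly p (t^-1)) d1.
    have d3 := @is_derive1_comp _ expR (fun s => - s^-1) t _ _ (is_derive_expR (- t^-1)) (is_deriveN d1).
    refine (is_derive_eq (is_deriveM d2 d3) _).
    rewrite /= /dbump !hornerE/= exprVn /GRing.scale/=; ring.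
  by near=> s; rewrite bumpf_gt0//; near: s; exact: lt_nbhsr.
- rewrite t0 [X in is_derive _ _ _ X]bumpf_le0 ?lexx//.
  (* Two factors t are extracted: one cancels the division by h, the other gives the bound C |h| on
     the difference quotient. *)
  have [C C0 HC] := bumpf_bounded ('X * ('X * p)).
  have cv : h^-1 *: (bumpf p (h *: 1 + 0) - bumpf p 0) @[h --> 0^'] --> (0 : R).
    apply: (@squeeze_cvgr _ _ _ _ (fun h => - (C * `|h|)) (fun h => C * `|h|)).
    + near=> h; rewrite -ler_norml (bumpf_le0 _ (lexx 0)) subr0 addr0 /GRing.scale/= mulr1.
      have [h0|h0] := ltP 0 h; last by rewrite bumpf_le0// mulr0 normr0 mulr_ge0.
      rewrite bumpfMX// bumpfMX// 2!normrM normrM mulrA -normrM mulVf ?gt_eqF// normr1 mul1r.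
      by rewrite mulrC ler_wpM2r.
    + rewrite -[X in _ --> X]oppr0; apply: cvgN.
      apply: cvg_within_filter.
      have : C * `|h| @[h --> (0:R)] --> C * `|0 : R|.
        by apply: cvgMr; apply: cvg_norm; exact: cvg_id.
      by rewrite normr0 mulr0.
    + apply: cvg_within_filter.
      have : C * `|h| @[h --> (0:R)] --> C * `|0 : R|.
        by apply: cvgMr; apply: cvg_norm; exact: cvg_id.
      by rewrite normr0 mulr0.
  split; first by apply/cvg_ex; exists 0; exact: cv.
  exact: (cvg_lim _ cv).
Unshelve. all: by end_near. Qed.

(** The polynomials 1, X^2 and [dbump] X^2 are successive images under [dbump], so these are
    exp(-1/t) and its first two derivatives. *)
Definition flat t : R := bumpf 1 t.
Definition flat' t : R := bumpf 'X^2 t.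
Definition flat'' t : R := bumpf (dbump 'X^2) t.

Lemma flat_derive t : is_derive t 1 flat (flat' t).
Proof.
by apply: is_derive_eq (bumpf_derive 1 t) _; rewrite /dbump derivC subr0 mulr1.
Qed.

Lemma flat'_derive t : is_derive t 1 flat' (flat'' t).
Proof. exact: bumpf_derive. Qed.

Lemma flat_ge0 t : 0 <= flat t.
Proof. by rewrite /flat /bumpf; case: ifP => // _; rewrite hornerE mul1r expR_ge0. Qed.

Lemma flat_le1 t : flat t <= 1.
Proof.
rewrite /flat /bumpf; case: ifPn => [t0|_]; last exact: ler01.
by rewrite hornerE mul1r -expR0 ler_expR oppr_le0 invr_ge0 ltW.
Qed.

Lemma flat_gt0 t : (0 < flat t) = (0 < t).
Proof. by rewrite /flat /bumpf; case: ifP => // _; rewrite ?ltxx// hornerE mul1r expR_gt0. Qed.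

Lemma flat_le0 t : t <= 0 -> flat t = 0.
Proof. exact: bumpf_le0. Qed.

Lemma flat'_ge0 t : 0 <= flat' t.
Proof.
rewrite /flat' /bumpf; case: ifP => // t0.
by rewrite hornerXn mulr_ge0 ?expR_ge0// exprn_ge0// invr_ge0 ltW.
Qed.

Lemma flat'_gt0 t : (0 < flat' t) = (0 < t).
Proof.
rewrite /flat' /bumpf; case: ifPn => [t0|_]; last by rewrite ltxx.
by rewrite hornerXn mulr_gt0 ?expR_gt0// exprn_gt0// invr_gt0.
Qed.

Lemma flat'_le2 t : flat' t <= 2.
Proof.
rewrite /flat' /bumpf; case: ifPn => // t0.
by rewrite hornerXn (expR_ge_pow 2)// invr_ge0 ltW.
Qed.

(** With [flat'_le_inv2], the decay that later compensates the steep gradients of the cutoffs near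
    the sphere. *)
Lemma flat'_le_inv t : 0 < t -> t * flat' t <= 1.
Proof.
move=> t0; rewrite /flat' bumpf_gt0// hornerXn mulrA expr2 mulrA divff ?gt_eqF// mul1r.
by apply: (expR_ge_pow 1); rewrite invr_ge0 ltW.
Qed.

Lemma flat_ge t : 0 < t -> 1 - t^-1 <= flat t.
Proof.
by move=> t0; rewrite /flat bumpf_gt0// hornerE mul1r; apply: expR_ge1Dx.
Qed.

Lemma flat'_le_inv2 t : 0 < t -> flat' t <= t^-1 ^+ 2.
Proof.
move=> t0; rewrite /flat' bumpf_gt0// hornerXn ler_piMr ?exprn_ge0 ?invr_ge0 ?ltW//.
by rewrite -expR0 ltr_expR oppr_lt0 invr_gt0.
Qed.

Lemma flat_lip s t : `|flat s - flat t| <= 2 * `|s - t|.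
Proof.
wlog st : s t / t < s.
  move=> H; have [|/H//|->] := ltgtP s t; last by rewrite !subrr !normr0 mulr0.
  by rewrite distrC [X in _ * X]distrC => /H.
have [|c _ ->] := MVT st (fun x _ => flat_derive x).
  apply: continuous_subspaceT => x; apply: differentiable_continuous.
  exact/derivable1_diffP/(@ex_derive _ _ _ _ _ _ _ (flat_derive x)).
by rewrite normrM ler_wpM2r// ger0_norm ?flat'_ge0// flat'_le2.
Qed.

End bumpf.

(** * Smooth functions and test functions *)

Section smooth_calculus.
Context {R : realType} {n : nat}.
Implicit Types (f g u : 'rV[R]_n -> R).

(** A directional derivative is the derivative at 0 of the restriction to the line t -> t v + x,
    which reduces the claim to the chain rule in one variable. *)
Lemma is_derive_comp (F : R -> R) f x v df dF :
  is_derive x v f df -> is_derive (f x) 1 F dF ->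
  is_derive x v (F \o f) (dF * df).
Proof.
have line (k : 'rV[R]_n -> R) :
    (fun h : R => h^-1 *: ((k \o shift x) (h *: v) - k x)) =
    (fun h : R => h^-1 *: (((fun t : R => k (t *: v + x)) \o shift 0) (h *: (1 : R))
       - k (0 *: v + x))).
  by apply/funext => h /=; rewrite addr0 scale0r add0r /GRing.scale/= mulr1.
have lineP (k : 'rV[R]_n -> R) (d : R) :
    is_derive x v k d <-> is_derive (0 : R) 1 (fun t : R => k (t *: v + x)) d.
  by split => -[h1 h2]; split; move: h1 h2; rewrite /derivable /derive (line k).
move=> /lineP hf hF; apply/lineP.
apply: (@is_derive1_comp _ F (fun t => f (t *: v + x))) => //.
by rewrite scale0r add0r.
Qed.

Lemma partialE i f x df : is_derive x 'e_i f df -> partial i f x = df.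
Proof. by move=> H; rewrite /partial derive_val. Qed.

Lemma is_derive_coord (i j : 'I_n) x :
  is_derive x 'e_i (fun y : 'rV[R]_n => y ord0 j) (i == j)%:R.
Proof.
have cv : h^-1 *: (((fun y : 'rV[R]_n => y ord0 j) \o shift x) (h *: 'e_i) - x ord0 j)
    @[h --> (0 : R)^'] --> ((i == j)%:R : R).
  apply: cvg_near_cst; near=> h.
  rewrite /= !mxE eqxx/= addrK /GRing.scale/= mulrA mulVf ?mul1r; last first.
    by near: h; exact: nbhs_dnbhs_neq.
  by rewrite eq_sym.
split; first by apply/cvg_ex; exists (i == j)%:R; exact: cv.
exact: (cvg_lim _ cv).
Unshelve. all: by end_near. Qed.

(* The partial derivative of a generated function is again generated, so one
   induction covers the iterated derivatives in [smooth]; [gen_smooth] makes the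
   closure properties of [smooth] itself a special case. *)
Inductive smooth_gen : ('rV[R]_n -> R) -> Prop :=
| gen_smooth f : smooth f -> smooth_gen f
| gen_cst c : smooth_gen (fun=> c)
| gen_coord i : smooth_gen (fun x => x ord0 i)
| gen_add f g : smooth_gen f -> smooth_gen g -> smooth_gen (fun x => f x + g x)
| gen_mul f g : smooth_gen f -> smooth_gen g -> smooth_gen (fun x => f x * g x)
| gen_bumpf p f : smooth_gen f -> smooth_gen (bumpf p \o f).

Lemma partials_rcons s i u : partials (rcons s i) u = partials s (partial i u).
Proof. by rewrite /partials -cats1 foldr_cat. Qed.

Lemma smooth_gen_partial f : smooth_gen f -> continuous f /\
  forall i, exists2 f', smooth_gen f' & forall x, is_derive x 'e_i f (f' x).
Proof.
elim => {f} [f sf|c|j|f g sf [cf df] sg [cg dg]|f g sf [cf df] sg [cg dg]|p f sf [cf df]].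
- split; first exact: (sf [::]).1.
  move=> i; exists (partial i f).
    by apply: gen_smooth => s; rewrite -partials_rcons; exact: sf.
  by move=> x; apply: derivableP; exact: ((sf [::]).2 i x).
- split; first exact: cst_continuous.
  by move=> i; exists (fun=> 0); [exact: gen_cst|move=> x; exact: is_derive_cst].
- split; first exact: coord_continuous.
  move=> i; exists (fun=> (i == j)%:R); [exact: gen_cst|move=> x; exact: is_derive_coord].
- split; first by move=> x; exact: (continuousD (cf x) (cg x)).
  move=> i; have [f' sf' hf] := df i; have [g' sg' hg] := dg i.
  by exists (fun x => f' x + g' x); [exact: gen_add|move=> x; exact: is_deriveD].
- split; first by move=> x; exact: (continuousM (cf x) (cg x)).
  move=> i; have [f' sf' hf] := df i; have [g' sg' hg] := dg i.
  exists (fun x => f x * g' x + g x * f' x); last by move=> x; exact: is_deriveM.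
  by apply: gen_add; apply: gen_mul.
- split.
    move=> x; apply: continuous_comp; first exact: cf.
    apply: differentiable_continuous; apply/derivable1_diffP.
    exact: (@ex_derive _ _ _ _ _ _ _ (bumpf_derive p (f x))).
  move=> i; have [f' sf' hf] := df i.
  exists (fun x => (bumpf (dbump p) \o f) x * f' x).
    by apply: gen_mul => //; exact: gen_bumpf.
  by move=> x; apply: is_derive_comp => //; exact: bumpf_derive.
Qed.

Lemma smooth_genP f : smooth_gen f -> smooth f.
Proof.
move=> sf s; have : smooth_gen (partials s f).
  elim: s => //= i s IH; have [_ /(_ i)[f' sf' hf']] := smooth_gen_partial IH.
  by rewrite (_ : partial i _ = f')//; apply/funext => x; exact: partialE.
move=> /smooth_gen_partial[cf df]; split => // i x.
by have [f' _ hf'] := df i; exact: (@ex_derive _ _ _ _ _ _ _ (hf' x)).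
Qed.

Lemma smooth_cst (c : R) : smooth (fun _ : 'rV[R]_n => c).
Proof. exact/smooth_genP/gen_cst. Qed.

Lemma smooth_coord i : smooth (fun x : 'rV[R]_n => x ord0 i).
Proof. exact/smooth_genP/gen_coord. Qed.

Lemma smoothD f g : smooth f -> smooth g -> smooth (fun x => f x + g x).
Proof. by move=> sf sg; apply/smooth_genP/gen_add; exact: gen_smooth. Qed.

Lemma smoothM f g : smooth f -> smooth g -> smooth (fun x => f x * g x).
Proof. by move=> sf sg; apply/smooth_genP/gen_mul; exact: gen_smooth. Qed.

Lemma smooth_bumpf p f : smooth f -> smooth (fun x => bumpf p (f x)).
Proof. by move=> sf; apply/smooth_genP; apply: (gen_bumpf p); exact: gen_smooth. Qed.

Lemma smoothZ c f : smooth f -> smooth (fun x => c * f x).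
Proof. by apply: smoothM; exact: smooth_cst. Qed.

Lemma smoothB f g : smooth f -> smooth g -> smooth (fun x => f x - g x).
Proof.
move=> sf sg; rewrite (_ : (fun x => _) = (fun x => f x + -1 * g x)).
  by apply: smoothD sf _; exact: smoothZ sg.
by apply/funext => x; rewrite mulN1r.
Qed.

Lemma smooth_sum (I : Type) (s : seq I) (F : I -> 'rV[R]_n -> R) :
  (forall i, smooth (F i)) -> smooth (fun x => \sum_(i <- s) F i x).
Proof.
move=> sF; elim: s => [|i s IH].
  by rewrite (_ : (fun x => _) = fun=> 0); [exact: smooth_cst|apply/funext => x; rewrite big_nil].
have := smoothD (sF i) IH; congr smooth.
by apply/funext => x; rewrite big_cons.
Qed.

Lemma smooth_partial i f : smooth f -> smooth (partial i f).
Proof. by move=> sf s; rewrite -partials_rcons; exact: sf. Qed.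

Lemma smooth_continuous f : smooth f -> continuous f.
Proof. by move=> /(_ [::])[]. Qed.

Lemma smooth_is_derive f i x : smooth f -> is_derive x 'e_i f (partial i f x).
Proof. by move=> sf; apply: derivableP; exact: ((sf [::]).2 i x). Qed.

Definition sqn (x : 'rV[R]_n) : R := \sum_i x ord0 i ^+ 2.

Lemma sqn_ge0 x : 0 <= sqn x.
Proof. by apply: sumr_ge0 => i _; exact: sqr_ge0. Qed.

Lemma enorm_sqr x : enorm x ^+ 2 = sqn x.
Proof. by rewrite sqr_sqrtr// sqn_ge0. Qed.

Lemma eballE r x : 0 <= r -> eball n r x <-> sqn x < r ^+ 2.
Proof.
by move=> r0; rewrite -enorm_sqr /eball /= ltr_pXn2r// nnegrE sqrtr_ge0.
Qed.

Lemma smooth_sqn (y : 'rV[R]_n) : smooth (fun x => sqn (x - y)).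
Proof.
apply: smooth_sum => i; rewrite (_ : (fun x : 'rV__ => _) =
    (fun x : 'rV_n => (x ord0 i - y ord0 i) * (x ord0 i - y ord0 i))).
  by apply: smoothM; apply: smoothB; (exact: smooth_coord || exact: smooth_cst).
by apply/funext => x; rewrite !mxE expr2.
Qed.

Lemma is_derive_sqn (y x : 'rV[R]_n) i :
  is_derive x 'e_i (fun x => sqn (x - y)) (2 * (x ord0 i - y ord0 i)).
Proof.
have : forall s : seq 'I_n, is_derive x 'e_i (fun x : 'rV_n => \sum_(j <- s) (x - y) ord0 j ^+ 2)
    (\sum_(j <- s) (i == j)%:R * (2 * (x ord0 j - y ord0 j))).
  elim=> [|j s IH].
    under eq_fun do rewrite big_nil; rewrite big_nil; exact: is_derive_cst.
  under eq_fun do rewrite big_cons; rewrite big_cons; apply: is_deriveD.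
  have d1 := is_deriveB (is_derive_coord i j x) (is_derive_cst (y ord0 j) x 'e_i).
  rewrite (_ : (fun _ => _) = (fun x0 : 'rV_n => (x0 ord0 j - y ord0 j) * (x0 ord0 j - y ord0 j))).
    by refine (is_derive_eq (is_deriveM d1 d1) _); rewrite /= /GRing.scale/= /cst !fctE subr0; ring.
  by apply/funext => z; rewrite !mxE expr2.
move=> /(_ (index_enum _)) /is_derive_eq; apply.
rewrite (bigD1 i)//= eqxx mul1r big1 ?addr0// => j ji.
by rewrite eq_sym (negbTE ji) mul0r.
Qed.

Lemma is_derive_sqn0 (x : 'rV[R]_n) i : is_derive x 'e_i sqn (2 * x ord0 i).
Proof.
have := is_derive_sqn 0 x i; rewrite mxE subr0.
by rewrite (_ : (fun _ => _) = sqn)//; apply/funext => z; rewrite subr0.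
Qed.

Lemma smooth_sqn0 : smooth sqn.
Proof.
by have := smooth_sqn 0; rewrite (_ : (fun _ => _) = sqn)//; apply/funext => z; rewrite subr0.
Qed.

End smooth_calculus.

Section test_functions.
Context {R : realType} {n : nat}.
Local Notation supp := Defs.support.
Implicit Types (f g u phi psi : 'rV[R]_n -> R) (Omega : set 'rV[R]_n).

Lemma closed_sqn_ball (rho : R) : closed [set x : 'rV[R]_n | sqn x <= rho].
Proof.
apply: (@closed_comp _ _ (@sqn R n) [set t | t <= rho]); last exact: closed_le.
by move=> x _; exact: (smooth_continuous smooth_sqn0).
Qed.

Lemma open_sqn_ball (rho : R) : open [set x : 'rV[R]_n | sqn x < rho].
Proof.
apply: (@open_comp _ _ (@sqn R n) [set t | t < rho]); last exact: open_lt.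
by move=> x _; exact: (smooth_continuous smooth_sqn0).
Qed.

Lemma coord_le_sqn (x : 'rV[R]_n) i : x ord0 i ^+ 2 <= sqn x.
Proof.
by rewrite /sqn (bigD1 i)//= lerDl; apply: sumr_ge0 => j _; exact: sqr_ge0.
Qed.

Lemma compact_sqn_ball (rho : R) : compact [set x : 'rV[R]_n | sqn x <= rho].
Proof.
apply: (@subclosed_compact _ _ [set v : 'rV[R]_n | forall i, `[- (1 + rho), 1 + rho]%classic (v ord0 i)]).
- exact: closed_sqn_ball.
- by apply: (@rV_compact _ _ (fun=> `[- (1 + rho), 1 + rho]%classic)) => i; exact: segment_compact.
- move=> x /= xr i; have h := le_trans (coord_le_sqn x i) xr.
  have r0 := le_trans (sqn_ge0 x) xr.
  rewrite in_itv/= -ler_norml -(@ler_pXn2r _ 2) ?nnegrE ?addr_ge0// real_normK ?num_real//.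
  by apply: le_trans h _; nra.
Qed.

Lemma closure_sub_closed (T : topologicalType) (A B : set T) :
  closed B -> A `<=` B -> closure A `<=` B.
Proof. by move=> cB AB; rewrite [B](closure_id _).1//; exact: closure_subset. Qed.

Lemma support_sub phi x : phi x != 0 -> supp phi x.
Proof. by move=> h; apply: (@subset_closure _ [set y | phi y != 0]). Qed.

(** The gap between rho and r^2 keeps the closed support, a subset of a compact ball, inside the
    open ball. *)
Lemma test_function_sqn phi (rho r : R) : smooth phi ->
  0 <= r -> rho < r ^+ 2 -> (forall x, phi x != 0 -> sqn x <= rho) ->
  test_function (eball n r) phi.
Proof.
move=> sphi r0 rr H.
have sub : supp phi `<=` [set x | sqn x <= rho].
  exact: closure_sub_closed (@closed_sqn_ball rho) H.
split => //.
  by apply: (subclosed_compact _ (@compact_sqn_ball rho) sub); exact: closed_closure.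
by move=> x /sub /= h; apply/eballE => //; exact: le_lt_trans rr.
Qed.

Lemma test_function_support Omega phi psi : test_function Omega phi -> smooth psi ->
  (forall x, psi x != 0 -> supp phi x) -> test_function Omega psi.
Proof.
move=> [_ cphi sphi] spsi H.
have sub : supp psi `<=` supp phi.
  exact: closure_sub_closed (@closed_closure _ _) H.
split => //; last exact: subset_trans sphi.
by apply: (subclosed_compact _ cphi sub); exact: closed_closure.
Qed.

Lemma test_functionMr Omega phi g : test_function Omega phi -> smooth g ->
  test_function Omega (fun x => phi x * g x).
Proof.
move=> tphi sg; apply: (test_function_support tphi).
  by case: tphi => sphi _ _; exact: smoothM.
move=> x; rewrite mulf_eq0 negb_or => /andP[+ _]; exact: support_sub.
Qed.

(** Off its closed support the function vanishes in a whole neighbourhood, hence so does its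
    derivative. *)
Lemma partial_support i phi x : partial i phi x != 0 -> supp phi x.
Proof.
move=> /eqP; apply: contra_notP => nx; apply: partialE.
have H : \near x, cst (0 : R) x = phi x.
  have : nbhs x (~` supp phi).
    by apply: open_nbhs_nbhs; split => //; apply: closed_openC; exact: closed_closure.
  apply: filterS => y ny; apply/esym/eqP/negPn/negP => /support_sub; exact: ny.
exact: near_eq_is_derive H (is_derive_cst 0 x _).
Qed.

Lemma test_function_partial Omega i phi : test_function Omega phi ->
  test_function Omega (partial i phi).
Proof.
move=> tphi; apply: (test_function_support tphi) => [|x]; last exact: partial_support.
by apply: smooth_partial; case: tphi.
Qed.

Lemma test_functionD Omega phi psi : test_function Omega phi ->
  test_function Omega psi -> test_function Omega (fun x => phi x + psi x).
Proof.
move=> [sphi cphi iphi] [spsi cpsi ipsi].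
have cl : closed (supp phi `|` supp psi) by apply: closedU; exact: closed_closure.
have sub : supp (fun x => phi x + psi x) `<=` supp phi `|` supp psi.
  apply: closure_sub_closed cl _ => x /= h.
  have [px|px] := eqVneq (phi x) 0; [right|left]; apply: support_sub => //.
  by move: h; rewrite px add0r.
split; first exact: smoothD.
  apply: (subclosed_compact _ _ sub); [exact: closed_closure|exact: compactU].
by apply: (subset_trans sub) => x [/iphi|/ipsi].
Qed.

Lemma test_function_out Omega phi x : test_function Omega phi -> ~ Omega x -> phi x = 0.
Proof.
move=> [_ _ h] nx; apply/eqP/negPn/negP => /support_sub px; exact: nx (h _ px).
Qed.

Lemma test_function_bounded Omega phi : test_function Omega phi ->
  exists2 C : R, 0 <= C & forall x, `|phi x| <= C.
Proof.
move=> [sphi cphi _].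
have [e|/set0P ne] := eqVneq (supp phi) set0.
  exists 0 => // x; rewrite normr_le0; apply/negPn/negP => /support_sub.
  by rewrite e.
have [|c _ hc] := @EVT_max_rV _ _ (fun x => `|phi x|) _ ne cphi.
  apply: continuous_subspaceT => x; apply: continuous_comp; last exact: norm_continuous.
  exact: smooth_continuous.
exists `|phi c| => // x; have [->|/support_sub h] := eqVneq (phi x) 0.
  by rewrite normr0.
by apply: hc; rewrite inE.
Qed.

End test_functions.

(** * Lebesgue measure and integration on R^n *)

Section rV_measure.
Context {R : realType} {n : nat}.
Local Notation mu := (lebesgue_rV R n).
Implicit Types (a b : 'I_n -> R) (x y : 'rV[R]_n) (f : 'rV[R]_n -> R).

Definition cbox a b : set 'rV[R]_n := [set x | forall i, x ord0 i \in `[a i, b i]].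

(** Open half-spaces generate the coordinate sigma-algebra; this serves both for boxes and for the
    approximable sets. *)
Lemma measurable_rV_gen (G : set (set 'rV[R]_n)) :
  (forall i c, <<s G >> [set x : 'rV[R]_n | c < x ord0 i]) ->
  forall A : set 'rV[R]_n, measurable A -> <<s G >> A.
Proof.
move=> H; apply: smallest_sub; first exact: smallest_sigma_algebra.
rewrite -bigcup_seq; apply: bigcup_sub => i _ A [B mB <-].
have mc : measurable_fun [set: g_sigma_algebraType G] (fun x : 'rV[R]_n => x ord0 i).
  apply: (measurability _ (RGenOInfty.measurableE R)) => _ [_ [c ->] <-].
  rewrite setTI (_ : _ @^-1` _ = [set x : 'rV[R]_n | c < x ord0 i]); first exact: H.
  by apply/seteqP; split => x /=; rewrite in_itv/= andbT.
exact: mc.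
Qed.

Lemma measurable_halfspace i c : measurable [set x : 'rV[R]_n | c < x ord0 i].
Proof.
rewrite (_ : [set _ | _] = (fun x : 'rV[R]_n => x ord0 i) @^-1` `]c, +oo[%classic).
  by rewrite -[X in measurable X]setTI; exact: measurable_rV_coord.
by apply/seteqP; split => x /=; rewrite in_itv/= andbT.
Qed.

Lemma measurable_cbox a b : measurable (cbox a b).
Proof.
rewrite (_ : cbox a b = \bigcap_(j in [set: 'I_n])
    ((fun x : 'rV[R]_n => x ord0 j) @^-1` `[a j, b j]%classic)).
  apply: fin_bigcap_measurable => // j _.
  by rewrite -[X in measurable X]setTI; exact: measurable_rV_coord.
by apply/seteqP; split => [x h j _|x h j]; [exact: h|exact: (h j I)].
Qed.

Lemma coord_le_nat x : exists k : nat, forall i, `|x ord0 i| <= k%:R.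
Proof.
exists (\max_(i < n) (Num.truncn `|x ord0 i|).+1) => i.
have /ltW/le_trans := truncnS_gt `|x ord0 i|; apply.
by rewrite ler_nat; apply: (leq_bigmax_cond (F := fun i => (Num.truncn `|x ord0 i|).+1)).
Qed.

Lemma measurable_rV_cbox :
  measurable = <<s [set A | exists a b, A = cbox a b] >> :> set (set 'rV[R]_n).
Proof.
apply/seteqP; split; last first.
  apply: smallest_sub; first exact: sigma_algebra_measurable.
  by move=> _ [a [b ->]]; exact: measurable_cbox.
move=> A; apply: measurable_rV_gen => i c.
(* The margin 1/(k+1) in direction [i] turns the strict inequality into closed ones, while the other
   sides grow to the whole line. *)
rewrite (_ : [set _ | _] = \bigcup_k cbox
    (fun j => if j == i then c + k.+1%:R^-1 else - k%:R) (fun=> k%:R)).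
  by apply: sigma_algebra_bigcup => k; apply: sub_sigma_algebra; do 2 eexists; reflexivity.
apply/seteqP; split => [x /= cx|x [k _ /(_ i)]]; last first.
  by rewrite eqxx in_itv/= => /andP[h _]; apply: lt_le_trans h; rewrite ltrDl invr_gt0.
have [k1 h1] := coord_le_nat x.
have [k2 _ h2] : \forall k \near \oo, k.+1%:R^-1 < x ord0 i - c.
  by apply: (near_infty_natSinv_lt (PosNum _)); rewrite subr_gt0.
exists (maxn k1 k2) => // j; have := h1 j; rewrite ler_norml => /andP[h3 h4].
have le1 : (k1%:R : R) <= (maxn k1 k2)%:R by rewrite ler_nat leq_maxl.
rewrite in_itv/=; apply/andP; split; last exact: le_trans le1.
case: eqP => [->|_]; last by apply: le_trans h3; rewrite lerN2.
by have /ltW := h2 _ (leq_maxr k1 k2); rewrite lerBrDl.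
Qed.

Lemma cbox_ltoo a b : exists2 s : R, 0 <= s & mu (cbox a b) = s%:E.
Proof.
have [ab|/existsNP[i /negP ab]] := pselect (forall i, a i <= b i).
  exists (\prod_(i < n) (b i - a i)); last exact: lebesgue_rV_box.
  by apply: prodr_ge0 => i _; rewrite subr_ge0.
exists 0 => //; rewrite (_ : cbox a b = set0) ?measure0//.
apply/seteqP; split => // x /(_ i); rewrite in_itv/= => /andP[h1 h2].
by move: ab; rewrite (le_trans h1 h2).
Qed.

(** Boxes are stable under intersection, generate the sigma-algebra, and exhaust the space with
    finite measure. *)
Lemma lebesgue_rV_unique (m : {measure set 'rV[R]_n -> \bar R}) :
  (forall a b, (forall i, a i <= b i) -> m (cbox a b) = (\prod_(i < n) (b i - a i))%:E) ->
  forall A, measurable A -> m A = mu A.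
Proof.
move=> H; apply: (@measure_unique _ _ _ [set A | exists a b, A = cbox a b]
    (fun k : nat => cbox (fun=> - k%:R) (fun=> k%:R))).
- exact: measurable_rV_cbox.
- move=> _ _ [a [b ->]] [a' [b' ->]].
  exists (fun i => Num.max (a i) (a' i)), (fun i => Num.min (b i) (b' i)).
  apply/seteqP; split => [x [h h'] i|x h].
    have := h i; have := h' i; rewrite !in_itv/= ge_max le_min.
    by move=> /andP[-> ->] /andP[-> ->].
  by split => i; have := h i; rewrite !in_itv/= ge_max le_min => /andP[/andP[h1 h2] /andP[h3 h4]]; apply/andP.
- by move=> k; do 2 eexists; reflexivity.
- apply/seteqP; split => // x _; have [k hk] := coord_le_nat x.
  by exists k => // i; rewrite in_itv/= -ler_norml.
- move=> _ [a [b ->]]; have [ab|/existsNP[i /negP ab]] := pselect (forall i, a i <= b i).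
    by rewrite H// -lebesgue_rV_box.
  rewrite (_ : cbox a b = set0) ?measure0//.
  apply/seteqP; split => // x /(_ i); rewrite in_itv/= => /andP[h1 h2].
  by move: ab; rewrite (le_trans h1 h2).
- by move=> k; rewrite H ?ltry// => i; rewrite -subr_ge0 opprK addr_ge0.
Qed.

Lemma measurable_affine (c : R) y : measurable_fun setT (fun z : 'rV[R]_n => y + c *: z).
Proof.
apply: measurable_fun_rV => i; under eq_fun do rewrite !mxE.
by apply: measurable_funD => //; apply: measurable_funM => //; exact: measurable_rV_coord.
Qed.

Lemma cbox_affine (c : R) y a b : 0 < c ->
  (fun z : 'rV[R]_n => (y + c *: z)%R) @^-1` cbox a b =
  cbox (fun i => (a i - y ord0 i) / c) (fun i => (b i - y ord0 i) / c).
Proof.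
move=> c0; apply/seteqP; split => z h i; have := h i;
  by rewrite !mxE !in_itv/= ler_pdivrMr// ler_pdivlMr// lerBlDl lerBrDl (mulrC c).
Qed.

(** The pushforward under the affine map, multiplied by c^n, gives every box its volume, and
    uniqueness identifies it with Lebesgue measure. *)
Lemma lebesgue_rV_affine (c : R) y (A : set 'rV[R]_n) : 0 < c -> measurable A ->
  ((c ^+ n)%:E * mu ((fun z : 'rV[R]_n => (y + c *: z)%R) @^-1` A) = mu A)%E.
Proof.
move=> c0; have cn0 : 0 <= c ^+ n by rewrite exprn_ge0// ltW.
have mT := measurable_affine c y.
pose m : {measure set 'rV[R]_n -> \bar R} :=
  mscale (NngNum cn0) (pushforward mu (fun z : 'rV[R]_n => y + c *: z)).
move=> mA; suff H a b : (forall i, a i <= b i) ->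
    m mT (cbox a b) = (\prod_(i < n) (b i - a i))%:E.
  exact: (lebesgue_rV_unique H mA).
move=> ab; rewrite /m /= /mscale /= /pushforward cbox_affine// lebesgue_rV_box.
  rewrite -EFinM; congr EFin.
  rewrite -{1}(card_ord n) -prodr_const -big_split/=; apply: eq_bigr => i _.
  by rewrite -mulrBl mulrCA divff ?gt_eqF// mulr1; ring.
by move=> i; rewrite ler_pM2r ?invr_gt0// lerD2r.
Qed.

Lemma ge0_integral_rV_affine (c : R) y (f : 'rV[R]_n -> \bar R) : 0 < c ->
  measurable_fun setT f -> (forall x, 0 <= f x)%E ->
  (\int[mu]_x f x = (c ^+ n)%:E * \int[mu]_z f (y + c *: z)%R)%E.
Proof.
move=> c0 mf f0; have cn0 : 0 <= c ^+ n by rewrite exprn_ge0// ltW.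
have mT := measurable_affine c y.
pose m : {measure set 'rV[R]_n -> \bar R} := pushforward mu (fun z : 'rV[R]_n => y + c *: z).
have -> : (\int[mu]_x f x = \int[mscale (NngNum cn0) (m mT)]_x f x)%E.
  apply: eq_measure_integral => A mA _.
  exact/esym/(lebesgue_rV_affine y c0 mA).
rewrite ge0_integral_mscale//; congr (_ * _)%E.
by rewrite ge0_integral_pushforward// preimage_setT.
Qed.

(** Positive and negative parts are translated separately, so measurability is enough. *)
Lemma Rintegral_rV_shift y (f : 'rV[R]_n -> R) : measurable_fun setT f ->
  \int[mu]_x f x = \int[mu]_x f (x + y).
Proof.
move=> mf; rewrite /Rintegral; congr fine; rewrite integralE [RHS]integralE.
have mf' : measurable_fun setT (EFin \o f) by exact/measurable_EFinP.
have H g : measurable_fun setT g -> (forall x, 0 <= g x)%E ->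
    (\int[mu]_x g x = \int[mu]_x g (x + y)%R)%E.
  move=> mg g0; rewrite (ge0_integral_rV_affine y ltr01 mg g0) expr1n mul1e.
  by apply: eq_integral => x _; rewrite scale1r addrC.
congr (_ - _)%E.
  rewrite (H _ (measurable_funepos mf') (funepos_ge0 _)).
  by apply: eq_integral => x _; rewrite !funeposE.
rewrite (H _ (measurable_funeneg mf') (funeneg_ge0 _)).
by apply: eq_integral => x _; rewrite !funenegE.
Qed.

Lemma open_rV_measurable (U : set 'rV[R]_n) : open U -> measurable U.
Proof.
(* Sup-norm balls with rational centre and radius 1/(k+1): a countable family, of which the members
   contained in [U] cover [U]. *)
move=> oU; pose B (p : 'rV[rat]_n * nat) : set 'rV[R]_n :=
  [set x | forall i, `|ratr (p.1 ord0 i) - x ord0 i| < p.2.+1%:R^-1].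
rewrite (_ : U = \bigcup_(p : 'rV[rat]_n * nat) (if `[< B p `<=` U >] then B p else set0)).
  apply: countable_bigcupT_measurable => // p; case: ifP => // _.
  rewrite (_ : B p = \bigcap_(j in [set: 'I_n])
      ((fun x : 'rV[R]_n => x ord0 j) @^-1` (ball (ratr (p.1 ord0 j) : R) p.2.+1%:R^-1))).
    apply: fin_bigcap_measurable => // j _.
    rewrite -[X in measurable X]setTI; apply: measurable_rV_coord => //.
    exact: measurable_ball.
  by apply/seteqP; split => [x h j _|x h j]; [exact: h|exact: (h j I)].
apply/seteqP; split => [x Ux|x [p _]]; last by case: ifPn => // /asboolP; apply.
have /nbhs_ballP[e /= e0 He] : nbhs x U by exact: open_nbhs_nbhs.
have [k _ /(_ k (leqnn _)) hk] := near_infty_natSinv_lt (PosNum (divr_gt0 e0 (ltr0n _ 2))).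
rewrite /= in hk; have k0 : 0 < k.+1%:R^-1 :> R by rewrite invr_gt0.
move: hk k0; rewrite /B; set d := k.+1%:R^-1 => hk k0.
have q_ i : {q : rat | `|ratr q - x ord0 i| < d}.
  apply/cid; have [|q] := @rat_in_itvoo R (x ord0 i - d) (x ord0 i + d).
    by lra.
  by rewrite in_itv/= => h; exists q; rewrite ltr_norml; move/andP: h => [h1 h2]; apply/andP; split; lra.
exists (\row_i sval (q_ i), k) => //; rewrite ifT.
  by move=> i /=; rewrite mxE; case: (q_ i).
apply/asboolP => z /= hz; apply: He; split=> // i j; rewrite (ord1 i) /ball/=.
have := hz j; rewrite mxE => h1; case: (q_ j) h1 => q /= h2 h1.
rewrite (_ : x ord0 j - z ord0 j = (ratr q - z ord0 j) - (ratr q - x ord0 j)); last by ring.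
by apply: le_lt_trans (ler_normB _ _) _; rewrite [e]splitr; apply: ltrD; exact: lt_trans hk.
Qed.

Lemma continuous_rV_measurable f (D : set 'rV[R]_n) : measurable D -> continuous f ->
  measurable_fun D f.
Proof.
move=> mD cf; apply: (@measurable_funS _ _ _ _ setT) => //.
apply: (measurability _ (RGenOpens.measurableE R)) => _ [_ [a [b ->]] <-].
rewrite setTI; apply: open_rV_measurable.
by apply: open_comp => [x _|]; [exact: cf|exact: interval_open].
Qed.

Lemma smooth_measurable f (D : set 'rV[R]_n) : measurable D -> smooth f -> measurable_fun D f.
Proof. by move=> mD /smooth_continuous; exact: continuous_rV_measurable. Qed.

End rV_measure.

(** * Integrals of real-valued functions *)

Section Rintegral_theory.
Context {d : measure_display} {T : measurableType d} {R : realType}.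
Variables (mu : {measure set T -> \bar R}) (D : set T) (mD : measurable D).
Local Notation int f := (mu.-integrable D (EFin \o f)).
Implicit Types f g h : T -> R.

Lemma int_meas f : int f -> measurable_fun D f.
Proof. by move=> /measurable_int/measurable_EFinP. Qed.

Lemma int_le f g : measurable_fun D f -> (forall x, D x -> `|f x| <= g x) ->
  int g -> int f.
Proof.
move=> mf fg; apply: le_integrable => //; first exact/measurable_EFinP.
by move=> x Dx /=; rewrite lee_fin (le_trans (fg _ Dx))// ler_norm.
Qed.

Lemma intD f g : int f -> int g -> int (fun x => f x + g x).
Proof. exact: integrableD. Qed.

Lemma intB f g : int f -> int g -> int (fun x => f x - g x).
Proof. exact: integrableB. Qed.

Lemma intZ c f : int f -> int (fun x => c * f x).
Proof. exact: integrableZl. Qed.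

Lemma int_sum (I : Type) (s : seq I) (F : I -> T -> R) :
  (forall i, int (F i)) -> int (fun x => \sum_(i <- s) F i x).
Proof.
move=> iF; elim: s => [|i s IH].
  by under eq_fun do rewrite big_nil; exact: (integrable0 mu D).
by apply: eq_integrable (intD (iF i) IH) => // x _ /=; rewrite big_cons.
Qed.

Lemma Rintegral_sum (I : Type) (s : seq I) (F : I -> T -> R) :
  (forall i, int (F i)) ->
  \int[mu]_(x in D) (\sum_(i <- s) F i x) = \sum_(i <- s) \int[mu]_(x in D) F i x.
Proof.
move=> iF; elim: s => [|i s IH].
  rewrite big_nil; under eq_Rintegral do rewrite big_nil.
  by rewrite Rintegral_cst// mul0r.
under eq_Rintegral do rewrite big_cons.
by rewrite big_cons RintegralD// ?IH//; exact: int_sum.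
Qed.

Lemma int_norm f : int f -> int (fun x => `|f x|).
Proof. exact: integrable_norm. Qed.

Lemma int_bdM (C : R) h f : measurable_fun D h -> (forall x, D x -> `|h x| <= C) ->
  int f -> int (fun x => h x * f x).
Proof.
move=> mh hC intf; apply: (@int_le _ (fun x => C * `|f x|)).
- by apply: measurable_funM => //; exact: int_meas.
- by move=> x Dx; rewrite normrM ler_wpM2r// hC.
- exact/intZ/int_norm.
Qed.

Lemma Rintegral_dct (F : nat -> T -> R) f g :
  (forall k, measurable_fun D (F k)) -> int g ->
  (forall k x, D x -> `|F k x| <= g x) ->
  (forall x, D x -> F k x @[k --> \oo] --> f x) ->
  int f /\ \int[mu]_(x in D) F k x @[k --> \oo] --> \int[mu]_(x in D) f x.
Proof.
move=> mF ig Fg cF.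
have mf : measurable_fun D f by exact: measurable_fun_cvg mF cF.
have [] := @dominated_convergence _ _ _ mu D mD (fun k => EFin \o F k) (EFin \o f) (EFin \o g).
- by move=> k; exact/measurable_EFinP.
- exact/measurable_EFinP.
- by apply: aeW => x Dx; apply: cvg_EFin; [exact: nearW|exact: cF].
- exact: ig.
- by apply: aeW => x k Dx /=; rewrite lee_fin Fg.
move=> ih _ cv; split => //.
apply: fine_cvg; rewrite fineK; last exact: integrable_fin_num.
exact: cv.
Qed.

Lemma Rintegral_ae_eq f g : measurable_fun D f -> measurable_fun D g ->
  {ae mu, forall x, D x -> f x = g x} -> \int[mu]_(x in D) f x = \int[mu]_(x in D) g x.
Proof.
move=> mf mg fg; rewrite /Rintegral; congr fine; apply: ae_eq_integral => //.
- exact/measurable_EFinP.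
- exact/measurable_EFinP.
- by apply: filterS fg => x + Dx => /(_ Dx) /= ->.
Qed.

Lemma Rintegral_ae_ge0 f : measurable_fun D f ->
  {ae mu, forall x, D x -> 0 <= f x} -> 0 <= \int[mu]_(x in D) f x.
Proof.
move=> mf f0; rewrite (@Rintegral_ae_eq f (fun x => `|f x|))//.
- by apply: Rintegral_ge0.
- exact: measurableT_comp.
- by apply: filterS f0 => x + Dx => /(_ Dx) /ger0_norm.
Qed.

Lemma Rintegral_le0_ae f : int f -> {ae mu, forall x, D x -> 0 <= f x} ->
  \int[mu]_(x in D) f x <= 0 -> {ae mu, forall x, D x -> f x = 0}.
Proof.
move=> intf f0 le0.
have mf := int_meas intf.
have e0 : \int[mu]_(x in D) `|f x| = 0.
  rewrite -(@Rintegral_ae_eq f).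
  - by apply/eqP; rewrite eq_le le0 Rintegral_ae_ge0.
  - by [].
  - exact: measurableT_comp.
  - by apply: filterS f0 => x + Dx => /(_ Dx) /ger0_norm.
have mf' : measurable_fun D (EFin \o f) by exact/measurable_EFinP.
have /(ae_eq_integral_abs mu mD mf') : (\int[mu]_(x in D) `|(EFin \o f) x| = 0)%E.
  have : (\int[mu]_(x in D) `|f x|%:E)%E = (\int[mu]_(x in D) `|f x|)%:E.
    by rewrite fineK//; apply: integrable_fin_num => //; exact: int_norm.
  by rewrite e0.
by apply: filterS => x + Dx => /(_ Dx) /= [].
Qed.

Lemma int_cst c : (mu D < +oo)%E -> int (fun=> c).
Proof.
move=> fin; apply: measurable_bounded_integrable => //.
exists `|c|; split; first exact: num_real.
by move=> x cx y _ /=; exact: ltW.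
Qed.

End Rintegral_theory.

(** * Euclidean balls and smooth cutoffs *)

Section eball_measure.
Context {R : realType} {n : nat}.
Local Notation mu := (lebesgue_rV R n).
Implicit Types (f g phi v : 'rV[R]_n -> R) (r rho : R).

Lemma eball_sqn r : 0 <= r -> eball n r = [set x : 'rV[R]_n | sqn x < r ^+ 2].
Proof. by move=> r0; apply/seteqP; split => x /eballE; exact. Qed.

Lemma open_eball r : 0 <= r -> open (eball n r : set 'rV[R]_n).
Proof. by move=> r0; rewrite eball_sqn//; exact: open_sqn_ball. Qed.

Lemma measurable_eball r : 0 <= r -> measurable (eball n r : set 'rV[R]_n).
Proof. by move=> r0; apply: open_rV_measurable; exact: open_eball. Qed.

Lemma eball_coord r (x : 'rV[R]_n) i : 0 <= r -> eball n r x -> `|x ord0 i| <= r.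
Proof.
move=> r0 /eballE -/(_ r0) /ltW h.
by rewrite -(@ler_pXn2r _ 2) ?nnegrE// real_normK ?num_real// (le_trans (coord_le_sqn x i)).
Qed.

Lemma eball_cbox r : 0 <= r -> eball n r `<=` cbox (fun=> - r) (fun=> r : R).
Proof. by move=> r0 x h i; rewrite in_itv/= -ler_norml; exact: eball_coord. Qed.

Lemma eball_finite r : 0 <= r -> (mu (eball n r) < +oo)%E.
Proof.
move=> r0; have [s _ hs] := @cbox_ltoo R n (fun=> - r) (fun=> r).
rewrite (@le_lt_trans _ _ s%:E) ?ltry// -hs le_measure ?inE//.
- exact: measurable_eball.
- exact: measurable_cbox.
- exact: eball_cbox.
Qed.

Lemma eball_sub rho r : rho <= r -> eball n rho `<=` (eball n r : set 'rV[R]_n).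
Proof. by move=> h x; rewrite /eball /= => /lt_le_trans; apply. Qed.

Lemma test_function_sub (A B : set 'rV[R]_n) phi : A `<=` B -> test_function A phi -> test_function B phi.
Proof. by move=> AB [h1 h2 h3]; split => //; exact: subset_trans AB. Qed.

Lemma test_function_measurable (A D : set 'rV[R]_n) phi : measurable D -> test_function A phi ->
  measurable_fun D phi.
Proof. by move=> mD [h1 _ _]; exact: smooth_measurable. Qed.

(** The shift by -1 makes it vanish where k (rho^2 - |x|^2) <= 1, so for k > 0 the support is
    compact in the ball; at each point of the ball it tends to 1 as k grows. *)
Definition cutoff rho (k : nat) (x : 'rV[R]_n) : R := flat ((k%:R : R) * (rho ^+ 2 - sqn x) - 1).

Lemma smooth_cutoff rho k : smooth (cutoff rho k).
Proof.
apply: smooth_bumpf; apply: smoothB; last exact: smooth_cst.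
by apply: smoothZ; apply: smoothB; [exact: smooth_cst|exact: smooth_sqn0].
Qed.

Lemma cutoff_test rho k : 0 <= rho -> test_function (eball n rho) (cutoff rho k).
Proof.
move=> rho0.
have [->|k0] := posnP k.
  rewrite (_ : cutoff rho 0 = fun=> 0); last first.
    by apply/funext => x; rewrite /cutoff mul0r sub0r flat_le0// lerN10.
  have sub : Defs.support (fun _ : 'rV[R]_n => 0 : R) `<=` set0.
    apply: closure_sub_closed; first exact: closed0.
    by move=> x /=; rewrite eqxx.
  split; [exact: smooth_cst| |by move=> x /sub].
  by rewrite (_ : Defs.support _ = set0); [exact: compact0|apply/seteqP; split].
apply: (@test_function_sqn _ _ _ (rho ^+ 2 - k%:R^-1)); first exact: smooth_cutoff.
- by [].
- by rewrite ltrBlDr ltrDl invr_gt0 ltr0n.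
move=> x; apply: contraNT; rewrite -ltNge ltrBlDr -ltrBlDl => h.
rewrite /cutoff flat_le0// subr_le0 -ler_pdivlMl ?ltr0n// mulr1.
exact: ltW.
Qed.

Lemma cutoff_ge0 rho k x : 0 <= cutoff rho k x. Proof. exact: flat_ge0. Qed.
Lemma cutoff_le1 rho k x : cutoff rho k x <= 1. Proof. exact: flat_le1. Qed.

Lemma flat_cvg1 (a b : R) : 0 < a -> flat ((k%:R : R) * a + b) @[k --> \oo] --> (1 : R).
Proof.
move=> a0; apply/cvgrPdist_le => e e0; near=> k.
rewrite ger0_norm ?subr_ge0 ?flat_le1// lerBlDr.
have t0 : 0 < e^-1 by rewrite invr_gt0.
have big : e^-1 <= k%:R * a + b.
  rewrite -lerBlDr -ler_pdivrMr//; near: k; exact: nbhs_infty_ger.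
have := @flat_ge R _ (lt_le_trans t0 big).
have : (k%:R * a + b)^-1 <= e by rewrite invf_ple ?posrE// (lt_le_trans t0 big).
by lra.
Unshelve. all: by end_near. Qed.

Lemma cutoff_cvg rho x : 0 <= rho -> eball n rho x -> cutoff rho k x @[k --> \oo] --> (1 : R).
Proof. by move=> r0 /eballE -/(_ r0) h; apply: flat_cvg1; rewrite subr_gt0. Qed.

End eball_measure.

Opaque smooth.

(** * The fundamental lemma of the calculus of variations *)

Section density.
Context {R : realType} {n : nat}.
Local Notation mu := (lebesgue_rV R n).
Implicit Types (f g phi v : 'rV[R]_n -> R) (r rho : R) (A : set 'rV[R]_n).

Section approximable.
Variables (rho : R) (v : 'rV[R]_n -> R).
Hypothesis rho0 : 0 <= rho.
Local Notation B := (eball n rho).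
Hypothesis iv : mu.-integrable B (EFin \o v).

Let dist f g := \int[mu]_(x in B) (`|f x - g x| * `|v x|).

(* The measurable sets with this property form a sigma-algebra containing the
   half-spaces. *)
Definition approximable A := forall e : R, 0 < e -> exists2 g,
  test_function B g /\ (forall x, 0 <= g x <= 1) & dist (\1_A) g < e.

Let mB : measurable (eball n rho) := measurable_eball rho0.

Let unit_dist (a b : R) : 0 <= a <= 1 -> 0 <= b <= 1 -> `|a - b| <= 1.
Proof. by move=> /andP[? ?] /andP[? ?]; rewrite ler_norml; apply/andP; split; lra. Qed.

Let indic01 A (x : 'rV[R]_n) : 0 <= (\1_A x : R) <= 1.
Proof. by rewrite indicE; case: (_ \in _); rewrite /= ?lexx ?ler01. Qed.

Let int_dist f g : measurable_fun B f -> measurable_fun B g ->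
  (forall x, 0 <= f x <= 1) -> (forall x, 0 <= g x <= 1) ->
  mu.-integrable B (EFin \o (fun x => `|f x - g x| * `|v x|)).
Proof.
move=> mf mg f01 g01; apply: (int_bdM mB (C := 1)).
- by apply: measurableT_comp => //; exact: measurable_funB.
- by move=> x _; rewrite normr_id unit_dist.
- exact: (int_norm iv).
Qed.

Let dist_cvg0 (F : nat -> 'rV[R]_n -> R) f : (forall k, measurable_fun B (F k)) ->
  measurable_fun B f ->
  (forall k x, 0 <= F k x <= 1) -> (forall x, 0 <= f x <= 1) ->
  (forall x, B x -> F k x @[k --> \oo] --> f x) ->
  forall e : R, 0 < e -> \forall k \near \oo, dist f (F k) < e.
Proof.
move=> mF mf F01 f01 cF e e0.
have [||||_] := @Rintegral_dct _ _ _ mu B mB (fun k x => `|f x - F k x| * `|v x|) (fun=> 0) (fun x => `|v x|).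
- by move=> k; apply: int_meas; exact: int_dist.
- exact: (int_norm iv).
- move=> k x Bx; rewrite normrM !normr_id; rewrite -[leRHS]mul1r ler_wpM2r//.
  exact: unit_dist.
- move=> x Bx; rewrite -(mul0r `|v x|); apply: cvgMl.
  rewrite -(normr0 R) -(subrr (f x)); apply: cvg_norm; apply: cvgB; first exact: cvg_cst.
  exact: cF.
rewrite Rintegral_cst// mul0r => /cvgrPdist_lt/(_ _ e0).
apply: filterS => k; rewrite sub0r normrN; exact: le_lt_trans (ler_norm _).
Qed.

Let test01_meas g : test_function B g -> measurable_fun B g.
Proof. exact: test_function_measurable. Qed.

(** The function 1 - g is not compactly supported in the ball, so it is multiplied by a cutoff whose
    distance to 1 costs another e/2. *)
Lemma approximable_setC A : measurable A -> approximable A -> approximable (~` A).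
Proof.
move=> mA aA e e0; have e2 : 0 < e / 2 by rewrite divr_gt0.
have [g [tg g01] dg] := aA _ e2.
have c01 k x : 0 <= @cutoff R n rho k x <= 1 by rewrite cutoff_ge0 cutoff_le1.
have mc k : measurable_fun B (@cutoff R n rho k) by apply: smooth_measurable mB _; exact: smooth_cutoff.
have one01 : 0 <= (1 : R) <= 1 by rewrite ler01 lexx.
have [k dk] : exists k, dist (fun=> 1) (cutoff rho k) < e / 2.
  have [|N _ /(_ N (leqnn _)) hN] := dist_cvg0 mc (measurable_cst _) c01 (fun=> one01) _ e2.
    by move=> x Bx; exact: cutoff_cvg.
  by exists N.
have sg : smooth g by case: tg.
exists (fun x => cutoff rho k x * (1 - g x)).
  split; first by apply: test_functionMr; [exact: cutoff_test|apply: smoothB sg; exact: smooth_cst].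
  by move=> x; have := c01 k x; have := g01 x => /andP[? ?] /andP[? ?]; apply/andP; split; nra.
have mg := test01_meas tg.
have m1A : measurable_fun B (\1_A : 'rV[R]_n -> R) by apply: measurable_indic.
rewrite [e]splitr; apply: le_lt_trans (ltrD dk dg).
have i1 := int_dist (measurable_cst (1 : R)) (mc k) (fun=> one01) (c01 k).
have i2 := int_dist m1A mg (indic01 A) g01.
rewrite /dist -RintegralD//.
apply: (le_Rintegral mB).
- apply: int_dist.
  + by apply: measurable_indic; exact: measurableC.
  + by apply: measurable_funM => //; apply: measurable_funB.
  + exact: indic01.
  + by move=> x; have := c01 k x; have := g01 x => /andP[? ?] /andP[? ?]; apply/andP; split; nra.
- exact: (intD mB i1 i2).
move=> x Bx; rewrite -mulrDl ler_wpM2r//.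
rewrite (_ : \1_(~` A) x - _ = (1 - cutoff rho k x) * (1 - g x) - (\1_A x - g x)); last first.
  rewrite !indicE in_setC; case: (x \in A) => /=; ring.
apply: le_trans (ler_normB _ _) _; rewrite lerD2r normrM ler_piMr//.
by rewrite unit_dist.
Qed.

(** The approximating function is 1 - (1 - g)(1 - g'), the smooth counterpart of a union. *)
Lemma approximable_setU A A' : measurable A -> measurable A' ->
  approximable A -> approximable A' -> approximable (A `|` A').
Proof.
move=> mA mA' aA aA' e e0; have e2 : 0 < e / 2 by rewrite divr_gt0.
have [g [tg g01] dg] := aA _ e2; have [g' [tg' g01'] dg'] := aA' _ e2.
have sg : smooth g by case: tg.
have sg' : smooth g' by case: tg'.
have h01 x : 0 <= g x + g' x * (1 - g x) <= 1.
  by have := g01' x; have := g01 x => /andP[? ?] /andP[? ?]; apply/andP; split; nra.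
have mg := test01_meas tg; have mg' := test01_meas tg'.
exists (fun x => g x + g' x * (1 - g x)).
  split; last exact: h01.
  exact: (test_functionD tg (test_functionMr tg' (smoothB (smooth_cst 1) sg))).
have m1A : measurable_fun B (\1_A : 'rV[R]_n -> R) by apply: measurable_indic.
have m1A' : measurable_fun B (\1_A' : 'rV[R]_n -> R) by apply: measurable_indic.
have i1 := int_dist m1A mg (indic01 A) g01.
have i2 := int_dist m1A' mg' (indic01 A') g01'.
rewrite [e]splitr; apply: le_lt_trans (ltrD dg dg').
rewrite /dist -RintegralD//; apply: (le_Rintegral mB).
- apply: int_dist h01.
  + by apply: measurable_indic; exact: measurableU.
  + by apply: measurable_funD => //; apply: measurable_funM => //; apply: measurable_funB.
  + exact: indic01.
- exact: (intD mB i1 i2).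
move=> x Bx; rewrite -mulrDl ler_wpM2r//.
have [/andP[a0 a1] /andP[b0 b1]] := (g01 x, g01' x).
rewrite !indicE in_setU; case: (x \in A); case: (x \in A') => /=.
- rewrite (_ : 1%:R - _ = (1 - g x) * (1 - g' x)); last by ring.
  rewrite normrM (le_trans (ler_piMr _ _))// ?lerDl//.
  by rewrite ger0_norm; lra.
- rewrite (_ : 1%:R - _ = (1 - g x) * (1 - g' x)); last by ring.
  rewrite normrM (le_trans (ler_piMr _ _))// ?lerDl//.
  by rewrite ger0_norm; lra.
- rewrite (_ : 1%:R - _ = (1 - g x) * (1 - g' x)); last by ring.
  rewrite normrM (le_trans (ler_piMl _ _))// ?lerDr//.
  by rewrite ger0_norm; lra.
- rewrite !sub0r !normrN (le_trans (ler_normD _ _))// lerD2l normrM ler_piMr//.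
  by rewrite ger0_norm; lra.
Qed.

Lemma approximable_set0 : approximable set0.
Proof.
move=> e e0; exists (fun=> 0).
  split; last by move=> x; rewrite lexx ler01.
  by have := @cutoff_test R n rho 0 rho0; congr test_function;
    apply/funext => x; rewrite /cutoff mul0r sub0r flat_le0// lerN10.
rewrite /dist; under eq_Rintegral do rewrite indicE in_set0 subrr normr0 mul0r.
by rewrite Rintegral_cst ?mul0r//; exact: mB.
Qed.

(** Dominated convergence, with |v| as majorant, brings some F N within e/2 of A; an approximation
    of F N then serves for A. *)
Lemma approximable_cvg (F : nat -> set 'rV[R]_n) A : measurable A ->
  (forall k, measurable (F k)) -> (forall k, approximable (F k)) ->
  (forall x, B x -> \forall k \near \oo, (x \in F k) = (x \in A)) -> approximable A.
Proof.
move=> mA mF aF cF e e0; have e2 : 0 < e / 2 by rewrite divr_gt0.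
have mI C : measurable C -> measurable_fun B (\1_C : 'rV[R]_n -> R).
  by move=> mC; exact: measurable_indic.
have [|N _ /(_ N (leqnn _)) hN] := dist_cvg0 (fun k => mI _ (mF k)) (mI _ mA)
    (fun k => indic01 (F k)) (indic01 A) _ e2.
  move=> x Bx; apply: cvg_near_cst; apply: filterS (cF x Bx) => k.
  by rewrite !indicE => ->.
have [g [tg g01] dg] := aF N _ e2.
exists g => //; rewrite [e]splitr; apply: le_lt_trans (ltrD hN dg).
have i1 := int_dist (mI _ mA) (mI _ (mF N)) (indic01 A) (indic01 (F N)).
have i2 := int_dist (mI _ (mF N)) (test01_meas tg) (indic01 (F N)) g01.
rewrite /dist -RintegralD//; apply: (le_Rintegral mB).
- exact: (int_dist (mI _ mA) (test01_meas tg) (indic01 A) g01).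
- exact: (intD mB i1 i2).
by move=> x Bx; rewrite -mulrDl ler_wpM2r// ler_distD.
Qed.

(** As k grows, [flat] of k (x_i - c) tends to 1 where x_i > c and is 0 elsewhere; the cutoff
    restores compact support. *)
Lemma approximable_halfspace (i : 'I_n) c : approximable [set x | c < x ord0 i].
Proof.
move=> e e0.
pose g k (x : 'rV[R]_n) : R := cutoff rho k x * flat (k%:R * (x ord0 i - c) + 0).
have g01 k x : 0 <= g k x <= 1.
  have := @cutoff_ge0 R n rho k x; have := @cutoff_le1 R n rho k x.
  have := @flat_ge0 R (k%:R * (x ord0 i - c) + 0).
  have := @flat_le1 R (k%:R * (x ord0 i - c) + 0).
  by rewrite /g => ? ? ? ?; apply/andP; split; nra.
have tg k : test_function B (g k).
  apply: (test_functionMr (cutoff_test k rho0)); apply: smooth_bumpf.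
  apply: smoothD; last exact: smooth_cst.
  by apply: smoothZ; apply: smoothB; [exact: smooth_coord|exact: smooth_cst].
have mI : measurable_fun B (\1_[set x : 'rV[R]_n | c < x ord0 i] : _ -> R).
  by apply: measurable_indic; exact: measurable_halfspace.
have [|N _ /(_ N (leqnn _)) hN] :=
  dist_cvg0 (fun k => test01_meas (tg k)) mI g01 (indic01 _) _ e0; last by exists (g N).
move=> x Bx; rewrite indicE.
have [cx|cx] := ltP c (x ord0 i).
  rewrite mem_set// -[X in _ --> X]mulr1; apply: cvgM; first exact: cutoff_cvg.
  by apply: flat_cvg1; rewrite subr_gt0.
rewrite memNset; last by apply/negP; rewrite -leNgt.
apply: cvg_near_cst; near=> k; rewrite /g (flat_le0 (t := _ + 0)) ?mulr0//.
by rewrite addr0 mulr_ge0_le0// subr_le0.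
Unshelve. all: by end_near. Qed.

Lemma approximable_measurable A : measurable A -> approximable A.
Proof.
have H : <<s [set A | exists i c, A = [set x : 'rV[R]_n | c < x ord0 i]] >> `<=`
    [set A : set 'rV[R]_n | measurable A /\ approximable A].
  apply: smallest_sub; last first.
    by move=> _ [i [c ->]]; split; [exact: measurable_halfspace|exact: approximable_halfspace].
  split.
  - by split; [exact: measurable0|exact: approximable_set0].
  - move=> C [mC aC]; rewrite setTD.
    by split; [exact: measurableC|exact: approximable_setC].
  - move=> F FG; have mF k := (FG k).1; have aF k := (FG k).2.
    split; first exact: bigcupT_measurable.
    (* A countable union is the pointwise limit of its finite partial unions. *)
    have mU N : measurable (\big[setU/set0]_(k < N) F k).
      by apply: bigsetU_measurable => k _; exact: mF.
    apply: (approximable_cvg _ mU); first exact: bigcupT_measurable.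
      elim=> [|N IH]; first by rewrite big_ord0; exact: approximable_set0.
      by rewrite big_ord_recr/=; exact: (approximable_setU (mU N) (mF N) IH (aF N)).
    move=> x _; have [[k _ Fk]|nx] := pselect ((\bigcup_k F k) x).
      near=> N; rewrite [RHS]mem_set; last by exists k.
      rewrite mem_set// -bigcup_mkord; exists k => //=.
      by near: N; exact: nbhs_infty_gt.
    near=> N; rewrite [RHS]memNset// memNset// -bigcup_mkord => -[k _ Fk].
    by apply: nx; exists k.
move=> mA; apply: (H A _).2; apply: measurable_rV_gen mA => i c.
by apply: sub_sigma_algebra; exists i, c.
Unshelve. all: by end_near. Qed.

(** Approximating the indicator of the set v < 0 by test functions with values in [0, 1] shows that
    the integral of [v] over this set is at least 0, so the set is null. *)
Lemma test_function_ge0_ae :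
  (forall phi, test_function B phi -> (forall x, 0 <= phi x) ->
     0 <= \int[mu]_(x in B) (v x * phi x)) ->
  {ae mu, forall x, B x -> 0 <= v x}.
Proof.
move=> H; have mv := int_meas iv.
pose A := B `&` [set x | v x < 0].
have mA : measurable A.
  rewrite (_ : A = B `&` v @^-1` `]-oo, 0[%classic); first exact: mv.
  by apply/seteqP; split => x [Bx]; rewrite /= in_itv/=.
have m1 : measurable_fun B (\1_A : 'rV[R]_n -> R) by exact: measurable_indic.
have norm1 (x : 'rV[R]_n) : `|\1_A x : R| <= 1.
  by rewrite indicE; case: (_ \in _); rewrite ?normr1// normr0.
have i1 : mu.-integrable B (EFin \o (fun x => \1_A x * v x)).
  by apply: (int_bdM mB m1 (C := 1)) => // x _.
have ge : 0 <= \int[mu]_(x in B) (\1_A x * v x).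
  apply/ler_addgt0Pl => e e0.
  have [g [tg g01] dg] := approximable_measurable mA e0.
  have mg := test01_meas tg.
  have i2 : mu.-integrable B (EFin \o (fun x => g x * v x)).
    apply: (int_bdM mB mg (C := 1)) => // x _.
    by have /andP[? ?] := g01 x; rewrite ger0_norm.
  have := H g tg (fun x => (andP (g01 x)).1).
  under eq_Rintegral do rewrite mulrC.
  move=> /le_trans; apply; rewrite -lerBlDr -RintegralB//.
  apply: le_trans (ltW dg); apply: (le_Rintegral mB).
  - exact: (intB mB i2 i1).
  - exact: (int_dist m1 mg (indic01 A) g01).
  - by move=> x Bx; rewrite -mulrBl -normrM -normrN -mulNr opprB ler_norm.
have i3 : mu.-integrable B (EFin \o (fun x => -1 * (\1_A x * v x))) by exact: (intZ mB).
have := Rintegral_le0_ae mB i3; rewrite RintegralZl// mulN1r oppr_le0 => /(_ _ ge) H0.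
have : {ae mu, forall x, B x -> -1 * (\1_A x * v x) = 0}.
  apply: H0; apply: aeW => x Bx; rewrite indicE mulN1r oppr_ge0.
  have [xA|xA] := boolP (x \in A); last by rewrite mul0r.
  by move: xA; rewrite inE mul1r => -[_ /ltW].
apply: filterS => x + Bx => /(_ Bx); apply: contra_eqT; rewrite -ltNge => vx.
by rewrite indicE mem_set// mul1r mulN1r oppr_eq0 lt_eqF.
Qed.

End approximable.
End density.

Section fundamental_lemma.
Context {R : realType} {n : nat}.
Local Notation mu := (lebesgue_rV R n).
Implicit Types (f g phi v : 'rV[R]_n -> R) (r rho : R).

Lemma loc_integrable_eball r rho v : 0 <= rho -> rho < r ->
  loc_integrable (eball n r) v -> mu.-integrable (eball n rho) (EFin \o v).
Proof.
move=> rho0 rr [_ H]; have r0 : 0 <= r by rewrite (le_trans rho0)// ltW.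
have mc : measurable [set x : 'rV[R]_n | sqn x <= rho ^+ 2].
  rewrite (_ : [set _ | _] = ~` [set x | rho ^+ 2 < sqn x]).
    apply: measurableC; apply: open_rV_measurable.
    apply: (@open_comp _ _ (@sqn R n) [set t | rho ^+ 2 < t]); last exact: open_gt.
    by move=> x _; exact: (smooth_continuous smooth_sqn0).
  by apply/seteqP; split => x /=; rewrite leNgt => /negP.
apply: (@integrableS _ _ _ _ [set x : 'rV[R]_n | sqn x <= rho ^+ 2]) => //.
- exact: measurable_eball.
- by move=> x /eballE -/(_ rho0)/ltW.
- apply: H; first exact: compact_sqn_ball.
  move=> x /= h; apply/eballE => //; apply: le_lt_trans h _.
  by rewrite ltr_pXn2r// nnegrE.
Qed.

(** The countably many radii r (1 - 1/(k+1)) exhaust the ball. This lets statements about locally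
    integrable functions be proved on smaller balls, where the functions are integrable. *)
Lemma eball_exhaust (r : R) (P : 'rV[R]_n -> Prop) : 0 < r ->
  (forall s, 0 <= s -> s < r -> {ae mu, forall x, eball n s x -> P x}) ->
  {ae mu, forall x, eball n r x -> P x}.
Proof.
move=> r0 H.
pose s (k : nat) : R := r * (1 - k.+1%:R^-1).
have k1 (k : nat) : k.+1%:R^-1 <= 1 :> R by rewrite invf_le1// ler1n.
have s0 k : 0 <= s k by apply: mulr_ge0; [exact: ltW|rewrite subr_ge0].
have sr k : s k < r by rewrite /s mulrBr mulr1 ltrBlDr ltrDl mulr_gt0// invr_gt0.
have := ae_foralln (fun k => H (s k) (s0 k) (sr k)); apply: filterS => x hx xr.
have rx : 0 < (r - enorm x) / r by rewrite divr_gt0// subr_gt0.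
have [k _ /(_ k (leqnn _)) hk] := near_infty_natSinv_lt (PosNum rx).
apply: (hx k); rewrite /= in hk; rewrite /eball/= /s mulrBr mulr1 ltrBrDl -ltrBrDr.
by rewrite mulrC -ltr_pdivlMr.
Qed.

(** On each smaller concentric ball [v] is integrable, and a test function of that ball is also one
    of the large ball. *)
Lemma loc_test_function_ge0_ae r v : 0 < r -> loc_integrable (eball n r) v ->
  (forall phi, test_function (eball n r) phi -> (forall x, 0 <= phi x) ->
     0 <= \int[mu]_(x in eball n r) (v x * phi x)) ->
  {ae mu, forall x, eball n r x -> 0 <= v x}.
Proof.
move=> r0 lv H; apply: eball_exhaust => // s s0 sr.
apply: (test_function_ge0_ae s0); first exact: loc_integrable_eball lv.
move=> phi tphi phi0.
have sub : eball n s `<=` (eball n r : set 'rV[R]_n) by apply: eball_sub; rewrite ltW.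
have := H phi (test_function_sub sub tphi) phi0.
rewrite Rintegral_mkcond [X in _ -> 0 <= X]Rintegral_mkcond.
congr (0 <= _); congr Rintegral; apply/funext => x; rewrite !patchE.
have [xs|xs] := boolP (x \in eball n s).
  by rewrite mem_set//; apply: sub; rewrite inE in xs.
case: ifP => // _; rewrite (test_function_out tphi) ?mulr0//.
by move/negP: xs; rewrite inE.
Qed.

Lemma closed_rV_measurable (C : set 'rV[R]_n) : closed C -> measurable C.
Proof.
move=> cC; rewrite -[C]setCK; apply: measurableC; apply: open_rV_measurable.
exact: closed_openC.
Qed.

(** The product lives on the compact support of [phi], where [v] is integrable and [phi] is
    bounded. *)
Lemma loc_integrable_test (Omega : set 'rV[R]_n) v phi : measurable Omega ->
  loc_integrable Omega v -> test_function Omega phi ->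
  mu.-integrable Omega (EFin \o (fun x => v x * phi x)).
Proof.
move=> mO [mv lv] tphi; have [sphi cphi subphi] := tphi.
pose K := Defs.support phi.
have mK : measurable K by apply: closed_rV_measurable; exact: closed_closure.
have [C C0 hC] := test_function_bounded tphi.
have iK : mu.-integrable K (EFin \o (fun x => phi x * v x)).
  apply: (int_bdM mK (C := C)); [exact: smooth_measurable|by move=> x _; exact: hC|exact: lv].
apply/(integrable_mkcond _ mO); move/(integrable_mkcond _ mK) : iK.
congr integrable; apply/funext => x; rewrite !patchE.
have [xK|xK] := boolP (x \in K); first by rewrite mem_set /= 1?mulrC//; apply: subphi; rewrite inE in xK.
case: ifP => // _ /=; rewrite (_ : phi x = 0) ?mulr0//.
by apply/eqP; apply: contraNT xK => /support_sub; rewrite inE.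
Qed.

Lemma loc_integrableB (Omega : set 'rV[R]_n) f g : measurable Omega ->
  loc_integrable Omega f -> loc_integrable Omega g ->
  loc_integrable Omega (fun x => f x - g x).
Proof.
move=> mO [mf lf] [mg lg]; split; first exact: measurable_funB.
move=> K cK sK; apply: intB; [|exact: lf|exact: lg].
apply: closed_rV_measurable; apply: compact_closed => //; exact: norm_hausdorff.
Qed.

Lemma loc_test_function_ae_eq r f g : 0 < r ->
  loc_integrable (eball n r) f -> loc_integrable (eball n r) g ->
  (forall phi, test_function (eball n r) phi ->
     \int[mu]_(x in eball n r) (f x * phi x) = \int[mu]_(x in eball n r) (g x * phi x)) ->
  {ae mu, forall x, eball n r x -> f x = g x}.
Proof.
move=> r0 lf lg H; have mB : measurable (eball n r) := measurable_eball (ltW r0).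
have le h k : loc_integrable (eball n r) h -> loc_integrable (eball n r) k ->
    (forall phi, test_function (eball n r) phi ->
       \int[mu]_(x in eball n r) (h x * phi x) = \int[mu]_(x in eball n r) (k x * phi x)) ->
    {ae mu, forall x, eball n r x -> 0 <= h x - k x}.
  move=> lh lk E; apply: loc_test_function_ge0_ae => //; first exact: loc_integrableB.
  move=> phi tphi _; under eq_Rintegral do rewrite mulrBl.
  by rewrite RintegralB ?E ?subrr//; exact: loc_integrable_test.
apply: filterS2 (le f g lf lg H) (le g f lg lf (fun phi t => esym (H phi t))).
move=> x + + Bx => /(_ Bx) h1 /(_ Bx) h2.
by apply/eqP; rewrite eq_le -subr_ge0 h2 -subr_ge0.
Qed.

Lemma test_function_eball_coord r phi (x : 'rV[R]_n) i : 0 <= r -> test_function (eball n r) phi ->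
  r < `|x ord0 i| -> phi x = 0.
Proof.
move=> r0 tphi h; apply: (test_function_out tphi) => /(eball_coord i r0).
by rewrite leNgt h.
Qed.

Lemma eball_Rintegral r f : 0 <= r -> (forall x, ~ eball n r x -> f x = 0) ->
  \int[mu]_(x in eball n r) f x = \int[mu]_x f x.
Proof.
move=> r0 H; rewrite Rintegral_mkcond; congr Rintegral; apply/funext => x.
rewrite patchE; case: ifPn => // /negP; rewrite inE => /H ->//.
Qed.

(* By translation invariance the difference quotients integrate to zero. *)
Lemma Rintegral_partial r phi i : 0 <= r -> test_function (eball n r) phi ->
  \int[mu]_(x in eball n r) partial i phi x = 0.
Proof.
move=> r0 tphi; have [sphi _ _] := tphi.
have tdphi := test_function_partial i tphi.
rewrite eball_Rintegral//; last by move=> x; exact: test_function_out tdphi.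
have [C C0 hC] := test_function_bounded tdphi.
pose h (k : nat) : R := k.+1%:R^-1.
have h0 k : 0 < h k by rewrite invr_gt0.
have h1 k : h k <= 1 by rewrite invf_le1// ler1n.
pose F k (x : 'rV[R]_n) := (h k)^-1 * (phi (x + h k *: 'e_i) - phi x).
have mphi : measurable_fun setT phi by exact: smooth_measurable.
have msh k : measurable_fun setT (fun x : 'rV[R]_n => phi (x + h k *: 'e_i)).
  apply: (measurableT_comp mphi); apply: measurable_fun_rV => j.
  by under eq_fun do rewrite !mxE; apply: measurable_funD => //; exact: measurable_rV_coord.
have mF k : measurable_fun setT (F k).
  by apply: measurable_funM => //; exact: measurable_funB.
(* The steps h are at most 1, so all difference quotients vanish outside this enlarged box. *)
pose Q : set 'rV[R]_n := cbox (fun=> - (r + 1)) (fun=> r + 1).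
have mQ : measurable Q := measurable_cbox _ _.
have outQ x : ~ Q x -> exists j, r + 1 < `|x ord0 j|.
  by move=> /existsNP[j /negP]; rewrite in_itv/= -ler_norml -ltNge; exists j.
have iQ : mu.-integrable setT (EFin \o (\1_Q : 'rV[R]_n -> R)).
  have finQ : (mu Q < +oo)%E.
    by have [s _ hs] := @cbox_ltoo R n (fun=> - (r + 1)) (fun=> r + 1); rewrite hs ltry.
  have := int_cst mQ 1 finQ; move=> /(integrable_mkcond _ mQ); congr integrable.
  by apply/funext => x; rewrite patchE /= indicE; case: (x \in Q).
have iG : mu.-integrable setT (EFin \o (fun x => C * \1_Q x)) by exact: intZ.
have lineD x t : is_derive (t : R) 1 (fun s : R => phi (x + s *: 'e_i)) (partial i phi (x + t *: 'e_i)).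
  have H : is_derive (x + t *: 'e_i) 'e_i phi (partial i phi (x + t *: 'e_i)) by exact: smooth_is_derive.
  have E : (fun s : R => s^-1 *: (((fun s : R => phi (x + s *: 'e_i)) \o shift t) (s *: (1 : R)) - phi (x + t *: 'e_i)))
      = (fun s : R => s^-1 *: ((phi \o shift (x + t *: 'e_i)) (s *: 'e_i) - phi (x + t *: 'e_i))).
    apply/funext => s /=; congr (_ *: (phi _ - _)).
    have -> : s *: (1 : R) = s by exact: mulr1.
    by rewrite scalerDl addrCA.
  by case: H => H1 H2; split; move: H1 H2; rewrite /derivable /derive E.
have [C' C'0 hC'] := test_function_bounded tphi.
have iphi : mu.-integrable setT (EFin \o phi).
  apply: (@int_le _ _ _ _ _ _ _ (fun x => C' * \1_Q x)) => //.
    move=> x _; rewrite indicE; have [xQ|] := boolP (x \in Q); first by rewrite mulr1.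
    rewrite notin_setE => /outQ[j hj]; rewrite (@test_function_eball_coord r _ x j) ?normr0 ?mulr0//.
    by apply: lt_trans hj; rewrite ltrDl.
  exact: intZ.
(* The mean value theorem bounds the quotients by the maximum of the derivative, which gives an
   integrable majorant. *)
have FC k x : `|F k x| <= C * \1_Q x.
  rewrite indicE; have [xQ|xQ] := boolP (x \in Q).
    rewrite mulr1 /F.
    have [|c _] := MVT (h0 k) (fun t _ => lineD x t).
      apply: continuous_subspaceT => t; apply: differentiable_continuous.
      exact/derivable1_diffP/(@ex_derive _ _ _ _ _ _ _ (lineD x t)).
    rewrite scale0r addr0 subr0 => ->.
    by rewrite mulrCA mulVf ?gt_eqF// mulr1.
  rewrite mulr0 normr_le0 /F mulf_eq0; apply/orP; right.
  have /outQ[j hj] : ~ Q x by move: xQ; rewrite notin_setE.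
  rewrite (@test_function_eball_coord r _ x j)//; last by apply: lt_trans hj; rewrite ltrDl.
  rewrite (@test_function_eball_coord r _ _ j) ?subrr//.
  rewrite !mxE eqxx andTb; have e1 : `|h k * (j == i)%:R| <= 1.
    by rewrite normrM (ger0_norm (ltW (h0 k))); case: (j == i); rewrite ?normr1 ?mulr1 ?normr0 ?mulr0.
  have := lerB_normD (x ord0 j) (h k * (j == i)%:R); lra.
have cF x : F k x @[k --> \oo] --> partial i phi x.
  have [H1 H2] : is_derive x 'e_i phi (partial i phi x) by exact: smooth_is_derive.
  have /cvg_ex[l cl] := H1.
  have lE : l = partial i phi x by rewrite -H2; apply/esym; exact: cvg_lim cl.
  rewrite lE in cl.
  have hc : h k @[k --> \oo] --> (0 : R)^'.
    move=> A hA.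
    have H : \forall k \near \oo, h k != 0 -> A (h k) := @cvg_harmonic R _ hA.
    by apply: filterS H => k; apply; exact: lt0r_neq0 (h0 k).
  rewrite (_ : (fun k => F k x) =
      (fun y : R => y^-1 *: ((phi \o shift x) (y *: 'e_i) - phi x)) \o h).
    exact: cvg_comp hc cl.
  by apply/funext => k; rewrite /F /= [x + _]addrC.
have [||||_] := @Rintegral_dct _ _ _ mu setT measurableT F (partial i phi) (fun x => C * \1_Q x).
- exact: mF.
- exact: iG.
- by move=> k x _; exact: FC.
- by move=> x _; exact: cF.
rewrite (_ : (fun k => _) = fun=> 0).
  by move=> /(cvg_unique _ (cvg_cst _)) ->.
apply/funext => k.
have iF : mu.-integrable setT (EFin \o F k).
  by apply: (int_le measurableT (mF k) _ iG) => x _; exact: FC.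
have idf : mu.-integrable setT (EFin \o (fun x => phi (x + h k *: 'e_i) - phi x)).
  have := intZ measurableT (h k) iF; congr integrable; apply/funext => x /=.
  by rewrite /F mulrA divff ?gt_eqF// mul1r.
have ish : mu.-integrable setT (EFin \o (fun x => phi (x + h k *: 'e_i))).
  have := intD measurableT idf iphi; congr integrable; apply/funext => x /=.
  by rewrite subrK.
rewrite RintegralZl// RintegralB//.
by rewrite -(Rintegral_rV_shift (h k *: 'e_i) mphi) subrr mulr0.
Qed.

End fundamental_lemma.

(** * The weak maximum principle *)

Section weak_maximum.
Context {R : realType} {n : nat}.
Local Notation mu := (lebesgue_rV R n).
Implicit Types (f g phi : 'rV[R]_n -> R) (r : R).

Lemma cvg_sumr (I : Type) (s : seq I) (F : I -> nat -> R) (l : I -> R) :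
  (forall i, F i j @[j --> \oo] --> l i) ->
  \sum_(i <- s) F i j @[j --> \oo] --> \sum_(i <- s) l i.
Proof.
move=> H; elim: s => [|i s IH].
  by under eq_fun do rewrite big_nil; rewrite big_nil; exact: cvg_cst.
by under eq_fun do rewrite big_cons; rewrite big_cons; apply: cvgD.
Qed.

Lemma test_function_smooth (Omega : set 'rV[R]_n) phi : test_function Omega phi -> smooth phi.
Proof. by case. Qed.

Lemma test_function_flatN (Omega : set 'rV[R]_n) phi : test_function Omega phi ->
  test_function Omega (fun x => flat (- phi x)).
Proof.
move=> tphi; have sphi := test_function_smooth tphi.
apply: (test_function_support tphi).
  apply: smooth_bumpf; have := smoothZ (-1) sphi; congr smooth.
  by apply/funext => x; rewrite mulN1r.
move=> x; have [->|/support_sub//] := eqVneq (phi x) 0.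
by rewrite oppr0 flat_le0// eqxx.
Qed.

Lemma is_derive_flatN phi x i : smooth phi ->
  is_derive x 'e_i (fun x => flat (- phi x)) (- (flat' (- phi x) * partial i phi x)).
Proof.
move=> sphi; rewrite -mulrN; apply: (@is_derive_comp _ _ flat (fun x => - phi x)).
  by apply: is_deriveN; exact: smooth_is_derive.
exact: flat_derive.
Qed.

(* [D] is the weak gradient of [u], and the last hypothesis says that
   -Delta u = F. The negative part is replaced by its smooth substitute
   [flat (- w j)]: as a test function it forces its own energy to 0, and integrating
   the derivative of [flat (- w j)] times a coordinate gives a Poincare inequality. *)
Lemma weak_maximum r (u F : 'rV[R]_n -> R) (D : 'I_n -> 'rV[R]_n -> R)
    (w : nat -> 'rV[R]_n -> R) : (0 < n)%N -> 0 < r ->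
  let B := eball n r in
  mu.-integrable B (EFin \o u) -> mu.-integrable B (EFin \o F) ->
  (forall i, mu.-integrable B (EFin \o D i)) ->
  (forall i, mu.-integrable B (EFin \o (fun x => D i x ^+ 2))) ->
  {ae mu, forall x, B x -> 0 <= F x} ->
  (forall j, test_function B (w j)) ->
  \int[mu]_(x in B) `|w j x - u x| @[j --> \oo] --> (0 : R) ->
  (forall i, \int[mu]_(x in B) ((partial i (w j) x - D i x) ^+ 2) @[j --> \oo] --> (0 : R)) ->
  (forall phi, test_function B phi ->
     \sum_(i < n) \int[mu]_(x in B) (D i x * partial i phi x) = \int[mu]_(x in B) (F x * phi x)) ->
  {ae mu, forall x, B x -> 0 <= u x}.
Proof.
move=> n0 r0 B iu iF iD iD2 F0 tw wu wD weak.
have mB : measurable B := measurable_eball (ltW r0).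
have finB : (mu B < +oo)%E := eball_finite (ltW r0).
have mS f : smooth f -> measurable_fun B f by exact: smooth_measurable.
pose a i j := partial i (w j).
pose k j x := flat' (- w j x).
pose phi j x := flat (- w j x).
have tphi j : test_function B (phi j) by exact: test_function_flatN.
have sw j : smooth (w j) := test_function_smooth (tw j).
have mk j : measurable_fun B (k j).
  apply: mS; apply: smooth_bumpf; have := smoothZ (-1) (sw j); congr smooth.
  by apply/funext => x; rewrite mulN1r.
have k0 j x : 0 <= k j x by exact: flat'_ge0.
have k2 j x : k j x <= 2 by exact: flat'_le2.
have mphi j : measurable_fun B (phi j) := mS _ (test_function_smooth (tphi j)).
have phi0 j x : 0 <= phi j x by exact: flat_ge0.
have phi1 j x : phi j x <= 1 by exact: flat_le1.
have ma i j : measurable_fun B (a i j) by apply: mS; exact: smooth_partial.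
have dphi i j x : partial i (phi j) x = - (k j x * a i j x).
  by apply: partialE; exact: is_derive_flatN.
have bdI f C : measurable_fun B f -> (forall x, `|f x| <= C) -> mu.-integrable B (EFin \o f).
  by move=> mf fC; apply: (int_le mB mf (fun x _ => fC x)); exact: int_cst.
have ia i j : exists2 C, 0 <= C & forall x, `|a i j x| <= C.
  exact: test_function_bounded (test_function_partial i (tw j)).
have ika2 i j : mu.-integrable B (EFin \o (fun x => k j x * a i j x ^+ 2)).
  have [C C0 hC] := ia i j; apply: (bdI _ (2 * C ^+ 2)).
    by apply: measurable_funM => //; exact: measurable_funX.
  move=> x; rewrite normrM (ger0_norm (k0 j x)) normrX; apply: ler_pM => //.
  by rewrite ler_pXn2r// nnegrE.
have ikaD i j : mu.-integrable B (EFin \o (fun x => k j x * a i j x * D i x)).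
  have [C C0 hC] := ia i j; apply: (int_bdM mB (C := 2 * C)) => //.
    exact: measurable_funM.
  by move=> x _; rewrite normrM (ger0_norm (k0 j x)); apply: ler_pM.
have ie2 i j : mu.-integrable B (EFin \o (fun x => (a i j x - D i x) ^+ 2)).
  have [C C0 hC] := ia i j.
  have iaD : mu.-integrable B (EFin \o (fun x => a i j x * D i x)).
    by apply: (int_bdM mB (ma i j) (C := C)) => // x _.
  have ia2 : mu.-integrable B (EFin \o (fun x => a i j x ^+ 2)).
    apply: (bdI _ (C ^+ 2)); first exact: measurable_funX.
    by move=> x; rewrite normrX ler_pXn2r// nnegrE.
  have := intD mB (intB mB ia2 (intZ mB 2 iaD)) (iD2 i); congr integrable.
  by apply/funext => x /=; congr EFin; ring.
pose E j := \sum_(i < n) \int[mu]_(x in B) (a i j x - D i x) ^+ 2.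
have E0 : E j @[j --> \oo] --> (0 : R).
  have : \sum_(i < n) \int[mu]_(x in B) (a i j x - D i x) ^+ 2 @[j --> \oo] -->
      \sum_(i < n) (0 : R).
    by apply: cvg_sumr => i; exact: wD.
  by rewrite big1.
(* The gradient of [phi j] is -k_j grad w_j; testing with it and F >= 0 make the integral of k_j
   grad w_j . D nonpositive. As D is close to grad w_j, the weighted energy of w_j is controlled by
   the approximation error [E j]. *)
have energy j : \sum_(i < n) \int[mu]_(x in B) (k j x * a i j x ^+ 2) <= 2 * E j.
  have h1 : \sum_(i < n) \int[mu]_(x in B) (k j x * a i j x * D i x) <= 0.
    have := weak _ (tphi j).
    under eq_bigr => i _ do under eq_Rintegral => x _ do rewrite dphi mulrN mulrC -mulN1r.
    under eq_bigr => i _ do rewrite RintegralZl//.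
    rewrite -mulr_sumr mulN1r => e.
    rewrite -oppr_ge0 e; apply: Rintegral_ae_ge0 => //.
      by apply: measurable_funM => //; exact: int_meas iF.
    by apply: filterS F0 => x + Bx => /(_ Bx) Fx; exact: mulr_ge0.
  (* A pointwise inequality from 0 <= K <= 2, the bounds on [flat']: right side minus left side is
     half of (2 - K)(A - d)^2 + K d^2. *)
  have h2 i : 2^-1 * \int[mu]_(x in B) (k j x * a i j x ^+ 2) <=
      \int[mu]_(x in B) (k j x * a i j x * D i x) + \int[mu]_(x in B) (a i j x - D i x) ^+ 2.
    rewrite -RintegralZl// -RintegralD//; apply: (le_Rintegral mB).
    - exact: intZ.
    - exact: intD.
    - move=> x _; have := k0 j x; have := k2 j x.
      move: (k j x) (a i j x) (D i x) => K A d h3 h4.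
      have h5 : 0 <= (2 - K) * (A - d) ^+ 2 by rewrite mulr_ge0 ?subr_ge0 ?sqr_ge0.
      have h6 : 0 <= K * d ^+ 2 by rewrite mulr_ge0 ?sqr_ge0.
      rewrite -subr_ge0 (_ : _ - _ = 2^-1 * ((2 - K) * (A - d) ^+ 2 + K * d ^+ 2)); last by field.
      by rewrite mulr_ge0 ?invr_ge0// addr_ge0.
  have : \sum_(i < n) 2^-1 * \int[mu]_(x in B) (k j x * a i j x ^+ 2) <=
    \sum_(i < n) (\int[mu]_(x in B) (k j x * a i j x * D i x) + \int[mu]_(x in B) (a i j x - D i x) ^+ 2).
    by apply: ler_sum => i _; exact: h2.
  by rewrite -mulr_sumr big_split/= -/(E j); lra.
pose V := \int[mu]_(x in B) (1 : R).
pose i0 : 'I_n := Ordinal n0.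
have iphi j : mu.-integrable B (EFin \o phi j).
  by apply: (bdI _ 1) => // x; rewrite ger0_norm.
(* The derivative of [phi j] times a coordinate integrates to 0, so the integral of [phi j] is that
   of x_0 k_j d_0 w_j. Since |x_0| <= r, Young's inequality with the free parameter [th] bounds it
   by the energy and a term of order [th]. *)
have poincare j th : 0 < th -> \int[mu]_(x in B) phi j x <= r * th * V + r / th * E j.
  move=> th0.
  have tx := test_functionMr (tphi j) (smooth_coord i0).
  have := Rintegral_partial i0 (ltW r0) tx.
  have dx x : partial i0 (fun x : 'rV_n => phi j x * x ord0 i0) x =
      phi j x - x ord0 i0 * (k j x * a i0 j x).
    apply: partialE; have d1 := is_derive_flatN x i0 (sw j).
    refine (is_derive_eq (is_deriveM d1 (is_derive_coord i0 i0 x)) _).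
    by rewrite eqxx /GRing.scale/= mulr1 mulrN.
  under eq_Rintegral do rewrite dx.
  have [C C0 hC] := ia i0 j.
  have ixka : mu.-integrable B (EFin \o (fun x : 'rV[R]_n => x ord0 i0 * (k j x * a i0 j x))).
    apply: (int_bdM mB (C := r)).
    - by apply: mS; exact: smooth_coord.
    - by move=> x; exact/eball_coord/ltW.
    - apply: (bdI _ (2 * C)); first exact: measurable_funM.
      by move=> x; rewrite normrM (ger0_norm (k0 j x)); apply: ler_pM.
  rewrite RintegralB// => /eqP; rewrite subr_eq0 => /eqP ->.
  have i1 : mu.-integrable B (EFin \o (fun=> 1 : R)) by exact: int_cst.
  have le1 : \int[mu]_(x in B) ((x : 'rV[R]_n) ord0 i0 * (k j x * a i0 j x)) <=
      r * th * V + r / (2 * th) * \int[mu]_(x in B) (k j x * a i0 j x ^+ 2).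
    rewrite -!RintegralZl// -RintegralD//; [|exact: intZ|exact: intZ].
    apply: (le_Rintegral mB) => //; first by apply: intD => //; exact: intZ.
    move=> x Bx; have := k0 j x; have := k2 j x; have := eball_coord i0 (ltW r0) Bx.
    rewrite ler_norml; move: (x ord0 i0) (k j x) (a i0 j x) => X K A /andP[h1 h2] h3 h4.
    have h5 : X * (K * A) <= r * (K * `|A|).
      apply: le_trans (ler_norm _) _; rewrite !normrM (ger0_norm h4) ler_wpM2r ?mulr_ge0//.
      by rewrite ler_norml h1.
    apply: le_trans h5 _.
    have h6 : 0 <= K * (`|A| - th) ^+ 2 by rewrite mulr_ge0 ?sqr_ge0.
    have h7 : 0 <= (2 - K) * th ^+ 2 by rewrite mulr_ge0 ?sqr_ge0// subr_ge0.
    rewrite -subr_ge0 (_ : _ - _ = r / (2 * th) * (K * (`|A| - th) ^+ 2 + (2 - K) * th ^+ 2)).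
      by rewrite mulr_ge0 ?divr_ge0 ?mulr_ge0 ?addr_ge0// ltW.
    have -> : K * A ^+ 2 = K * `|A| ^+ 2 by rewrite real_normK ?num_real.
    by field; rewrite gt_eqF.
  apply: le_trans le1 _; rewrite lerD2l.
  have le2 : \int[mu]_(x in B) (k j x * a i0 j x ^+ 2) <=
      \sum_(i < n) \int[mu]_(x in B) (k j x * a i j x ^+ 2).
    rewrite (bigD1 i0)//= lerDl; apply: sumr_ge0 => i _; apply: Rintegral_ge0 => x _.
    by rewrite mulr_ge0 ?sqr_ge0.
  have le3 := le_trans le2 (energy j).
  rewrite (_ : r / th * E j = r / (2 * th) * (2 * E j)); last by field; rewrite gt_eqF.
  by rewrite ler_wpM2l// divr_ge0 ?mulr_ge0// ltW.
have mu' : measurable_fun B u := int_meas iu.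
have mfu : measurable_fun B (fun x => flat (- u x)).
  apply: (measurableT_comp (f := fun t : R => flat (- t))) => //.
  apply: continuous_measurable_fun => t; apply: continuous_comp; first exact: opp_continuous.
  apply: differentiable_continuous; apply/derivable1_diffP.
  exact: (@ex_derive _ _ _ _ _ _ _ (flat_derive (- t))).
have ifu : mu.-integrable B (EFin \o (fun x => flat (- u x))).
  by apply: (bdI _ 1) => // x; rewrite ger0_norm ?flat_ge0 ?flat_le1.
have iwu j : mu.-integrable B (EFin \o (fun x => `|w j x - u x|)).
  apply: int_norm; apply: intB => //; have [C C0 hC] := test_function_bounded (tw j).
  by apply: (bdI _ C) => //; exact: mS.
(* For fixed [th] the limit in j removes both [E j] and the L^1 distance; [th] is sent to 0 only
   afterwards. *)
have main th : 0 < th -> \int[mu]_(x in B) flat (- u x) <= r * th * V.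
  move=> th0; have bound j : \int[mu]_(x in B) flat (- u x) <=
      r * th * V + r / th * E j + 2 * \int[mu]_(x in B) `|w j x - u x|.
    apply: le_trans (lerD (poincare j _ th0) (lexx _)).
    rewrite -RintegralZl// -RintegralD//; last exact: intZ.
    apply: (le_Rintegral mB) => //; first by apply: intD => //; exact: intZ.
    move=> x _; rewrite addrC -lerBlDr; apply: le_trans (ler_norm _) _.
    apply: le_trans (flat_lip _ _) _; rewrite ler_wpM2l//.
    by rewrite -opprD normrN distrC.
  have cv : r * th * V + r / th * E j + 2 * \int[mu]_(x in B) `|w j x - u x|
      @[j --> \oo] --> r * th * V + r / th * 0 + 2 * 0.
    apply: cvgD; last by apply: cvgMr; exact: wu.
    by apply: cvgD; [exact: cvg_cst|apply: cvgMr; exact: E0].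
  rewrite !mulr0 !addr0 in cv.
  rewrite -(cvg_lim _ cv)//; apply: limr_ge; last exact: nearW.
  by apply/cvg_ex; exists (r * th * V).
have le0 : \int[mu]_(x in B) flat (- u x) <= 0.
  have V0 : 0 <= V by apply: Rintegral_ge0.
  apply/ler_addgt0Pl => e e0; rewrite addr0.
  have rV : 0 < r * V + 1 by rewrite ltr_wpDl// mulr_ge0// ltW.
  apply: le_trans (main (e / (r * V + 1)) _) _; first by rewrite divr_gt0.
  rewrite mulrAC mulrCA ler_piMr ?(ltW e0)// ler_pdivrMr// mul1r.
  by rewrite lerDl.
have := Rintegral_le0_ae mB ifu (aeW _ (fun x _ => flat_ge0 _)) le0.
apply: filterS => x + Bx => /(_ Bx) e.
by rewrite leNgt -oppr_gt0 -flat_gt0 e ltxx.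
Qed.

End weak_maximum.

(** * The strong minimum principle for weakly superharmonic functions *)

Section kernel.
Context {R : realType} {n : nat}.
Local Notation mu := (lebesgue_rV R n).
Implicit Types (x y : 'rV[R]_n) (e q r : R).

Lemma is_derive_lip (f df : R -> R) (C : R) : (forall t : R, is_derive t (1 : R) f (df t)) ->
  (forall t, `|df t| <= C) -> forall s t, `|f s - f t| <= C * `|s - t|.
Proof.
move=> hf hC s t; wlog st : s t / t < s.
  move=> H; have [|/H//|->] := ltgtP s t; last by rewrite !subrr !normr0 mulr0.
  by rewrite distrC [X in _ * X]distrC => /H.
have [|c _ ->] := MVT st (fun z _ => hf z).
  apply: continuous_subspaceT => z; apply: differentiable_continuous.
  exact/derivable1_diffP/(@ex_derive _ _ _ _ _ _ _ (hf z)).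
by rewrite normrM ler_wpM2r.
Qed.

Lemma flat'_lip : exists2 C : R, 0 <= C & forall s t : R, `|flat' s - flat' t| <= C * `|s - t|.
Proof.
have [C C0 hC] := bumpf_bounded (dbump ('X^2 : {poly R})).
exists C => //; apply: (is_derive_lip (df := flat'')); [exact: flat'_derive|exact: hC].
Qed.

Lemma is_derive_measurable (f df : R -> R) : (forall t : R, is_derive t (1 : R) f (df t)) ->
  measurable_fun setT f.
Proof.
move=> hf; apply: continuous_measurable_fun => t.
apply: differentiable_continuous; apply/derivable1_diffP.
exact: (@ex_derive _ _ _ _ _ _ _ (hf t)).
Qed.

(* The derivative of the kernel in [e] is a positive multiple of the Laplacian of
   [potential], a test function ([laplacian_potential]); this makes the means
   of a superharmonic function monotone in [e]. *)
Definition kern e x y : R := e^-1 ^+ n * flat' (1 - sqn (x - y) * e^-1 ^+ 2).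

Definition kern' e x y : R :=
  2 * sqn (x - y) * e^-1 ^+ n.+3 * flat'' (1 - sqn (x - y) * e^-1 ^+ 2)
  - n%:R * e^-1 ^+ n.+1 * flat' (1 - sqn (x - y) * e^-1 ^+ 2).

Lemma is_derive_inv e : 0 < e -> is_derive e 1 (fun e : R => e^-1) (- e^-1 ^+ 2).
Proof.
move=> e0; have := @is_deriveV R id e 1 1 (lt0r_neq0 e0) (is_derive_id _ _).
by rewrite /GRing.scale/= mulr1 exprVn.
Qed.

Lemma is_derive_kern e x y : 0 < e -> is_derive e 1 (fun e : R => kern e x y) (kern' e x y).
Proof.
move=> e0; have d1 := is_derive_inv e0.
have d2 := is_deriveX 2 d1.
have d3 : is_derive e 1 (fun e : R => e^-1 ^+ n) (n%:R * e^-1 ^+ n.-1 * - e^-1 ^+ 2).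
  by have := is_deriveX n d1; rewrite exprfctE.
have d4 : is_derive e 1 (fun e : R => 1 - sqn (x - y) * e^-1 ^+ 2)
    (2 * sqn (x - y) * e^-1 ^+ 3).
  refine (is_derive_eq (is_deriveB (is_derive_cst (1 : R) e 1) (is_deriveZ (sqn (x - y)) d2)) _).
  rewrite /= /GRing.scale/=; ring.
have d5 := is_derive1_comp (flat'_derive _) d4.
refine (is_derive_eq (is_deriveM d3 d5) _).
rewrite /kern' /GRing.scale/=; move: (sqn (x - y)) => d0.
have pow (m : nat) : m%:R * e^-1 ^+ m.-1 * - e^-1 ^+ 2 = - (m%:R * e^-1 ^+ m.+1).
  by case: m => [|m]; rewrite ?mul0r ?oppr0// !exprS /=; ring.
by rewrite pow !exprS; ring.
Qed.

Lemma kern_ge0 e x y : 0 < e -> 0 <= kern e x y.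
Proof. by move=> e0; rewrite mulr_ge0 ?flat'_ge0// exprn_ge0// invr_ge0 ltW. Qed.

Lemma kern_le e x y : 0 < e -> kern e x y <= 2 * e^-1 ^+ n.
Proof.
by move=> e0; rewrite /kern mulrC ler_wpM2r ?flat'_le2// exprn_ge0// invr_ge0 ltW.
Qed.

(** Where [flat''] does not vanish, |x - y|^2 <= e^2, which absorbs two of the n + 3 inverse powers
    of e. The bound is uniform in x and y, as differentiation under the integral requires. *)
Lemma kern'_bounded : exists2 C : R, 0 <= C &
  forall e x y, 0 < e -> `|kern' e x y| <= C * e^-1 ^+ n.+1.
Proof.
have [C C0 hC] := bumpf_bounded (dbump ('X^2 : {poly R})).
exists (2 * C + 2 * n%:R); first by rewrite addr_ge0 ?mulr_ge0.
move=> e x y e0; have q0 : 0 <= e^-1 by rewrite invr_ge0 ltW.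
rewrite mulrDl; apply: le_trans (ler_normB _ _) _; apply: lerD; last first.
  rewrite ger0_norm ?mulr_ge0 ?exprn_ge0 ?flat'_ge0//.
  by rewrite mulrC mulrA ler_wpM2r ?exprn_ge0// ler_wpM2r// flat'_le2.
set s := 1 - _; have [s0|s0] := leP s 0.
  rewrite (_ : flat'' s = 0); last exact: bumpf_le0.
  by rewrite mulr0 normr0 !mulr_ge0 ?exprn_ge0.
rewrite normrM (_ : 2 * _ * _ = 2 * (1 - s) * e^-1 ^+ n.+1); last first.
  by rewrite /s opprB addrCA subrr addr0 !exprS; ring.
have s1 : 0 <= 1 - s by rewrite /s opprB addrCA subrr addr0 mulr_ge0 ?sqn_ge0 ?exprn_ge0.
rewrite ger0_norm; last by rewrite !mulr_ge0 ?exprn_ge0.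
rewrite mulrAC ler_wpM2r ?exprn_ge0// ler_pM ?mulr_ge0//; last exact: hC.
by rewrite ler_piMr//; lra.
Qed.

Lemma smooth_dist_sqn y q : smooth (fun x => 1 - sqn (x - y) * q).
Proof.
apply: smoothB; first exact: smooth_cst.
by apply: smoothM; [exact: smooth_sqn|exact: smooth_cst].
Qed.

Lemma smooth_kern e y : smooth (fun x => kern e x y).
Proof. by apply: smoothZ; apply: smooth_bumpf; exact: smooth_dist_sqn. Qed.

Definition potential q y x : R := flat (1 - sqn (x - y) * q).

Lemma smooth_potential q y : smooth (potential q y).
Proof. by apply: smooth_bumpf; exact: smooth_dist_sqn. Qed.

Lemma potential_test r rho e y : 0 < e -> 0 <= r -> rho < r ^+ 2 ->
  (forall x, sqn (x - y) <= e ^+ 2 -> sqn x <= rho) ->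
  test_function (eball n r) (potential (e^-1 ^+ 2) y).
Proof.
move=> e0 r0 rr H; apply: (test_function_sqn (smooth_potential _ _) r0 rr) => x px.
apply: H; rewrite leNgt; apply: contra_neqN px => h.
apply: flat_le0; rewrite subr_le0 exprVn ler_pdivlMr ?exprn_gt0// mul1r.
exact: ltW.
Qed.

Lemma is_derive_dist_sqn y q x i :
  is_derive x 'e_i (fun x => 1 - sqn (x - y) * q) (- (2 * (x ord0 i - y ord0 i) * q)).
Proof.
have d1 := is_deriveB (is_derive_cst (1 : R) x 'e_i) (is_deriveM (is_derive_sqn y x i) (is_derive_cst q x 'e_i)).
by refine (is_derive_eq d1 _); rewrite /GRing.scale/= /cst; ring.
Qed.

Lemma partial_potential q y i x : partial i (potential q y) x =
  - (2 * q) * (flat' (1 - sqn (x - y) * q) * (x ord0 i - y ord0 i)).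
Proof.
apply: partialE.
refine (is_derive_eq (is_derive_comp (is_derive_dist_sqn y q x i) (flat_derive _)) _).
ring.
Qed.

Lemma partial2_potential q y i x : partial i (partial i (potential q y)) x =
  4 * q ^+ 2 * (x ord0 i - y ord0 i) ^+ 2 * flat'' (1 - sqn (x - y) * q)
  - 2 * q * flat' (1 - sqn (x - y) * q).
Proof.
apply: partialE.
rewrite (_ : partial i _ = fun x => - (2 * q) * (flat' (1 - sqn (x - y) * q) * (x ord0 i - y ord0 i))); last first.
  by apply/funext => z; exact: partial_potential.
have d1 := is_derive_comp (is_derive_dist_sqn y q x i) (flat'_derive _).
have d2 := is_deriveB (is_derive_coord i i x) (is_derive_cst (y ord0 i) x 'e_i).
refine (is_derive_eq (is_deriveZ (- (2 * q)) (is_deriveM d1 d2)) _).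
rewrite eqxx /= !fctE /GRing.scale/=; ring.
Qed.

(** [kern] is a mass-preserving dilation of its profile, so its derivative in e is -1/e times the
    divergence of (x - y) [kern]; and (x - y) [kern] is -(e^2 / 2) e^-n times the gradient of
    [potential], since its profile [flat'] is the derivative of [flat]. *)
Lemma laplacian_potential e y x : 0 < e ->
  kern' e x y = 2^-1 * e * e^-1 ^+ n * \sum_i partial i (partial i (potential (e^-1 ^+ 2) y)) x.
Proof.
move=> e0; under eq_bigr do rewrite partial2_potential.
rewrite sumrB -mulr_suml -mulr_sumr sumr_const card_ord -mulr_natr.
rewrite (_ : \sum_i _ = sqn (x - y)); last by apply: eq_bigr => i _; rewrite !mxE.
by rewrite /kern' !exprS expr0; field; rewrite gt_eqF.
Qed.

End kernel.

Lemma int_support {R : realType} {n : nat} (rho C : R) (f : 'rV[R]_n -> R) : 0 <= rho ->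
  measurable_fun setT f -> (forall x, `|f x| <= C) ->
  (forall x, ~ eball n rho x -> f x = 0) -> (lebesgue_rV R n).-integrable setT (EFin \o f).
Proof.
move=> rho0 mf fC f0; have mB := @measurable_eball R n _ rho0.
have := int_cst mB C (eball_finite rho0) => /(integrable_mkcond _ mB) iC.
apply: (int_le measurableT (g := (fun=> C) \_ (eball n rho)) mf).
  move=> x _; rewrite patchE; case: ifPn => [_|/negP]; first exact: fC.
  by rewrite inE => /f0 ->; rewrite normr0.
move: iC; congr integrable; apply/funext => x; rewrite /= !patchE.
by case: ifP.
Qed.

Section strong_minimum.
Context {R : realType} {n : nat}.
Local Notation mu := (lebesgue_rV R n).
Implicit Types (x y z : 'rV[R]_n) (e q : R) (g phi : 'rV[R]_n -> R).

(* [(a + b)^2 <= (1 + t) a^2 + (1 + 1/t) b^2] replaces the triangle inequality. *)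
Lemma eball_shift (r s : R) : 0 < s -> s < r -> exists d, [/\ 0 < d, d < r &
  forall x y, eball n d y -> sqn (x - y) <= s ^+ 2 -> sqn x <= (s ^+ 2 + 3 * r ^+ 2) / 4].
Proof.
move=> s0 sr; have r0 := lt_trans s0 sr.
have sr2 : s ^+ 2 < r ^+ 2 by rewrite ltr_pXn2r// nnegrE ltW.
have s20 : 0 < s ^+ 2 by rewrite exprn_gt0.
have D0 : 0 < r ^+ 2 - s ^+ 2 by rewrite subr_gt0.
(* With this [t], (1 + t) s^2 is the midpoint of s^2 and r^2; [tau] is such that (1 + 1/t) tau =
   (r^2 - s^2)/4, half of what remains below r^2. *)
pose t := (r ^+ 2 - s ^+ 2) / (2 * s ^+ 2).
have t0 : 0 < t by rewrite divr_gt0// mulr_gt0.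
pose tau := (r ^+ 2 - s ^+ 2) / 4 / (1 + t^-1).
have it0 : 0 < 1 + t^-1 by rewrite addr_gt0// invr_gt0.
have tau0 : 0 < tau by rewrite !divr_gt0.
have rt : tau < r ^+ 2.
  rewrite /tau ltr_pdivrMr// ltr_pdivrMr//; apply: (@lt_le_trans _ _ (r ^+ 2)).
    by rewrite ltrBlDr ltrDl.
  rewrite -mulrA ler_peMr ?sqr_ge0//.
  have : 0 < t^-1 by rewrite invr_gt0.
  lra.
exists (Num.sqrt tau); split.
- by rewrite sqrtr_gt0.
- by rewrite -(@ltr_pXn2r _ 2) ?nnegrE ?sqrtr_ge0 ?ltW// sqr_sqrtr// ltW.
move=> x y /eballE -/(_ (sqrtr_ge0 _)); rewrite sqr_sqrtr ?(ltW tau0)// => /ltW hy hx.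
have key : sqn x <= (1 + t) * sqn (x - y) + (1 + t^-1) * sqn y.
  rewrite /sqn !mulr_sumr -big_split/=; apply: ler_sum => i _; rewrite !mxE.
  move: (x ord0 i) (y ord0 i) => X Y.
  rewrite -subr_ge0 (_ : _ - _ = t^-1 * (t * (X - Y) - Y) ^+ 2); last by field; rewrite gt_eqF.
  by rewrite mulr_ge0 ?sqr_ge0// invr_ge0 ltW.
apply: le_trans key _.
have -> : (s ^+ 2 + 3 * r ^+ 2) / 4 = (1 + t) * s ^+ 2 + (1 + t^-1) * tau.
  rewrite /tau [(1 + t^-1) * _]mulrC divfK ?gt_eqF// /t; field; rewrite ?gt_eqF//.
apply: lerD; first by rewrite ler_wpM2l// addr_ge0// ltW.
by rewrite ler_wpM2l// ltW.
Qed.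

Variables (r : R) (W : 'rV[R]_n -> R).
Hypotheses (r0 : 0 < r) (Wout : forall x, ~ eball n r x -> W x = 0) (W0 : forall x, 0 <= W x)
  (iW : mu.-integrable setT (EFin \o W))
  (superharmonic : forall phi, test_function (eball n r) phi -> (forall x, 0 <= phi x) ->
     \sum_(i < n) \int[mu]_x (W x * partial i (partial i phi) x) <= 0).

Let mW : measurable_fun setT W := int_meas iW.

(** Not normalised: the mass of the kernel is the integral of [kern1] at every scale. Since [W]
    vanishes off the ball, the integral can run over the whole space. *)
Definition mean e y : R := \int[mu]_x (W x * kern e x y).

Let mkern e y : measurable_fun setT (fun x => kern e x y).
Proof. by apply: smooth_measurable => //; exact: smooth_kern. Qed.

Let iWk e y : 0 < e -> mu.-integrable setT (EFin \o (fun x => W x * kern e x y)).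
Proof.
move=> e0; under eq_fun do rewrite mulrC.
apply: (int_bdM measurableT (C := 2 * e^-1 ^+ n)) => // x _.
by rewrite ger0_norm ?kern_ge0// kern_le.
Qed.

Lemma mean_derive e y : 0 < e ->
  is_derive e 1 (fun e : R => mean e y) (\int[mu]_x (W x * kern' e x y)).
Proof.
move=> e0; have [C C0 hC] := @kern'_bounded R n.
have e2 : 0 < e / 2 by rewrite divr_gt0.
pose f (e : R) x := W x * kern e x y.
have df e' x : 0 < e' -> is_derive e' 1 (f ^~ x) (W x * kern' e' x y).
  by move=> e'0; exact: (is_deriveZ (W x) (is_derive_kern x y e'0)).
have p1 e' x : 0 < e' -> partial1of2 f e' x = W x * kern' e' x y.
  by move=> e'0; rewrite partial1of2E; have [] := df e' x e'0.
pose G x := (C * (e / 2)^-1 ^+ n.+1) * W x.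
(* On this window the scale stays above e/2, so [kern'_bounded] yields a single integrable
   majorant. *)
have ein : `]e / 2, 2 * e[%classic e by rewrite /= in_itv/=; apply/andP; split; lra.
have pos e' : `]e / 2, 2 * e[%classic e' -> 0 < e'.
  by rewrite /= in_itv/= => /andP[h _]; exact: lt_trans h.
have cond1 e' : `]e / 2, 2 * e[%classic e' -> mu.-integrable setT (EFin \o f e').
  by move=> /pos e'0; exact: iWk.
have cond2 e' x : `]e / 2, 2 * e[%classic e' -> [set: 'rV[R]_n] x -> derivable (f^~ x) e' 1.
  by move=> /pos e'0 _; have [] := df e' x e'0.
have G0 x : 0 <= G x by rewrite /G !mulr_ge0 ?exprn_ge0// invr_ge0 ltW.
have iG : mu.-integrable setT (EFin \o G) by exact: intZ.
have cond3 e' x : `]e / 2, 2 * e[%classic e' -> [set: 'rV[R]_n] x -> `|partial1of2 f e' x| <= G x.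
  move=> he _; have e'0 := pos _ he; rewrite p1// normrM (ger0_norm (W0 x)) mulrC.
  rewrite ler_wpM2r//; apply: le_trans (hC _ _ _ e'0) _; rewrite ler_wpM2l//.
  rewrite ler_pXn2r ?nnegrE ?invr_ge0 ?(ltW e'0) ?(ltW e2)// lef_pV2 ?posrE//.
  by move: he; rewrite /= in_itv/= => /andP[/ltW].
split; first exact: (derivable_under_integral measurableT ein cond1 cond2 G0 iG cond3).
rewrite -derive1E (differentiation_under_integral measurableT ein cond1 cond2 G0 iG cond3).
by apply: eq_Rintegral => x _; rewrite p1.
Qed.

(** At an intermediate scale the derivative of the mean is a nonnegative multiple of the integral of
    [W] against the Laplacian of [potential]; the hypothesis on rho makes [potential] a test
    function of the ball, so superharmonicity gives the sign. *)
Lemma mean_decreasing a b rho y : 0 < a -> a < b -> rho < r ^+ 2 ->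
  (forall x, sqn (x - y) <= b ^+ 2 -> sqn x <= rho) -> mean b y <= mean a y.
Proof.
move=> a0 ab rr H; rewrite -subr_le0.
have pos c : c \in `]a, b[ -> 0 < c by rewrite in_itv/= => /andP[h _]; exact: lt_trans h.
have [||c cab ->] := @MVT R (fun e => mean e y) (fun e => \int[mu]_x (W x * kern' e x y)) _ _ ab.
- by move=> c /pos c0; exact: mean_derive.
- apply: derivable_within_continuous => c; rewrite in_itv/= => /andP[h _].
  by have [] := mean_derive y (lt_le_trans a0 h).
apply: mulr_le0_ge0; last by rewrite subr_ge0 ltW.
have c0 := pos _ cab.
have tp : test_function (eball n r) (potential (c^-1 ^+ 2) y).
  apply: (potential_test c0 (ltW r0) rr) => x hx; apply: H; apply: le_trans hx _.
  rewrite ler_pXn2r ?nnegrE ?(ltW c0) ?(ltW (lt_trans a0 ab))//.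
  by move: cab; rewrite in_itv/= => /andP[_ /ltW].
have := superharmonic tp (fun x => flat_ge0 _).
have iWp i : mu.-integrable setT (EFin \o (fun x => W x * partial i (partial i (potential (c^-1 ^+ 2) y)) x)).
  have t2 := test_function_partial i (test_function_partial i tp).
  have [C _ hC] := test_function_bounded t2.
  under eq_fun do rewrite mulrC.
  by apply: (int_bdM measurableT (C := C)) => //; exact: test_function_measurable t2.
rewrite -Rintegral_sum// => le0.
under eq_Rintegral do rewrite laplacian_potential// mulrCA mulr_sumr.
rewrite RintegralZl//; last exact: int_sum.
by rewrite mulr_ge0_le0// !mulr_ge0 ?exprn_ge0 ?invr_ge0// ltW.
Qed.

Definition kern1 z : R := flat' (1 - sqn z).

Lemma sqnZ e z : sqn (e *: z) = e ^+ 2 * sqn z.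
Proof. by rewrite /sqn mulr_sumr; apply: eq_bigr => i _; rewrite mxE exprMn. Qed.

Lemma sqnN z : sqn (- z) = sqn z.
Proof. by apply: eq_bigr => i _; rewrite mxE sqrrN. Qed.

Lemma kernC e x y : kern e x y = kern e y x.
Proof. by rewrite /kern -sqnN opprB. Qed.

Lemma smooth_kern1 : smooth kern1.
Proof.
have := smooth_dist_sqn (0 : 'rV[R]_n) 1 => h; have := smooth_bumpf 'X^2 h; congr smooth.
by apply/funext => z; rewrite subr0 mulr1.
Qed.

Lemma kern1_ge0 z : 0 <= kern1 z. Proof. exact: flat'_ge0. Qed.

Lemma int_kern1 : mu.-integrable setT (EFin \o kern1).
Proof.
apply: (@int_support _ _ 1 2) => //.
- by apply: smooth_measurable => //; exact: smooth_kern1.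
- by move=> z; rewrite ger0_norm ?kern1_ge0// flat'_le2.
move=> z /eballE; move=> /(_ ler01)/negP; rewrite expr1n -leNgt => h.
by apply: bumpf_le0; rewrite subr_le0.
Qed.

Lemma kern_scale e x z : 0 < e -> kern e x (x + e *: z) = e^-1 ^+ n * kern1 z.
Proof.
move=> e0; rewrite /kern opprD addrA subrr add0r sqnN sqnZ mulrAC.
by rewrite -exprMn divff ?gt_eqF// expr1n mul1r.
Qed.

(** The average of [g] against the kernel about x, written in the variable z = (y - x)/e so that the
    limit at small scales can be taken under the integral. *)
Definition smear g e x : R := \int[mu]_z (g (x + e *: z) * kern1 z).

Section smear.
Variables (g : 'rV[R]_n -> R) (d Cg : R).
Hypotheses (g0 : forall x, 0 <= g x) (cg : continuous g) (gC : forall x, g x <= Cg)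
  (d0 : 0 <= d) (gout : forall x, ~ eball n d x -> g x = 0).

Let mg : measurable_fun setT g.
Proof. exact: continuous_rV_measurable. Qed.

Let mkern1 : measurable_fun setT kern1.
Proof. by apply: smooth_measurable => //; exact: smooth_kern1. Qed.

Let mgs e x : measurable_fun setT (fun z => g (x + e *: z) * kern1 z).
Proof. by apply: measurable_funM => //; apply: (measurableT_comp mg); exact: measurable_affine. Qed.

Let gC' x : `|g x| <= Cg. Proof. by rewrite ger0_norm. Qed.

Let igs e x : mu.-integrable setT (EFin \o (fun z => g (x + e *: z) * kern1 z)).
Proof.
apply: (int_bdM measurableT (C := Cg)) => //; last exact: int_kern1.
by apply: (measurableT_comp mg); exact: measurable_affine.
Qed.

Lemma smear_ge0 e x : 0 <= smear g e x.
Proof. by apply: Rintegral_ge0 => z _; rewrite mulr_ge0 ?kern1_ge0. Qed.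

Lemma smear_le e x : smear g e x <= Cg * \int[mu]_z kern1 z.
Proof.
rewrite -RintegralZl//; last exact: int_kern1.
apply: le_Rintegral => //; first by apply: intZ => //; exact: int_kern1.
by move=> z _; rewrite ler_wpM2r ?kern1_ge0.
Qed.

Lemma smearE e x : 0 < e ->
  (\int[mu]_y (g y * kern e x y)%:E = (smear g e x)%:E)%E.
Proof.
move=> e0.
have mgk : measurable_fun setT (fun y => (g y * kern e x y)%:E).
  apply/measurable_EFinP; apply: measurable_funM => //.
  rewrite (_ : kern e x = fun y => kern e y x); first exact: mkern.
  by apply/funext => y; exact: kernC.
rewrite (ge0_integral_rV_affine x e0 mgk); last first.
  by move=> y; rewrite lee_fin mulr_ge0// kern_ge0.
rewrite -ge0_integralZl_EFin//; first last.
- by rewrite exprn_ge0// ltW.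
- apply/measurable_EFinP; under eq_fun do rewrite kern_scale// mulrCA.
  exact: measurable_funM.
- by move=> z _; rewrite lee_fin mulr_ge0// kern_ge0.
rewrite [RHS]fineK; last exact: (integrable_fin_num measurableT (igs e x)).
apply: eq_integral => z _; rewrite -EFinM; congr EFin.
rewrite kern_scale// mulrCA [e ^+ n * _]mulrA -exprMn divff ?gt_eqF// expr1n.
by rewrite mul1r.
Qed.

Lemma smear_cvg x : smear g k.+1%:R^-1 x @[k --> \oo] --> g x * \int[mu]_z kern1 z.
Proof.
have [||||_] := @Rintegral_dct _ _ _ mu setT measurableT (fun (k : nat) z => g (x + k.+1%:R^-1 *: z) * kern1 z)
    (fun z => g x * kern1 z) (fun z => Cg * kern1 z).
- by move=> k; exact: mgs.
- by apply: intZ => //; exact: int_kern1.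
- by move=> k z _; rewrite normrM (ger0_norm (kern1_ge0 z)) ler_wpM2r ?kern1_ge0.
- move=> z _; apply: cvgMl.
  have cz : x + k.+1%:R^-1 *: z @[k --> \oo] --> x.
    rewrite -[X in _ --> X]addr0 -(scale0r z); apply: cvgD; first exact: cvg_cst.
    by apply: cvgZr_tmp; exact: cvg_harmonic.
  apply: (@cvg_comp _ _ _ (fun k : nat => x + k.+1%:R^-1 *: z) g _ _ _ cz); exact: cg.
by rewrite RintegralZl//; exact: int_kern1.
Qed.

Let mpair e : measurable_fun [set: 'rV[R]_n * 'rV[R]_n] (fun p => kern e p.1 p.2).
Proof.
have msq : measurable_fun [set: 'rV[R]_n * 'rV[R]_n] (fun p => sqn (p.1 - p.2)).
  rewrite /sqn; apply: (@measurable_sum _ _ _ _ _ _ (fun (i : 'I_n) (p : 'rV[R]_n * 'rV[R]_n) => (p.1 - p.2) ord0 i ^+ 2)).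
  move=> i; apply: measurable_funX; under eq_fun do rewrite !mxE.
  apply: measurable_funB.
    exact: (measurableT_comp (measurable_rV_coord i) measurable_fst).
  exact: (measurableT_comp (measurable_rV_coord i) measurable_snd).
apply: measurable_funM => //.
apply: (measurableT_comp (f := flat')); first exact: (is_derive_measurable flat'_derive).
by apply: measurable_funB => //; exact: measurable_funM.
Qed.

Lemma measurable_mean e : 0 < e -> measurable_fun setT (mean e).
Proof.
move=> e0; have mf : measurable_fun [set: 'rV[R]_n * 'rV[R]_n] (fun p => (W p.1 * kern e p.1 p.2)%:E).
  apply/measurable_EFinP; apply: measurable_funM => //.
  exact: (measurableT_comp mW measurable_fst).
have := @measurable_fun_fubini_tonelli_G _ _ _ _ _ mu _ mf.
move=> H; have {}H := H (fun p => _); apply/measurable_EFinP.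
have E : fubini_G mu (fun p : 'rV[R]_n * 'rV[R]_n => (W p.1 * kern e p.1 p.2)%:E) = EFin \o mean e.
  apply/funext => y; rewrite /fubini_G /= /mean /Rintegral fineK//.
  exact: (integrable_fin_num measurableT (iWk y e0)).
rewrite -E; apply: H => p.
by rewrite lee_fin mulr_ge0// kern_ge0.
Qed.

Let Wkern_ge0 e x y : 0 < e -> 0 <= W x * kern e x y.
Proof. by move=> e0; rewrite mulr_ge0// kern_ge0. Qed.

Let gkern_ge0 e x y : 0 < e -> 0 <= g y * kern e x y.
Proof. by move=> e0; rewrite mulr_ge0// kern_ge0. Qed.

(** Tonelli's theorem and the symmetry of the kernel move the averaging from [W] to [g]. *)
Lemma mean_smear e : 0 < e -> \int[mu]_y (g y * mean e y) = \int[mu]_x (W x * smear g e x).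
Proof.
move=> e0; rewrite /Rintegral; congr fine.
have mf : measurable_fun [set: 'rV[R]_n * 'rV[R]_n] (fun p => (g p.2 * (W p.1 * kern e p.1 p.2))%:E).
  apply/measurable_EFinP; apply: measurable_funM.
    exact: (measurableT_comp mg measurable_snd).
  apply: measurable_funM => //; exact: (measurableT_comp mW measurable_fst).
have f0 p : (0 <= (g p.2 * (W p.1 * kern e p.1 p.2))%:E)%E.
  by rewrite lee_fin mulr_ge0// mulr_ge0// kern_ge0.
have := @fubini_tonelli _ _ _ _ _ mu mu _ mf f0 => /= F.
transitivity (\int[mu]_y \int[mu]_x (g y * (W x * kern e x y))%:E)%E.
  apply: eq_integral => y _; rewrite EFinM /mean /Rintegral fineK; last first.
    exact: (integrable_fin_num measurableT (iWk y e0)).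
  have Wk0 x : setT x -> (0 <= (W x * kern e x y)%:E)%E.
    by move=> _; rewrite lee_fin; exact: Wkern_ge0.
  have mWk : measurable_fun setT (fun x => (W x * kern e x y)%:E).
    by apply/measurable_EFinP; exact: measurable_funM.
  by rewrite -(ge0_integralZl_EFin mu measurableT Wk0 mWk (g0 y)).
rewrite -F; clear F f0 mf; apply: eq_integral => x _; rewrite EFinM -(smearE x e0).
have gk0 y : setT y -> (0 <= (g y * kern e x y)%:E)%E.
  by move=> _; rewrite lee_fin; exact: gkern_ge0.
have mgk : measurable_fun setT (fun y => (g y * kern e x y)%:E).
  apply/measurable_EFinP; apply: measurable_funM => //.
  rewrite (_ : kern e x = fun y => kern e y x); first exact: mkern.
  by apply/funext => y; exact: kernC.
rewrite -(ge0_integralZl_EFin mu measurableT gk0 mgk (W0 x)).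
by apply: eq_integral => y _; rewrite -EFinM mulrCA.
Qed.

Lemma smear_measurable e : 0 < e -> measurable_fun setT (smear g e).
Proof.
move=> e0; have mf : measurable_fun [set: 'rV[R]_n * 'rV[R]_n] (fun p => (g p.2 * kern e p.1 p.2)%:E).
  apply/measurable_EFinP; apply: measurable_funM => //.
  exact: (measurableT_comp mg measurable_snd).
have f0 p : (0 <= (g p.2 * kern e p.1 p.2)%:E)%E by rewrite lee_fin mulr_ge0// kern_ge0.
have := @measurable_fun_fubini_tonelli_F _ _ _ _ _ mu _ mf f0.
rewrite (_ : fubini_F _ _ = EFin \o smear g e); first by move/measurable_EFinP.
by apply/funext => x; rewrite /fubini_F /= smearE.
Qed.

(** A lower bound on the means at all small scales becomes a weak lower bound on [W]: once the
    averaging has been moved to [g], continuity of [g] gives the limit. *)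
Lemma mean_ge_ae_int (c e0 : R) : 0 < e0 ->
  (forall e y, 0 < e -> e < e0 -> eball n d y -> c <= mean e y) ->
  c * \int[mu]_y g y <= \int[mu]_x (W x * g x) * \int[mu]_z kern1 z.
Proof.
move=> e00 H; have ig : mu.-integrable setT (EFin \o g) by exact: int_support gout.
have c1_0 : 0 <= \int[mu]_z kern1 z by apply: Rintegral_ge0 => z _; exact: kern1_ge0.
have [||||_] := @Rintegral_dct _ _ _ mu setT measurableT (fun (k : nat) x => W x * smear g k.+1%:R^-1 x)
    (fun x => W x * (g x * \int[mu]_z kern1 z)) (fun x => Cg * (\int[mu]_z kern1 z) * W x).
- by move=> k; apply: measurable_funM => //; exact: smear_measurable.
- exact: intZ.
- move=> k x _; rewrite normrM (ger0_norm (W0 x)) (ger0_norm (smear_ge0 _ _)) mulrC.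
  by rewrite ler_wpM2r// smear_le.
- by move=> x _; apply: cvgMr; exact: smear_cvg.
move=> cv; have iWg : mu.-integrable setT (EFin \o (fun x => W x * g x)).
  by under eq_fun do rewrite mulrC; apply: (int_bdM measurableT (C := Cg)).
have E : \int[mu]_x (W x * (g x * \int[mu]_z kern1 z)) = \int[mu]_x (W x * g x) * \int[mu]_z kern1 z.
  by rewrite -RintegralZr//; apply: eq_Rintegral => x _; rewrite mulrA.
rewrite -E -(cvg_lim _ cv)//; apply: limr_ge.
  by apply/cvg_ex; eexists; exact: cv.
have [N _ HN] := near_infty_natSinv_lt (PosNum e00).
exists N => // k /= Nk; have ek : k.+1%:R^-1 < e0 by exact: HN.
have ek0 : 0 < k.+1%:R^-1 :> R by rewrite invr_gt0.
rewrite -(mean_smear ek0) -RintegralZl//; apply: le_Rintegral => //.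
- exact: intZ.
- apply: (@int_support _ _ d (Cg * (2 * k.+1%:R^-1^-1 ^+ n * \int[mu]_x W x))) => //.
  + by apply: measurable_funM => //; exact: measurable_mean.
  + move=> y; rewrite normrM; apply: ler_pM => //.
    rewrite ger0_norm; last by apply: Rintegral_ge0 => x _; rewrite mulr_ge0// kern_ge0.
    rewrite -RintegralZl//; apply: le_Rintegral => //; [exact: iWk|exact: intZ|].
    by move=> x _; rewrite mulrC ler_wpM2r// kern_le.
  + by move=> y /gout ->; rewrite mul0r.
move=> y _; rewrite mulrC; have [By|/gout->] := pselect (eball n d y); last by rewrite !mul0r.
by rewrite ler_wpM2l// H.
Qed.

End smear.

Lemma mean_near0 e : 0 < e -> 0 < mean e 0 ->
  exists d, [/\ 0 < d & forall y, eball n d y -> mean e 0 / 2 <= mean e y].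
Proof.
move=> e0 m0; have [C C0 hC] := @flat'_lip R.
(* For x in the ball and |y_i| <= d <= 1, each coordinate changes the squared distance by at most (2
   r + 1) d, and [flat'] is C-Lipschitz. *)
pose L := e^-1 ^+ n * (C * (n%:R * (2 * r + 1) * e^-1 ^+ 2)).
have q0 : 0 <= e^-1 by rewrite invr_ge0 ltW.
have L0 : 0 <= L by rewrite !mulr_ge0 ?exprn_ge0 ?addr_ge0 ?mulr_ge0// ltW.
have IW0 : 0 <= \int[mu]_x W x by apply: Rintegral_ge0.
pose M := L * \int[mu]_x W x.
have M0 : 0 <= M by rewrite mulr_ge0.
pose d := Num.min 1 (mean e 0 / (2 * (M + 1))).
have d0 : 0 < d by rewrite lt_min ltr01 divr_gt0// mulr_gt0// ltr_wpDl.
have d1 : d <= 1 by rewrite ge_min lexx.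
have dM : M * d <= mean e 0 / 2.
  apply: (@le_trans _ _ ((M + 1) * d)); first by rewrite ler_wpM2r ?(ltW d0)// lerDl.
  rewrite mulrC -ler_pdivlMr; last by rewrite ltr_wpDl.
  by rewrite /d ge_min; apply/orP; right; rewrite invfM mulrA.
exists d; split; first exact: d0.
move=> y yd; have bound x : `|W x * kern e x 0 - W x * kern e x y| <= L * d * W x.
  rewrite -mulrBr normrM (ger0_norm (W0 x)) mulrC.
  have [xB|/Wout->] := pselect (eball n r x); last by rewrite !mulr0.
  rewrite ler_wpM2r// /kern -mulrBr normrM (ger0_norm (exprn_ge0 _ q0)) -mulrA ler_wpM2l ?exprn_ge0//.
  apply: le_trans (hC _ _) _; rewrite -[leRHS]mulrA ler_wpM2l//.
  rewrite (_ : _ - _ = (sqn (x - y) - sqn (x - 0)) * e^-1 ^+ 2); last by ring.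
  rewrite normrM (ger0_norm (exprn_ge0 2 q0)) mulrAC ler_wpM2r ?exprn_ge0//.
  rewrite /sqn -sumrB; apply: le_trans (ler_norm_sum _ _ _) _.
  apply: (@le_trans _ _ (\sum_(i < n) (2 * r + 1) * d)); last first.
    by rewrite sumr_const card_ord -[leLHS]mulr_natl mulrA.
  apply: ler_sum => i _; rewrite !mxE subr0.
  have hx := eball_coord i (ltW r0) xB; have hy := eball_coord i (ltW d0) yd.
  rewrite (_ : _ - _ = y ord0 i * (y ord0 i - 2 * x ord0 i)); last by ring.
  rewrite normrM mulrC; apply: ler_pM => //; apply: le_trans (ler_normB _ _) _.
  rewrite normrM ger0_norm// addrC; apply: lerD; first by rewrite ler_wpM2l.
  exact: le_trans hy d1.
have : mean e 0 - mean e y <= L * d * \int[mu]_x W x.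
  rewrite /mean -RintegralB//; [|exact: iWk|exact: iWk].
  rewrite -RintegralZl//; apply: le_Rintegral => //.
  - by apply: intB => //; exact: iWk.
  - exact: intZ.
  - by move=> x _; exact: le_trans (ler_norm _) (bound x).
rewrite mulrAC => /le_trans/(_ dM); rewrite lerBlDl -lerBlDr; apply: le_trans.
by rewrite lerBrDr -splitr.
Qed.

Lemma strong_minimum :
  (exists d c, [/\ 0 < d, 0 < c & {ae mu, forall x, eball n d x -> c <= W x}]) \/
  {ae mu, forall x, eball n r x -> W x = 0}.
Proof.
(* If the mean at the centre is positive at some scale e, it stays above half of that value for
   centres near 0, and monotonicity carries the bound to all smaller scales. *)
have [[e [e0 er m0]]|all0] := pselect (exists e, [/\ 0 < e, e < r & 0 < mean e 0]).
  left; have [d1 [d10 hd1]] := mean_near0 e0 m0.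
  have [d2 [d20 d2r hd2]] := eball_shift e0 er.
  pose d := Num.min d1 d2.
  have d0 : 0 < d by rewrite lt_min d10.
  have sub1 : eball n d `<=` (eball n d1 : set 'rV[R]_n) by apply: eball_sub; rewrite ge_min lexx.
  have sub2 : eball n d `<=` (eball n d2 : set 'rV[R]_n) by apply: eball_sub; rewrite ge_min lexx orbT.
  pose c := mean e 0 / 2; have c0 : 0 < c by rewrite divr_gt0.
  pose I1 := \int[mu]_z kern1 z.
  have low e' y : 0 < e' -> e' < e -> eball n d y -> c <= mean e' y.
    move=> e'0 e'e yd; apply: le_trans (hd1 _ (sub1 _ yd)) _.
    apply: (mean_decreasing e'0 e'e (rho := (e ^+ 2 + 3 * r ^+ 2) / 4)).
      have : e ^+ 2 < r ^+ 2 by rewrite ltr_pXn2r// nnegrE ltW.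
      lra.
    by move=> x; apply: hd2; exact: sub2.
  have mB : measurable (eball n d) := measurable_eball (ltW d0).
  have iWB : mu.-integrable (eball n d) (EFin \o W).
    by apply: integrableS iW => //.
  have icB : mu.-integrable (eball n d) (EFin \o (fun=> c)).
    by apply: int_cst => //; apply: eball_finite; exact: ltW.
  have iv : mu.-integrable (eball n d) (EFin \o (fun x => I1 * W x - c)).
    by apply: intB => //; exact: intZ.
  have : {ae mu, forall x, eball n d x -> 0 <= I1 * W x - c}.
    apply: (test_function_ge0_ae (ltW d0) iv) => phi tphi phi0.
    have [Cp Cp0 hCp] := test_function_bounded tphi.
    have outp x : ~ eball n d x -> phi x = 0 by exact: test_function_out tphi.
    have := @mean_ge_ae_int phi d Cp phi0 (smooth_continuous (test_function_smooth tphi))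
      (fun x => le_trans (ler_norm _) (hCp x)) (ltW d0) outp c e e0 low.
    have iphi : mu.-integrable setT (EFin \o phi).
      exact: (int_support (ltW d0) (test_function_measurable measurableT tphi) hCp outp).
    have iWphi : mu.-integrable setT (EFin \o (fun x => W x * phi x)).
      under eq_fun do rewrite mulrC.
      by apply: (int_bdM measurableT (C := Cp)) => //; exact: test_function_measurable tphi.
    rewrite -subr_ge0 [X in _ -> 0 <= X](eball_Rintegral (ltW d0)); last first.
      by move=> x /outp ->; rewrite mulr0.
    rewrite mulrC -/I1 -!RintegralZl// -RintegralB//; [|exact: intZ|exact: intZ].
    by under eq_Rintegral do rewrite mulrA -mulrBl.
  (* For I1 <= 0 the inequality c <= I1 W is incompatible with c > 0 and W >= 0, so any bound
     follows from it. *)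
  have [I1le0|I10] := leP I1 0.
    move=> h; exists d, 1; split => //; apply: filterS h => x + xd => /(_ xd).
    by have := W0 x; nra.
  move=> h; exists d, (c / I1); split => //; first by rewrite divr_gt0.
  by apply: filterS h => x + xd => /(_ xd); rewrite ler_pdivrMr// subr_ge0 mulrC.
(* Now every mean at the centre is at most 0, while the kernel of scale s is positive on the ball of
   radius s. For s = 0 the ball is empty. *)
right; apply: eball_exhaust r0 _ => s; rewrite le_eqVlt => /predU1P[<- _|s0 sr].
  by apply: aeW => x; rewrite /eball/= ltNge sqrtr_ge0.
have le0 : mean s 0 <= 0.
  by rewrite leNgt; apply/negP => m0; apply: all0; exists s.
have := Rintegral_le0_ae measurableT (iWk 0 s0) _ le0 => H.
have {}H : {ae mu, forall x, [set: 'rV[R]_n] x -> W x * kern s x 0 = 0}.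
  by apply: H; apply: aeW => x _; rewrite mulr_ge0// kern_ge0.
apply: filterS H => x + xs => /(_ I)/eqP; rewrite mulf_eq0 => /orP[/eqP//|].
rewrite gt_eqF// /kern mulr_gt0 ?exprn_gt0 ?invr_gt0// flat'_gt0 subr_gt0 subr0.
rewrite exprVn ltr_pdivrMr ?exprn_gt0// mul1r.
by move/eballE : xs => /(_ (ltW s0)).
Qed.

End strong_minimum.

(** * Lp norms and Sobolev spaces on balls *)

Section Lp_norm.
Context {R : realType} {n : nat}.
Local Notation mu := (lebesgue_rV R n).
Implicit Types (u v : 'rV[R]_n -> R) (p r C : R).

Lemma eball_gt0 r : 0 < r -> (0 < mu (eball n r))%E.
Proof.
(* A cube of half-side r/(n+1) fits into the ball, because n / (n+1)^2 < 1. *)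
move=> r0; pose t := r / (n.+1%:R : R).
have t0 : 0 < t by rewrite divr_gt0.
have sub : cbox (fun=> - t) (fun=> t) `<=` (eball n r : set 'rV[R]_n).
  move=> x hx; apply/eballE; first exact: ltW.
  apply: (@le_lt_trans _ _ (\sum_(i < n) t ^+ 2)).
    apply: ler_sum => i _; have := hx i; rewrite in_itv/= -ler_norml => h.
    by rewrite -[leLHS]real_normK ?num_real// ler_pXn2r// nnegrE ltW.
  rewrite sumr_const card_ord /t expr_div_n -[ltLHS]mulr_natl mulrCA gtr_pMr ?exprn_gt0//.
  rewrite ltr_pdivrMr ?exprn_gt0// mul1r -natrX ltr_nat expnS expn1.
  by rewrite mulSn (leq_trans (ltnSn n))// leq_addr.
apply: (@lt_le_trans _ _ (mu (cbox (fun=> - t) (fun=> t)))).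
  rewrite lebesgue_rV_box; last by move=> i; rewrite -subr_ge0 opprK addr_ge0// ltW.
  by rewrite lte_fin prodr_gt0// => i _; rewrite opprK addr_gt0.
apply: le_measure => //; rewrite inE; first exact: measurable_cbox.
exact: measurable_eball (ltW r0).
Qed.

(** The L^oo norm is an essential supremum under the condition that the whole space has positive
    measure; this selects that case. *)
Lemma setT_gt0 : (0 < mu setT)%E.
Proof.
apply: lt_le_trans (eball_gt0 ltr01) _; apply: le_measure => //; rewrite inE//.
exact: measurable_eball.
Qed.

Section eball.
Variables (r : R).
Hypothesis r0 : 0 < r.
Local Notation B := (eball n r).

Let mB : measurable (eball n r) := measurable_eball (ltW r0).

Lemma Lp_norm_ge0 (p : \bar R) u : (0 <= Lp_norm B p u)%E.
Proof. exact: Lnorm_ge0. Qed.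

Lemma Lp_normE p u : p != 0 ->
  (Lp_norm B p%:E u `^ p = \int[mu]_(x in B) (`|u x| `^ p)%:E)%E.
Proof.
move=> p0; rewrite /Lp_norm poweR_Lnorm// [RHS]integral_mkcond.
apply: eq_integral => x _; rewrite !patchE; case: ifP => _ /=.
  by [].
by rewrite normr0 powR0.
Qed.

Let finB : (mu (eball n r) < +oo)%E := eball_finite (ltW r0).

Let mpatch u : measurable_fun B u -> measurable_fun setT ((EFin \o u) \_ B).
Proof. by move=> mu_; apply/(measurable_restrictT _ mB)/measurable_EFinP. Qed.

Lemma Lp_norm_ae_eq p u v : measurable_fun B u -> measurable_fun B v ->
  {ae mu, forall x, B x -> u x = v x} -> Lp_norm B p%:E u = Lp_norm B p%:E v.
Proof.
move=> mu_ mv uv; rewrite /Lp_norm unlock; congr poweR.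
pose P (w : 'rV[R]_n -> R) : 'rV[R]_n -> \bar R := (EFin \o w) \_ B.
have mP w : measurable_fun B w -> measurable_fun setT (fun x => (`|P w x| `^ p)%E).
  move=> mw; have H : measurable_fun setT (P w) := mpatch mw.
  apply: (measurableT_comp (f := fun x : \bar R => (x `^ p)%E)); first exact: measurable_poweR.
  exact: measurableT_comp.
apply: ae_eq_integral => //; [exact: mP|exact: mP|].
apply: filterS uv => x + _; rewrite !patchE.
by case: ifPn => // xB /(_ _)/= ->//; rewrite inE in xB.
Qed.

(** Since |u|/C <= 1 its p-th power is at most |u|/C, and 1/C <= 1; for bounded functions this
    reduces L^p to L^1. *)
Lemma Lp_norm_bound p C u : 1 <= p -> 1 <= C -> measurable_fun B u ->
  (forall x, B x -> `|u x| <= C) ->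
  (Lp_norm B p%:E u `^ p <= (C `^ p * \int[mu]_(x in B) `|u x|)%:E)%E.
Proof.
move=> p1 C1 mu_ uC; have p0 : 0 < p by rewrite (lt_le_trans ltr01).
have C0 : 0 < C by rewrite (lt_le_trans ltr01).
have iu : mu.-integrable B (EFin \o (fun x => `|u x|)).
  apply: (int_le mB (g := fun=> C)).
  - exact: measurableT_comp.
  - by move=> x Bx; rewrite normr_id uC.
  - exact: int_cst.
rewrite Lp_normE ?gt_eqF// -RintegralZl// /Rintegral fineK; last first.
  by apply: integrable_fin_num => //; exact: (intZ mB).
apply: ge0_le_integral => //.
- apply/measurable_EFinP; apply: (measurableT_comp (f := fun t : R => t `^ p)).
    exact: measurable_powR.
  exact: measurableT_comp.
- apply/measurable_EFinP; apply: measurable_funM => //; exact: measurableT_comp.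
move=> x Bx; rewrite lee_fin; have [->|ux] := eqVneq (u x) 0.
  by rewrite normr0 powR0 ?mulr0// gt_eqF.
have ux0 : 0 < `|u x| by rewrite normr_gt0.
have -> : `|u x| `^ p = C `^ p * (`|u x| / C) `^ p.
  by rewrite -powRM ?(ltW C0) ?divr_ge0 ?(ltW C0)// mulrC divfK ?gt_eqF.
rewrite ler_pM2l ?powR_gt0//.
apply: (@le_trans _ _ (`|u x| / C)).
  by rewrite ge1r_powR// divr_gt0//= ler_pdivrMr// mul1r uC.
by rewrite ler_piMr// invf_le1.
Qed.

Lemma Lp_norm_lty p C u : 1 <= p -> measurable_fun B u ->
  (forall x, B x -> `|u x| <= C) -> (Lp_norm B p%:E u < +oo)%E.
Proof.
move=> p1 mu_ uC; have p0 : 0 < p by rewrite (lt_le_trans ltr01).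
apply: (@lty_poweRy _ _ p); first by rewrite gt_eqF.
apply: le_lt_trans (Lp_norm_bound (C := Num.max 1 C) p1 _ mu_ _) _; rewrite ?ltry//.
  by rewrite le_max lexx.
by move=> x Bx; rewrite le_max uC ?orbT.
Qed.

(** Uniform bounds upgrade L^1 convergence to every finite p, which is how [u_infty] is placed in
    all the spaces at once. *)
Lemma Lp_norm_cvg0 p C (u : nat -> 'rV[R]_n -> R) : 1 <= p ->
  (forall j, measurable_fun B (u j)) -> (forall j x, B x -> `|u j x| <= C) ->
  \int[mu]_(x in B) `|u j x| @[j --> \oo] --> (0 : R) ->
  Lp_norm B p%:E (u j) @[j --> \oo] --> 0%E.
Proof.
move=> p1 mu_ uC cu; have p0 : 0 < p by rewrite (lt_le_trans ltr01).
pose D := Num.max 1 C; have D1 : 1 <= D by rewrite le_max lexx.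
have uD j x : B x -> `|u j x| <= D by move=> Bx; rewrite le_max uC ?orbT.
pose I j := \int[mu]_(x in B) `|u j x|.
have I0 j : 0 <= I j by apply: Rintegral_ge0.
pose a j := (D `^ p * I j) `^ p^-1.
have Na j : (Lp_norm B p%:E (u j) <= (a j)%:E)%E.
  have h := Lp_norm_bound p1 D1 (mu_ j) (uD j).
  have K : (((Lp_norm B p%:E (u j)) `^ p) `^ p^-1 = Lp_norm B p%:E (u j))%E.
    by rewrite -poweRrM divff ?gt_eqF// poweRe1// Lp_norm_ge0.
  rewrite -K -poweR_EFin; apply: gt0_ler_poweR => //.
  - by rewrite invr_ge0 ltW.
  - by rewrite in_itv/= poweR_ge0 leey.
  - by rewrite in_itv/= leey andbT lee_fin mulr_ge0// powR_ge0.
have a0 : a j @[j --> \oo] --> (0 : R).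
  apply/cvgrPdist_le => e e0; have ep : 0 < e `^ p / D `^ p.
    by rewrite divr_gt0 ?powR_gt0// (lt_le_trans ltr01).
  have /cvgrPdist_le/(_ _ ep) := cu; apply: filterS => j.
  rewrite !sub0r !normrN (ger0_norm (I0 j)) (ger0_norm (powR_ge0 _ _)) => h.
  rewrite -[leRHS](powRr1 (ltW e0)) -(divff (lt0r_neq0 p0)) powRrM.
  apply: ge0_ler_powR; rewrite ?nnegrE ?invr_ge0 ?mulr_ge0 ?powR_ge0 ?(ltW p0)//.
  by rewrite mulrC -ler_pdivlMr// powR_gt0// (lt_le_trans ltr01).
apply: (@squeeze_cvge _ _ _ _ (fun=> 0%E) _ (fun j => (a j)%:E)).
- by apply: nearW => j; rewrite Lp_norm_ge0 Na.
- exact: cvg_cst.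
- by apply: cvg_EFin => //; exact: nearW.
Qed.

Lemma Lp2_int_sqr u : measurable_fun B u -> (Lp_norm B 2%:E u < +oo)%E ->
  mu.-integrable B (EFin \o (fun x => u x ^+ 2)) /\
  (Lp_norm B 2%:E u `^ 2 = (\int[mu]_(x in B) (u x ^+ 2))%:E)%E.
Proof.
move=> mu_ u2.
have E : (Lp_norm B 2%:E u `^ 2 = \int[mu]_(x in B) (u x ^+ 2)%:E)%E.
  rewrite Lp_normE//; apply: eq_integral => x _; congr EFin.
  by rewrite powR_mulrn// real_normK ?num_real.
have iu : mu.-integrable B (EFin \o (fun x => u x ^+ 2)).
  apply/integrableP; split; first exact/measurable_EFinP/measurable_funX.
  rewrite (_ : (\int[mu]_(x in B) _ = Lp_norm B 2%:E u `^ 2)%E).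
    exact: poweR_lty.
  by rewrite E; apply: eq_integral => x _ /=; rewrite ger0_norm// sqr_ge0.
by split => //; rewrite E /Rintegral fineK//; exact: integrable_fin_num.
Qed.

Lemma sqr_int u : measurable_fun B u -> mu.-integrable B (EFin \o (fun x => u x ^+ 2)) ->
  mu.-integrable B (EFin \o u).
Proof.
move=> mu_ iu; apply: (int_le mB (g := fun x => 1 + u x ^+ 2)) => //.
  move=> x _; rewrite -[u x ^+ 2]real_normK ?num_real//.
  by move: `|u x| => t; have := sqr_ge0 (t - 1); have := sqr_ge0 t; nra.
by apply: (intD mB) => //; exact: int_cst.
Qed.

Lemma Lp2_cvg (u : nat -> 'rV[R]_n -> R) : (forall j, measurable_fun B (u j)) ->
  Lp_norm B 2%:E (u j) @[j --> \oo] --> 0%E ->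
  \int[mu]_(x in B) (u j x ^+ 2) @[j --> \oo] --> (0 : R).
Proof.
move=> mu_ cu; apply/cvgrPdist_lt => e e0.
(* A norm N < t satisfies N^2 <= t <= e because t <= 1. *)
pose t := Num.min e 1; have t0 : 0 < t by rewrite lt_min e0 ltr01.
have : \forall j \near \oo, (Lp_norm B 2%:E (u j) < t%:E)%E.
  have /fine_cvgP[fin /cvgrPdist_lt/(_ _ t0) cv] := cu.
  apply: filterS2 fin cv => j fj; rewrite sub0r normrN -[X in _ -> (X < _)%E](fineK fj) lte_fin.
  exact: le_lt_trans (ler_norm _).
apply: filterS => j h; rewrite sub0r normrN ger0_norm; last first.
  by apply: Rintegral_ge0 => x _; exact: sqr_ge0.
have [_ E] := Lp2_int_sqr (mu_ j) (lt_trans h (ltry _)).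
have N0 := Lp_norm_ge0 2%:E (u j).
have Nf : Lp_norm B 2%:E (u j) \is a fin_num by rewrite ge0_fin_numE// (lt_trans h)// ltry.
move: h N0 E; rewrite -(fineK Nf); move: (fine _) => N; rewrite lte_fin lee_fin => h N0.
rewrite poweR_EFin powR_mulrn// => -[<-].
have : t <= 1 by rewrite ge_min lexx orbT.
have : t <= e by rewrite ge_min lexx.
by nra.
Qed.

(** Young's inequality |s| <= t + s^2 / t on a set of finite measure stands in for
    Cauchy-Schwarz. *)
Lemma L2_cvg_L1 (u : nat -> 'rV[R]_n -> R) :
  (forall j, measurable_fun B (u j)) ->
  (forall j, mu.-integrable B (EFin \o (fun x => u j x ^+ 2))) ->
  \int[mu]_(x in B) (u j x ^+ 2) @[j --> \oo] --> (0 : R) ->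
  \int[mu]_(x in B) `|u j x| @[j --> \oo] --> (0 : R).
Proof.
move=> mu_ iu cu; apply/cvgrPdist_lt => e e0.
pose V := \int[mu]_(x in B) (1 : R).
have V0 : 0 <= V by apply: Rintegral_ge0.
pose t := e / (2 * (V + 1)); have t0 : 0 < t by rewrite divr_gt0// mulr_gt0// ltr_wpDl.
have te : 0 < t * (e / 2) by rewrite mulr_gt0// divr_gt0.
have /cvgrPdist_lt/(_ _ te) := cu; apply: filterS => j.
have i1 : mu.-integrable B (EFin \o (fun=> 1 : R)).
  exact: int_cst.
rewrite !sub0r !normrN ger0_norm; last by apply: Rintegral_ge0 => x _; exact: sqr_ge0.
rewrite ger0_norm; last by apply: Rintegral_ge0.
move=> h; apply: (@le_lt_trans _ _ (t * V + t^-1 * \int[mu]_(x in B) (u j x ^+ 2))).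
  rewrite -!RintegralZl// -RintegralD//; [|exact: (intZ mB)|exact: (intZ mB)].
  apply: (le_Rintegral mB).
  - exact/int_norm/sqr_int.
  - by apply: (intD mB); exact: (intZ mB).
  move=> x _; rewrite -[u j x ^+ 2]real_normK ?num_real// mulr1.
  move: `|u j x| (normr_ge0 (u j x)) => s s0.
  rewrite -subr_ge0 (_ : _ - _ = t^-1 * ((s - t) ^+ 2 + s * t)); last by field; rewrite gt_eqF.
  apply: mulr_ge0; first by rewrite invr_ge0 ltW.
  by rewrite addr_ge0 ?sqr_ge0// (mulr_ge0 s0 (ltW t0)).
rewrite [e]splitr; apply: ler_ltD; last by rewrite mulrC ltr_pdivrMr// mulrC.
rewrite /t invfM mulrA -mulrA ler_piMr ?divr_ge0 ?(ltW e0)//.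
by rewrite mulrC ler_pdivrMr ?ltr_wpDl// mul1r lerDl.
Qed.

Lemma Lp_norm_oo_ge u : {ae mu, forall x, B x -> (`|u x|%:E <= Lp_norm B +oo u)%E}.
Proof.
rewrite /Lp_norm unlock setT_gt0; have := ess_sup_ge mu (abse \o ((EFin \o u) \_ B)).
by apply: filterS => x + Bx; rewrite /= patchE mem_set.
Qed.

Lemma Lp_norm_oo_le u C : 0 <= C -> {ae mu, forall x, B x -> `|u x| <= C} ->
  (Lp_norm B +oo u <= C%:E)%E.
Proof.
move=> C0 h; rewrite /Lp_norm unlock setT_gt0; apply/ess_supP.
apply: filterS h => x uC; rewrite /= patchE.
by case: ifPn => [|_] /=; rewrite lee_fin ?normr0// inE.
Qed.

End eball.
End Lp_norm.

(** * Smooth functions as Sobolev functions, and [u_infty] as a hinged function *)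

Section hinged.
Context {R : realType} {n : nat}.
Variable r : R.
Hypothesis r0 : 0 < r.
Local Notation mu := (lebesgue_rV R n).
Local Notation B := (eball n r).
Implicit Types (u v f g phi : 'rV[R]_n -> R) (p C : R) (s : seq 'I_n).

Let mB : measurable (eball n r) := measurable_eball (ltW r0).
Let finB : (mu (eball n r) < +oo)%E := eball_finite (ltW r0).

Lemma smooth_bounded f : smooth f -> exists2 C, 0 <= C & forall x, B x -> `|f x| <= C.
Proof.
move=> sf; pose K : set 'rV[R]_n := [set x | sqn x <= r ^+ 2].
have K0 : K !=set0.
  exists 0; rewrite /K /= /sqn big1 ?sqr_ge0// => i _.
  by rewrite mxE expr0n.
have [|c _ hc] := @EVT_max_rV _ _ (fun x => `|f x|) _ K0 (@compact_sqn_ball _ _ _).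
  apply: continuous_subspaceT => x; apply: continuous_comp; last exact: norm_continuous.
  exact: smooth_continuous.
exists `|f c| => // x /eballE -/(_ (ltW r0)) h; apply: hc.
by rewrite inE; exact: ltW.
Qed.

Lemma bounded_int f C : measurable_fun B f -> (forall x, B x -> `|f x| <= C) ->
  mu.-integrable B (EFin \o f).
Proof. by move=> mf fC; apply: (int_le mB mf fC); exact: int_cst. Qed.

Lemma smooth_int f : smooth f -> mu.-integrable B (EFin \o f).
Proof.
move=> sf; have [C _ hC] := smooth_bounded sf.
exact: bounded_int (smooth_measurable mB sf) hC.
Qed.

Lemma int_loc f : mu.-integrable B (EFin \o f) -> loc_integrable B f.
Proof.
move=> intf; split; first exact: int_meas intf.
move=> K cK sK; apply: integrableS intf => //.
apply: closed_rV_measurable; apply: compact_closed => //; exact: norm_hausdorff.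
Qed.

(** The product [phi] times [u] is a test function, so its derivative integrates to 0. *)
Lemma Rintegral_by_parts i u phi : smooth u -> test_function B phi ->
  \int[mu]_(x in B) (u x * partial i phi x) = - \int[mu]_(x in B) (partial i u x * phi x).
Proof.
move=> su tphi; have sphi := test_function_smooth tphi.
have := Rintegral_partial i (ltW r0) (test_functionMr tphi su).
have E x : partial i (fun x => phi x * u x) x = u x * partial i phi x + partial i u x * phi x.
  apply: partialE; refine (is_derive_eq (is_deriveM (smooth_is_derive i x sphi) (smooth_is_derive i x su)) _).
  rewrite /GRing.scale/=; ring.
under eq_Rintegral do rewrite E.
have i1 : mu.-integrable B (EFin \o (fun x => u x * partial i phi x)).
  exact: smooth_int (smoothM su (smooth_partial i sphi)).
have i2 : mu.-integrable B (EFin \o (fun x => partial i u x * phi x)).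
  exact: smooth_int (smoothM (smooth_partial i su) sphi).
by rewrite RintegralD// => /eqP; rewrite addr_eq0 => /eqP.
Qed.

Lemma test_function_partials s phi : test_function B phi -> test_function B (partials s phi).
Proof. by move=> tphi; elim: s => //= i s; exact: test_function_partial. Qed.

Lemma smooth_partials s u : smooth u -> smooth (partials s u).
Proof. by move=> su; elim: s => [|i s IH]; [exact: su|exact: smooth_partial IH]. Qed.

(** Integration by parts moves the outermost derivative first, so the derivatives reach [u] in
    reversed order; with [rev s] no interchange of derivatives is involved. *)
Lemma smooth_weak_derivative s u : smooth u -> is_weak_derivative B s u (partials (rev s) u).
Proof.
move=> su; split; [exact/int_loc/smooth_int|exact/int_loc/smooth_int/smooth_partials|].
move=> phi tphi; elim: s u su => [|i s IH] u su /=; first by rewrite expr0 mul1r.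
rewrite (Rintegral_by_parts i su (test_function_partials s tphi)).
rewrite (IH _ (smooth_partial i su)) rev_cons partials_rcons exprS.
by rewrite -[LHS]mulN1r mulrA.
Qed.

Lemma weak_derivativeP s u g : is_weak_derivative B s u g ->
  is_weak_derivative B s u (weak_derivative B s u).
Proof. by move=> h; rewrite /weak_derivative; apply: (xgetPex (cst 0)); exists g. Qed.

Lemma weak_derivative_unique s u f g : is_weak_derivative B s u f ->
  is_weak_derivative B s u g -> {ae mu, forall x, B x -> f x = g x}.
Proof.
move=> [_ lf hf] [_ lg hg]; apply: loc_test_function_ae_eq => // phi tphi.
have := hf _ tphi; rewrite (hg _ tphi) => /mulfI -> //.
by rewrite expf_neq0// oppr_eq0 oner_neq0.
Qed.

Lemma smooth_Lp p u : 1 <= p -> smooth u -> Lp B p%:E u.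
Proof.
move=> p1 su; have mu_ := smooth_measurable mB su; have [C _ hC] := smooth_bounded su.
by split => //; exact: Lp_norm_lty hC.
Qed.

Lemma smooth_sobolev k p u : 1 <= p -> smooth u -> sobolev B k p%:E u.
Proof.
move=> p1 su; split; first exact: smooth_Lp.
move=> s _; exists (partials (rev s) u); first exact: smooth_weak_derivative.
exact: smooth_Lp p1 (smooth_partials _ su).
Qed.

Lemma bounded_cvg0 C (F : nat -> 'rV[R]_n -> R) : (forall j, measurable_fun B (F j)) ->
  (forall j x, B x -> `|F j x| <= C) -> (forall x, B x -> F j x @[j --> \oo] --> (0 : R)) ->
  \int[mu]_(x in B) `|F j x| @[j --> \oo] --> (0 : R) /\
  \int[mu]_(x in B) (F j x ^+ 2) @[j --> \oo] --> (0 : R).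
Proof.
move=> mF FC cF; have zero : \int[mu]_(x in B) (0 : R) = 0 by rewrite Rintegral_cst// mul0r.
split.
- have [||||_] := @Rintegral_dct _ _ _ mu B mB (fun j x => `|F j x|) (fun=> 0) (fun=> C).
  + by move=> j; exact: measurableT_comp.
  + exact: int_cst.
  + by move=> j x Bx; rewrite normr_id FC.
  + by move=> x Bx; rewrite -(normr0 R); apply: cvg_norm; exact: cF.
  by rewrite zero.
- have [||||_] := @Rintegral_dct _ _ _ mu B mB (fun j x => F j x ^+ 2) (fun=> 0) (fun=> C ^+ 2).
  + by move=> j; exact: measurable_funX.
  + exact: int_cst.
  + move=> j x Bx; rewrite normrX ler_pXn2r ?nnegrE ?FC//.
    exact: le_trans (FC j x Bx).
  + move=> x Bx; rewrite -(mulr0 (0 : R)); under eq_fun do rewrite expr2.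
    by apply: cvgM; exact: cF.
  by rewrite zero.
Qed.

Hypothesis n0 : (0 < n)%N.

Let n0R : 0 < n%:R :> R. Proof. by rewrite ltr0n. Qed.

Local Notation U := (@u_infty R n r).

Lemma u_inftyE x : U x = (2 * n%:R)^-1 * (r ^+ 2 - sqn x).
Proof. by rewrite /u_infty enorm_sqr. Qed.

Lemma smooth_u_infty : smooth U.
Proof.
have := smoothZ (2 * n%:R)^-1 (smoothB (smooth_cst (r ^+ 2)) (@smooth_sqn0 R n)).
by congr smooth; apply/funext => x; rewrite u_inftyE.
Qed.

Lemma partial_u_infty i : partial i U = fun x => - (n%:R^-1 * x ord0 i).
Proof.
apply/funext => x; apply: partialE.
rewrite (_ : U = fun y => (2 * n%:R)^-1 * (r ^+ 2 - sqn y)); last first.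
  by apply/funext => y; rewrite u_inftyE.
refine (is_derive_eq (is_deriveZ (2 * n%:R)^-1
  (is_deriveB (is_derive_cst (r ^+ 2) x 'e_i) (is_derive_sqn0 x i))) _).
by rewrite sub0r /GRing.scale/=; field; rewrite gt_eqF.
Qed.

Lemma partial2_u_infty i j : partial j (partial i U) = fun=> - (n%:R^-1 * (j == i)%:R).
Proof.
apply/funext => x; apply: partialE; rewrite partial_u_infty.
exact: is_deriveN (is_deriveZ n%:R^-1 (is_derive_coord j i x)).
Qed.

Lemma sum_partial2_u_infty x : \sum_(i < n) partial i (partial i U) x = -1.
Proof.
under eq_bigr do rewrite partial2_u_infty eqxx mulr1.
by rewrite sumrN sumr_const card_ord -[_ *+ _]mulr_natl divff// gt_eqF.
Qed.

Lemma u_infty_ge0 x : B x -> 0 <= U x.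
Proof.
move=> /eballE -/(_ (ltW r0)) h; rewrite u_inftyE mulr_ge0 ?invr_ge0 ?mulr_ge0 ?(ltW n0R)//.
by rewrite subr_ge0 ltW.
Qed.

Lemma u_infty_le x : U x <= r ^+ 2 / (2 * n%:R).
Proof.
rewrite u_inftyE mulrC ler_wpM2r ?invr_ge0 ?mulr_ge0 ?(ltW n0R)//.
by rewrite gerBl sqn_ge0.
Qed.

(** The finite family is indexed by the naturals, with a trivial condition at the indices beyond it,
    to use countable intersections. *)
Lemma ae_forall_fin (P : 'I_n -> 'rV[R]_n -> Prop) : (forall i, {ae mu, forall x, P i x}) ->
  {ae mu, forall x, forall i, P i x}.
Proof.
move=> H; pose Q (k : nat) x := forall i : 'I_n, val i = k -> P i x.
have : forall k, {ae mu, forall x, Q k x}.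
  move=> k; have [i ik|ni] := pickP (fun i : 'I_n => val i == k).
    apply: filterS (H i) => x Px j jk; rewrite (_ : j = i)//.
    by apply: val_inj; rewrite /= jk (eqP ik).
  by apply: aeW => x i ik; move: (ni i); rewrite ik eqxx.
by move=> /ae_foralln; apply: filterS => x Qx i; exact: (Qx i i).
Qed.

Lemma weak_laplacian_u_infty : {ae mu, forall x, B x -> weak_laplacian B U x = -1}.
Proof.
have H (i : 'I_n) : {ae mu, forall x, B x -> weak_derivative B [:: i; i] U x = partial i (partial i U) x}.
  have h := smooth_weak_derivative [:: i; i] smooth_u_infty.
  exact: weak_derivative_unique (weak_derivativeP h) h.
have := ae_forall_fin H; apply: filterS => x hx Bx.
rewrite /weak_laplacian -[RHS](sum_partial2_u_infty x); apply: eq_bigr => i _.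
exact: hx.
Qed.

(** A plain cutoff suffices because [U] vanishes on the sphere like r^2 - |x|^2, which compensates
    the factor k in the gradient of the cutoff. *)
Definition u_approx (k : nat) : 'rV[R]_n -> R := fun x => cutoff r k x * U x.

Lemma u_approx_test k : test_function B (u_approx k).
Proof. by apply: test_functionMr; [apply/cutoff_test/ltW|exact: smooth_u_infty]. Qed.

Lemma partial_cutoff k i x : partial i (@cutoff R n r k) x =
  - (2 * k%:R) * (flat' (k%:R * (r ^+ 2 - sqn x) - 1) * x ord0 i).
Proof.
apply: partialE.
have d0 := is_deriveB (is_derive_cst (r ^+ 2) x 'e_i) (is_derive_sqn0 x i).
have d1 := is_deriveB (is_deriveZ k%:R d0) (is_derive_cst (1 : R) x 'e_i).
refine (is_derive_eq (is_derive_comp d1 (flat_derive _)) _).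
rewrite /GRing.scale/=; ring.
Qed.

(** The last term is [U] times the gradient of the cutoff. In t = k (r^2 - |x|^2) its final factor
    is t [flat'] (t - 1), bounded in t and tending to 0 as t grows. *)
Lemma partial_u_approx k i x : partial i (u_approx k) x - partial i U x =
  (cutoff r k x - 1) * partial i U x
  - n%:R^-1 * x ord0 i * (k%:R * (r ^+ 2 - sqn x) * flat' (k%:R * (r ^+ 2 - sqn x) - 1)).
Proof.
have -> : partial i (u_approx k) x = cutoff r k x * partial i U x + U x * partial i (@cutoff R n r k) x.
  apply: partialE; refine (is_deriveM _ _); apply: smooth_is_derive.
    exact: smooth_cutoff.
  exact: smooth_u_infty.
rewrite partial_cutoff u_inftyE; field; by rewrite gt_eqF.
Qed.

(** Write t = (t - 1) + 1: the two parts contribute at most 1 and 2. *)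
Lemma flat'_shift_le (t : R) : 0 <= t -> 0 <= t * flat' (t - 1) <= 3.
Proof.
move=> t0; rewrite mulr_ge0 ?flat'_ge0//=.
have [t1|t1] := ltP 0 (t - 1); last by rewrite (_ : flat' _ = 0) ?mulr0//; exact: bumpf_le0.
have := flat'_le_inv t1; have := flat'_le2 (t - 1); nra.
Qed.

Lemma flat'_shift_cvg (v : R) : 0 < v -> k%:R * v * flat' (k%:R * v - 1) @[k --> \oo] --> (0 : R).
Proof.
move=> v0; apply/cvgrPdist_le => e e0; near=> k.
have kv : Num.max 2 (4 / e + 1) <= k%:R * v.
  by rewrite -ler_pdivrMr//; near: k; exact: nbhs_infty_ger.
move: kv; rewrite ge_max => /andP[k2 ke].
set t := k%:R * v - 1; have t1 : 1 <= t by rewrite /t; lra.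
have t0 : 0 < t by lra.
have te : 4 / e <= t by rewrite /t; lra.
rewrite sub0r normrN ger0_norm; last by rewrite mulr_ge0 ?flat'_ge0//; lra.
have h := flat'_le_inv2 t0.
have -> : k%:R * v = t + 1 by rewrite /t subrK.
apply: (@le_trans _ _ ((t + 1) * t^-1 ^+ 2)); first by rewrite ler_wpM2l// addr_ge0 ?(ltW t0).
apply: (@le_trans _ _ (2 * t^-1)).
  rewrite expr2 mulrA ler_wpM2r ?invr_ge0 ?(ltW t0)// ler_pdivrMr//; lra.
rewrite ler_pdivrMr//; move: te; rewrite ler_pdivrMr//; nra.
Unshelve. all: by end_near. Qed.

Let v0 x : B x -> 0 < r ^+ 2 - sqn x.
Proof. by move=> /eballE -/(_ (ltW r0)); rewrite subr_gt0. Qed.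

Lemma u_approx_bound k x : B x -> `|u_approx k x - U x| <= r ^+ 2 / (2 * n%:R).
Proof.
move=> Bx; have := @cutoff_ge0 R n r k x; have := @cutoff_le1 R n r k x.
have := u_infty_ge0 Bx; have := u_infty_le x; rewrite /u_approx.
move: (cutoff r k x) (U x) (r ^+ 2 / _) => c u M h1 h2 h3 h4.
rewrite ler_norml; apply/andP; split; nra.
Qed.

Lemma u_approx_cvg x : B x -> u_approx k x - U x @[k --> \oo] --> (0 : R).
Proof.
move=> Bx; rewrite -(subrr (1 * U x)) mul1r; apply: cvgB; last exact: cvg_cst.
by rewrite -[X in _ --> X]mul1r; apply: cvgMl; apply: cutoff_cvg => //; exact: ltW.
Qed.

Lemma partial_u_approx_bound k i x : B x -> `|partial i (u_approx k) x - partial i U x| <= 4 * r.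
Proof.
move=> Bx; rewrite partial_u_approx partial_u_infty.
have hx := eball_coord i (ltW r0) Bx.
have nx : `|n%:R^-1 * x ord0 i| <= r.
  rewrite normrM gtr0_norm ?invr_gt0//; apply: le_trans _ hx; rewrite ler_piMl//.
  by rewrite invf_le1// ler1n.
have kv0 : 0 <= k%:R * (r ^+ 2 - sqn x) by rewrite mulr_ge0// ltW// v0.
have /andP[f0 f3] := flat'_shift_le kv0.
apply: le_trans (ler_normB _ _) _; rewrite (_ : 4 * r = 1 * r + r * 3); last by ring.
apply: lerD; rewrite normrM; apply: ler_pM => //.
- have := @cutoff_ge0 R n r k x; have := @cutoff_le1 R n r k x => h1 h2.
  by rewrite ler_norml; apply/andP; split; lra.
- by rewrite normrN.
- by rewrite ger0_norm.
Qed.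

Lemma partial_u_approx_cvg i x : B x ->
  partial i (u_approx k) x - partial i U x @[k --> \oo] --> (0 : R).
Proof.
move=> Bx; rewrite (_ : (fun k => _) = fun k => (cutoff r k x - 1) * partial i U x
    - n%:R^-1 * x ord0 i * (k%:R * (r ^+ 2 - sqn x) * flat' (k%:R * (r ^+ 2 - sqn x) - 1))); last first.
  by apply/funext => k; rewrite partial_u_approx.
rewrite -[X in _ --> X](_ : 0 * partial i U x - n%:R^-1 * x ord0 i * 0 = 0); last first.
  by rewrite mul0r mulr0 subrr.
apply: cvgB.
  apply: cvgMl; rewrite -[X in _ --> X](subrr (1 : R)); apply: cvgB; last exact: cvg_cst.
  by apply: cutoff_cvg => //; exact: ltW.
by apply: cvgMr; apply: flat'_shift_cvg; exact: v0.
Qed.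

Let mapprox k : measurable_fun B (fun x => u_approx k x - U x).
Proof.
apply: measurable_funB; first exact: test_function_measurable mB (u_approx_test k).
exact: smooth_measurable mB smooth_u_infty.
Qed.

Let mpapprox i k : measurable_fun B (fun x => partial i (u_approx k) x - partial i U x).
Proof.
apply: measurable_funB; last exact: smooth_measurable mB (smooth_partial i smooth_u_infty).
exact: test_function_measurable mB (test_function_partial i (u_approx_test k)).
Qed.

Lemma u_approx_L : \int[mu]_(x in B) `|u_approx k x - U x| @[k --> \oo] --> (0 : R) /\
  \int[mu]_(x in B) ((u_approx k x - U x) ^+ 2) @[k --> \oo] --> (0 : R).
Proof. exact: bounded_cvg0 mapprox u_approx_bound u_approx_cvg. Qed.

Lemma partial_u_approx_L i :
  \int[mu]_(x in B) `|partial i (u_approx k) x - partial i U x| @[k --> \oo] --> (0 : R) /\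
  \int[mu]_(x in B) ((partial i (u_approx k) x - partial i U x) ^+ 2) @[k --> \oo] --> (0 : R).
Proof.
exact: bounded_cvg0 (mpapprox i) (fun k => @partial_u_approx_bound k i) (@partial_u_approx_cvg i).
Qed.

Lemma u_infty_sobolev0 p : 1 <= p -> sobolev0 B 1 p%:E U.
Proof.
move=> p1; split; first exact: smooth_sobolev smooth_u_infty.
exists u_approx; first exact: u_approx_test.
move=> s s1; have sU := smooth_u_infty.
have h := smooth_weak_derivative s sU.
have [_ [mw _] _] := weak_derivativeP h.
have ae := weak_derivative_unique (weak_derivativeP h) h.
have E k : Lp_norm B p%:E (partials s (u_approx k) \- weak_derivative B s U) =
    Lp_norm B p%:E (fun x => partials s (u_approx k) x - partials s U x).
  have mk : measurable_fun B (partials s (u_approx k)).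
    exact: test_function_measurable mB (test_function_partials s (u_approx_test k)).
  apply: (Lp_norm_ae_eq r0).
  - exact: measurable_funB.
  - by apply: measurable_funB => //; exact: smooth_measurable mB (smooth_partials s sU).
  - apply: filterS ae => x + Bx => /(_ Bx) /= ->; congr (_ - partials _ _ _).
    (* A list of at most one direction equals its own reversal. *)
    by case: s s1 {h mw mk} => [|i [|]].
under eq_fun do rewrite E.
case: s s1 {h mw ae E} => [|i [|//]] _ /=.
  exact: (Lp_norm_cvg0 r0 p1 mapprox u_approx_bound u_approx_L.1).
exact: (Lp_norm_cvg0 r0 p1 (mpapprox i) (fun k => @partial_u_approx_bound k i) (partial_u_approx_L i).1).
Qed.

Lemma measurable_weak_laplacian u :
  (forall i, exists g, is_weak_derivative B [:: i; i] u g) ->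
  measurable_fun B (weak_laplacian B u).
Proof.
move=> H; apply: (@measurable_sum _ _ _ _ _ _ (fun (i : 'I_n) => weak_derivative B [:: i; i] u)) => i.
by have [g /weak_derivativeP[_ [mg _] _]] := H i.
Qed.

Lemma u_infty_hinged : W2oo_hinged B U.
Proof.
move=> p /= p1; have sU := smooth_u_infty; split.
- by apply: smooth_sobolev sU; exact: ltW.
- by apply: u_infty_sobolev0; exact: ltW.
split.
  apply: measurable_weak_laplacian => i; exists (partials (rev [:: i; i]) U).
  exact: smooth_weak_derivative.
apply: (@le_lt_trans _ _ 1%:E); last by rewrite ltry.
apply: Lp_norm_oo_le => //; apply: filterS weak_laplacian_u_infty => x + Bx => /(_ Bx) ->.
by rewrite normrN normr1.
Qed.

End hinged.

(** * Comparison of hinged functions with u_infty *)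

Section comparison.
Context {R : realType} {n : nat}.
Variable r : R.
Hypotheses (r0 : 0 < r) (n0 : (0 < n)%N).
Local Notation mu := (lebesgue_rV R n).
Local Notation B := (eball n r).
Local Notation U := (@u_infty R n r).
Implicit Types (u v f g phi : 'rV[R]_n -> R).

Let mB : measurable (eball n r) := measurable_eball (ltW r0).
Let sU : smooth U := smooth_u_infty r.

Lemma weak_derivative_L2 s u : (exists2 g, is_weak_derivative B s u g & Lp B 2%:E g) ->
  [/\ is_weak_derivative B s u (weak_derivative B s u),
      mu.-integrable B (EFin \o weak_derivative B s u) &
      mu.-integrable B (EFin \o (fun x => weak_derivative B s u x ^+ 2))].
Proof.
move=> [g hg [mg g2]]; have hw := weak_derivativeP hg.
have mw : measurable_fun B (weak_derivative B s u) by case: hw => _ [].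
have ae := weak_derivative_unique r0 hw hg.
have w2 : (Lp_norm B 2%:E (weak_derivative B s u) < +oo)%E.
  by rewrite (Lp_norm_ae_eq r0 2 mw mg ae).
have [iw2 _] := Lp2_int_sqr r0 mw w2.
by split=> //; exact: sqr_int.
Qed.

Lemma int_test f phi : mu.-integrable B (EFin \o f) -> test_function B phi ->
  mu.-integrable B (EFin \o (fun x => f x * phi x)).
Proof. by move=> intf tphi; apply: loc_integrable_test => //; exact: int_loc. Qed.

Section hinged_function.
Variable u : 'rV[R]_n -> R.
Hypothesis hu : W2oo_hinged B u.
Local Notation D i := (weak_derivative B [:: i] u).
Local Notation DD i := (weak_derivative B [:: i; i] u).

Let hu2 : [/\ sobolev B 2 2%:E u, sobolev0 B 1 2%:E u & Lp B +oo%E (weak_laplacian B u)].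
Proof. by apply: hu; rewrite /= ltr1n. Qed.

Let u_L2 : measurable_fun B u /\ mu.-integrable B (EFin \o (fun x => u x ^+ 2)).
Proof. by have [[[mu_ u2] _] _ _] := hu2; have [] := Lp2_int_sqr r0 mu_ u2. Qed.

Let iu : mu.-integrable B (EFin \o u).
Proof. by have [mu_ iu2] := u_L2; exact: sqr_int. Qed.

Let D_L2 s : (size s <= 2)%N -> [/\ is_weak_derivative B s u (weak_derivative B s u),
      mu.-integrable B (EFin \o weak_derivative B s u) &
      mu.-integrable B (EFin \o (fun x => weak_derivative B s u x ^+ 2))].
Proof. by move=> s2; have [[_ H] _ _] := hu2; apply: weak_derivative_L2; exact: H. Qed.

Lemma int_weak_laplacian : mu.-integrable B (EFin \o weak_laplacian B u).
Proof. by apply: (int_sum mB) => i; have [] := D_L2 (isT : (size [:: i; i] <= 2)%N). Qed.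

(** Weak derivatives of both orders are defined against [u] itself; testing the first-order one with
    a derivative of [phi] shows that [DD i] is a weak derivative of [D i]. *)
Lemma weak_partial2 i phi : test_function B phi ->
  \int[mu]_(x in B) (u x * partial i (partial i phi) x) = \int[mu]_(x in B) (DD i x * phi x) /\
  \int[mu]_(x in B) (D i x * partial i phi x) = - \int[mu]_(x in B) (DD i x * phi x).
Proof.
move=> tphi; have [[_ _ h2] _ _] := D_L2 (isT : (size [:: i; i] <= 2)%N).
have [[_ _ h1] _ _] := D_L2 (isT : (size [:: i] <= 2)%N).
have e2 := h2 _ tphi; have e1 := h1 _ (test_function_partial i tphi).
rewrite /= in e1 e2; split; first by rewrite e2 sqrrN expr1n mul1r.
by move: e1; rewrite e2 sqrrN expr1n mul1r expr1 mulN1r => ->; rewrite opprK.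
Qed.

Lemma weak_laplacian_test phi : test_function B phi ->
  \sum_(i < n) \int[mu]_(x in B) (DD i x * phi x) = \int[mu]_(x in B) (weak_laplacian B u x * phi x).
Proof.
move=> tphi; rewrite -Rintegral_sum//; last first.
  by move=> i; apply: int_test tphi; have [] := D_L2 (isT : (size [:: i; i] <= 2)%N).
by apply: eq_Rintegral => x _; rewrite mulr_suml.
Qed.

Lemma hinged_approximation : exists w : nat -> 'rV[R]_n -> R,
  [/\ forall j, test_function B (w j),
      \int[mu]_(x in B) `|w j x - u x| @[j --> \oo] --> (0 : R) &
      forall i, \int[mu]_(x in B) ((partial i (w j) x - D i x) ^+ 2) @[j --> \oo] --> (0 : R)].
Proof.
have [_ [_ [w tw cw]] _] := hu2; exists w.
have mw j : measurable_fun B (w j) := test_function_measurable mB (tw j).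
have [mu_ iu2] := u_L2.
split => // [|i]; last first.
  have [[_ [md _] _] _ _] := D_L2 (isT : (size [:: i] <= 2)%N).
  apply: (Lp2_cvg r0) => [j|]; last exact: (cw [:: i]).
  by apply: measurable_funB => //; exact: test_function_measurable mB (test_function_partial i (tw j)).
have [hw iw iw2] := D_L2 (isT : (size [::] <= 2)%N).
(* For the empty list the approximation is to the chosen representative of [u], which equals [u]
   almost everywhere. *)
have hu0 : is_weak_derivative B [::] u u.
  by split; [exact: int_loc|exact: int_loc|move=> phi _; rewrite expr0 mul1r].
have ae := weak_derivative_unique r0 hw hu0.
have mwd := int_meas iw.
have c2 : \int[mu]_(x in B) ((w j x - weak_derivative B [::] u x) ^+ 2) @[j --> \oo] --> (0 : R).
  apply: (Lp2_cvg r0) => [j|]; last exact: (cw [::]).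
  exact: measurable_funB.
apply: (L2_cvg_L1 r0).
- by move=> j; exact: measurable_funB.
- move=> j; have [C C0 hC] := test_function_bounded (tw j).
  have iwu : mu.-integrable B (EFin \o (fun x => w j x * u x)).
    by apply: (int_bdM mB (C := C)) => // x _.
  have iww : mu.-integrable B (EFin \o (fun x => w j x ^+ 2)).
    apply: (bounded_int r0 (C := C ^+ 2)); first exact: measurable_funX.
    by move=> x _; rewrite normrX ler_pXn2r// nnegrE.
  have := intD mB (intB mB iww (intZ mB 2 iwu)) iu2; congr integrable.
  by apply/funext => x /=; congr EFin; ring.
rewrite (_ : (fun j => _) = (fun j => \int[mu]_(x in B) ((w j x - weak_derivative B [::] u x) ^+ 2)))//.
apply/funext => j; apply: Rintegral_ae_eq => //.
- by apply: measurable_funX; exact: measurable_funB.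
- by apply: measurable_funX; exact: measurable_funB.
- by apply: filterS ae => x + Bx => /(_ Bx) ->.
Qed.

Variables (M sigma : R).
Hypothesis M0 : 0 <= M.
Hypothesis lap_ge : {ae mu, forall x, B x -> 0 <= M + sigma * weak_laplacian B u x}.

Definition gap x : R := M * U x - sigma * u x.

(** This is -Delta of [gap], because -Delta U = 1. *)
Let F x : R := M + sigma * weak_laplacian B u x.

Lemma int_gap : mu.-integrable B (EFin \o gap).
Proof. by apply: (intB mB); apply: (intZ mB) => //; exact: smooth_int. Qed.

Let iF : mu.-integrable B (EFin \o F).
Proof.
apply: (intD mB); last exact: (intZ mB _ int_weak_laplacian).
by apply: int_cst => //; apply: eball_finite; exact: ltW.
Qed.

Let ipU i phi : test_function B phi ->
  \int[mu]_(x in B) (partial i U x * partial i phi x) = - \int[mu]_(x in B) (partial i (partial i U) x * phi x).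
Proof. by move=> tphi; exact: (Rintegral_by_parts r0 i (smooth_partial i sU) tphi). Qed.

Let sum_ipU phi : test_function B phi ->
  \sum_(i < n) \int[mu]_(x in B) (partial i (partial i U) x * phi x) = - \int[mu]_(x in B) phi x.
Proof.
move=> tphi; have iphi : mu.-integrable B (EFin \o phi) by apply: (smooth_int r0); case: tphi.
rewrite -Rintegral_sum//; last first.
  by move=> i; apply: int_test tphi; apply: (smooth_int r0); exact: (smooth_partial i (smooth_partial i sU)).
rewrite -mulN1r -RintegralZl//; apply: eq_Rintegral => x _.
by rewrite -mulr_suml sum_partial2_u_infty.
Qed.

Let F_test phi : test_function B phi ->
  M * \int[mu]_(x in B) phi x + sigma * \int[mu]_(x in B) (weak_laplacian B u x * phi x) =
  \int[mu]_(x in B) (F x * phi x).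
Proof.
move=> tphi; have iphi : mu.-integrable B (EFin \o phi) by apply: (smooth_int r0); case: tphi.
have ilp := int_test int_weak_laplacian tphi.
rewrite -!RintegralZl// -RintegralD//; [|exact: (intZ mB)|exact: (intZ mB)].
by apply: eq_Rintegral => x _; rewrite /F mulrDl mulrA.
Qed.

(** Moving both derivatives onto [U] and [u] turns the sum into minus the integral of [F] times
    [phi], with F >= 0. *)
Lemma gap_superharmonic phi : test_function B phi -> (forall x, 0 <= phi x) ->
  \sum_(i < n) \int[mu]_(x in B) (gap x * partial i (partial i phi) x) <= 0.
Proof.
move=> tphi phi0.
have -> : \sum_(i < n) \int[mu]_(x in B) (gap x * partial i (partial i phi) x) =
    - \int[mu]_(x in B) (F x * phi x).
  rewrite -F_test// opprD -weak_laplacian_test// -!mulrN -(sum_ipU tphi) -sumrN !mulr_sumr -big_split/=.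
  apply: eq_bigr => i _; have t2 := test_function_partial i (test_function_partial i tphi).
  have iU2 := int_test (smooth_int r0 sU) t2; have iu2 := int_test iu t2.
  rewrite mulrN -(weak_partial2 i tphi).1 -[\int[mu]_(x in B) (_ * phi x)]opprK -ipU//.
  rewrite -(Rintegral_by_parts r0 i sU (test_function_partial i tphi)).
  rewrite -!RintegralZl// -RintegralB//; [|exact: (intZ mB)|exact: (intZ mB)].
  by apply: eq_Rintegral => x _; rewrite /gap; ring.
rewrite oppr_le0; apply: Rintegral_ae_ge0 => //.
  exact: int_meas (int_test iF tphi).
by apply: filterS lap_ge => x + Bx => /(_ Bx) h; exact: mulr_ge0.
Qed.

Lemma gap_ge0 : {ae mu, forall x, B x -> 0 <= gap x}.
Proof.
have [w [tw wu wD]] := hinged_approximation.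
have [ua1 _] := u_approx_L r0 n0.
have iD i : mu.-integrable B (EFin \o D i) by have [] := D_L2 (isT : (size [:: i] <= 2)%N).
have iD2 i : mu.-integrable B (EFin \o (fun x => D i x ^+ 2)).
  by have [] := D_L2 (isT : (size [:: i] <= 2)%N).
have bdtest phi : test_function B phi -> mu.-integrable B (EFin \o phi).
  by move=> tphi; apply: (smooth_int r0); case: tphi.
(* The cutoffs of [U] and the test functions approximating [u] combine linearly into an
   approximation of the gap. *)
pose w' j x := M * u_approx r j x - sigma * w j x.
have tua j : test_function B (u_approx r j) := u_approx_test r0 j.
have tw' j : test_function B (w' j).
  have := test_functionD (test_functionMr (tua j) (smooth_cst M)) (test_functionMr (tw j) (smooth_cst (- sigma))).
  by congr test_function; apply/funext => x; rewrite /w'; ring.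
have pw' i j x : partial i (w' j) x = M * partial i (u_approx r j) x - sigma * partial i (w j) x.
  apply: partialE; have d1 := smooth_is_derive i x (test_function_smooth (tua j)).
  have d2 := smooth_is_derive i x (test_function_smooth (tw j)).
  exact: (is_deriveB (is_deriveZ M d1) (is_deriveZ sigma d2)).
pose Dg i x := M * partial i U x - sigma * D i x.
have ipU1 i : mu.-integrable B (EFin \o partial i U) := smooth_int r0 (smooth_partial i sU).
have sqB f g : mu.-integrable B (EFin \o (fun x => f x ^+ 2)) -> mu.-integrable B (EFin \o (fun x => g x ^+ 2)) ->
    measurable_fun B f -> measurable_fun B g -> forall a b : R,
    mu.-integrable B (EFin \o (fun x => (a * f x - b * g x) ^+ 2)).
  move=> f2 g2 mf mg a b.
  apply: (int_le mB (g := fun x => (2 * a ^+ 2) * f x ^+ 2 + (2 * b ^+ 2) * g x ^+ 2)).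
  - by apply: measurable_funX; apply: measurable_funB; apply: measurable_funM.
  - move=> x _; rewrite ger0_norm ?sqr_ge0//.
    have := sqr_ge0 (a * f x + b * g x); rewrite -subr_ge0.
    by move: (f x) (g x) => s t h; rewrite -subr_ge0 (_ : _ - _ = (a * s + b * t) ^+ 2 - 0)//; ring.
  - by apply: (intD mB); apply: (intZ mB).
have test2 phi : test_function B phi -> mu.-integrable B (EFin \o (fun x => phi x ^+ 2)).
  move=> tphi; under eq_fun do rewrite expr2; apply: (smooth_int r0).
  exact: smoothM (test_function_smooth tphi) (test_function_smooth tphi).
have mtest phi : test_function B phi -> measurable_fun B phi by exact: test_function_measurable.
have ipU2 i : mu.-integrable B (EFin \o (fun x => partial i U x ^+ 2)).
  under eq_fun do rewrite expr2; apply: (smooth_int r0).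
  exact: smoothM (smooth_partial i sU) (smooth_partial i sU).
apply: (@weak_maximum _ _ r gap F Dg w' n0 r0).
- exact: int_gap.
- exact: iF.
- by move=> i; apply: (intB mB); apply: (intZ mB).
- by move=> i; apply: sqB => //; exact: int_meas.
- exact: lap_ge.
- exact: tw'.
- have iua j : mu.-integrable B (EFin \o (fun x => `|u_approx r j x - U x|)).
    by apply: int_norm; apply: (intB mB); [exact: bdtest|exact: smooth_int].
  have iwu j : mu.-integrable B (EFin \o (fun x => `|w j x - u x|)).
    by apply: int_norm; apply: (intB mB) => //; exact: bdtest.
  apply: (@squeeze_cvgr _ _ _ _ (fun=> 0) (fun j => M * \int[mu]_(x in B) `|u_approx r j x - U x| +
      `|sigma| * \int[mu]_(x in B) `|w j x - u x|)).
  + apply: nearW => j; rewrite Rintegral_ge0//= -!RintegralZl// -RintegralD//; [|exact: (intZ mB)|exact: (intZ mB)].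
    apply: (le_Rintegral mB).
    * by apply: int_norm; apply: (intB mB); [exact: bdtest|exact: int_gap].
    * by apply: (intD mB); exact: (intZ mB).
    move=> x _; rewrite (_ : w' j x - gap x = M * (u_approx r j x - U x) - sigma * (w j x - u x)); last first.
      by rewrite /w' /gap; ring.
    by apply: le_trans (ler_normB _ _) _; rewrite !normrM (ger0_norm M0).
  + exact: cvg_cst.
  + rewrite -[X in _ --> X](_ : M * 0 + `|sigma| * 0 = 0); last by rewrite !mulr0 addr0.
    by apply: cvgD; apply: cvgMr.
- move=> i; have [_ ua2] := partial_u_approx_L r0 n0 i.
  have tpa j := test_function_partial i (tua j).
  have tpw j := test_function_partial i (tw j).
  have i1 j : mu.-integrable B (EFin \o (fun x => (partial i (u_approx r j) x - partial i U x) ^+ 2)).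
    have := sqB _ _ (test2 _ (tpa j)) (ipU2 i) (mtest _ (tpa j)) (int_meas (ipU1 i)) 1 1.
    by under eq_fun do rewrite !mul1r.
  have i2 j : mu.-integrable B (EFin \o (fun x => (partial i (w j) x - D i x) ^+ 2)).
    have := sqB _ _ (test2 _ (tpw j)) (iD2 i) (mtest _ (tpw j)) (int_meas (iD i)) 1 1.
    by under eq_fun do rewrite !mul1r.
  apply: (@squeeze_cvgr _ _ _ _ (fun=> 0)
    (fun j => 2 * M ^+ 2 * \int[mu]_(x in B) ((partial i (u_approx r j) x - partial i U x) ^+ 2) +
      2 * sigma ^+ 2 * \int[mu]_(x in B) ((partial i (w j) x - D i x) ^+ 2))).
  + apply: nearW => j; rewrite Rintegral_ge0//=; last by move=> x _; exact: sqr_ge0.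
    rewrite -!RintegralZl// -RintegralD//; [|exact: (intZ mB)|exact: (intZ mB)].
    apply: (le_Rintegral mB).
    * have m1 := measurable_funB (mtest _ (tpa j)) (int_meas (ipU1 i)).
      have m2 := measurable_funB (mtest _ (tpw j)) (int_meas (iD i)).
      have := sqB _ _ (i1 j) (i2 j) m1 m2 M sigma; congr integrable.
      by apply/funext => x /=; congr EFin; rewrite pw' /Dg; ring.
    * by apply: (intD mB); exact: (intZ mB).
    move=> x _; rewrite pw' /Dg; move: (partial i _ x) (partial i U x) (partial i (w j) x) (D i x) => a b c d.
    rewrite -subr_ge0 (_ : _ - _ = (M * (a - b) + sigma * (c - d)) ^+ 2); last by ring.
    exact: sqr_ge0.
  + exact: cvg_cst.
  + rewrite -[X in _ --> X](_ : 2 * M ^+ 2 * 0 + 2 * sigma ^+ 2 * 0 = 0); last by rewrite !mulr0 addr0.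
    by apply: cvgD; apply: cvgMr; [exact: ua2|exact: wD].
- move=> phi tphi; rewrite -F_test// -weak_laplacian_test//.
  rewrite -[\int[mu]_(x in B) phi x]opprK -(sum_ipU tphi) -sumrN !mulr_sumr -big_split/=.
  apply: eq_bigr => i _; have tp := test_function_partial i tphi.
  rewrite -ipU// -[\int[mu]_(x in B) (DD i x * phi x)]opprK -(weak_partial2 i tphi).2 mulrN.
  have j1 := int_test (ipU1 i) tp; have j2 := int_test (iD i) tp.
  rewrite -!RintegralZl// -RintegralB//; [|exact: (intZ mB)|exact: (intZ mB)].
  by apply: eq_Rintegral => x _; rewrite /Dg mulrBl !mulrA.
Qed.

Lemma gap_dichotomy :
  (exists d c, [/\ 0 < d, 0 < c & {ae mu, forall x, B x -> eball n d x -> c <= gap x}]) \/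
  {ae mu, forall x, B x -> gap x = 0}.
Proof.
(* The strong principle asks for a function that is nonnegative everywhere and defined on the whole
   space; |gap| extended by 0 is one, and by the weak principle it equals the gap almost everywhere
   in the ball. *)
pose W : 'rV[R]_n -> R := (fun x => `|gap x|) \_ B.
have WB x : B x -> W x = `|gap x| by move=> Bx; rewrite /W patchE mem_set.
have Wout x : ~ B x -> W x = 0 by move=> nBx; rewrite /W patchE memNset.
have W0 x : 0 <= W x by have [/WB->//|/Wout->] := pselect (B x).
have iW : mu.-integrable setT (EFin \o W).
  have /(integrable_mkcond _ mB) := int_norm int_gap; congr integrable.
  by apply/funext => x; rewrite /W /= !patchE; case: ifP.
have super phi : test_function B phi -> (forall x, 0 <= phi x) ->
    \sum_(i < n) \int[mu]_x (W x * partial i (partial i phi) x) <= 0.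
  move=> tphi phi0; apply: le_trans (gap_superharmonic tphi phi0).
  rewrite le_eqVlt; apply/orP; left; apply/eqP; apply: eq_bigr => i _.
  rewrite -(eball_Rintegral (ltW r0)); last by move=> x /Wout ->; rewrite mul0r.
  have t2 := test_function_partial i (test_function_partial i tphi).
  apply: Rintegral_ae_eq => //.
  - apply: measurable_funM; last exact: test_function_measurable t2.
    by apply: measurable_funTS; exact: int_meas iW.
  - exact: int_meas (int_test int_gap t2).
  - by apply: filterS gap_ge0 => x + Bx => /(_ Bx) g0; rewrite WB// ger0_norm.
have [[d [c [d0 c0 h]]]|h] := strong_minimum r0 Wout W0 iW super; [left|right].
  exists d, c; split => //; apply: filterS2 h gap_ge0 => x h1 h2 Bx dx.
  by have := h1 dx; rewrite WB// ger0_norm// h2.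
by apply: filterS h => x h1 Bx; apply/eqP; rewrite -normr_eq0 -WB// h1.
Qed.

End hinged_function.
End comparison.

(** * The infimum on the ball and its minimisers *)

Section hinged_ball.
Context {R : realType} {n : nat}.
Variable r : R.
Hypotheses (r0 : 0 < r) (n0 : (0 < n)%N).
Local Notation mu := (lebesgue_rV R n).
Local Notation B := (eball n r).
Local Notation U := (@u_infty R n r).
Local Notation L u := (weak_laplacian (eball n r) u).
Implicit Types (u : 'rV[R]_n -> R) (M N : R).

Let n2 : 0 < 2 * n%:R :> R. Proof. by rewrite mulr_gt0// ltr0n. Qed.

Lemma Lp_oo_lty u : Lp B +oo%E u -> exists M, [/\ 0 <= M, Lp_norm B +oo u = M%:E &
  {ae mu, forall x, B x -> `|u x| <= M}].
Proof.
move=> [_ uoo]; have N0 := Lp_norm_ge0 r +oo%E u.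
have fN : Lp_norm B +oo u \is a fin_num by rewrite ge0_fin_numE.
exists (fine (Lp_norm B +oo u)); split; [exact: fine_ge0|by rewrite fineK|].
by apply: filterS (Lp_norm_oo_ge r u) => x + Bx => /(_ Bx); rewrite -lee_fin fineK.
Qed.

Lemma hinged_Lp_oo u : W2oo_hinged B u -> Lp B +oo%E (L u).
Proof. by move=> hu; have [] := hu 2 (ltr1n _ 2). Qed.

(** The boolean encodes the sign (-1)^s, so that both gaps are covered by one statement. *)
Lemma lap_ge u M (s : bool) : {ae mu, forall x, B x -> `|L u x| <= M} ->
  {ae mu, forall x, B x -> 0 <= M + (-1) ^+ s * L u x}.
Proof.
apply: filterS => x + Bx => /(_ Bx); rewrite ler_norml => /andP[h1 h2].
by case: s; rewrite ?expr0 ?expr1; lra.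
Qed.

Lemma hinged_le_u_infty u M : W2oo_hinged B u -> 0 <= M ->
  {ae mu, forall x, B x -> `|L u x| <= M} -> {ae mu, forall x, B x -> `|u x| <= M * U x}.
Proof.
move=> hu M0 hM; have H s := gap_ge0 r0 n0 hu M0 (lap_ge s hM).
apply: filterS2 (H true) (H false) => x h1 h2 Bx.
by have := h1 Bx; have := h2 Bx; rewrite /gap expr0 expr1 ler_norml => *; lra.
Qed.

Lemma hinged_Lp_norm_le u M : W2oo_hinged B u -> 0 <= M ->
  {ae mu, forall x, B x -> `|L u x| <= M} ->
  (Lp_norm B +oo u <= (M * (r ^+ 2 / (2 * n%:R)))%:E)%E.
Proof.
move=> hu M0 hM; apply: Lp_norm_oo_le.
  by rewrite mulr_ge0// divr_ge0 ?sqr_ge0// ltW.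
apply: filterS (hinged_le_u_infty hu M0 hM) => x + Bx => /(_ Bx) /le_trans; apply.
by rewrite ler_wpM2l// u_infty_le.
Qed.

(** Turns the extended real quotient into a quotient of reals: [N] is finite by the comparison with
    [u_infty], and positive because [u] does not vanish almost everywhere. *)
Lemma hinged_neq0 u : W2oo_hinged_neq0 B u -> exists N M,
  [/\ 0 < N, Lp_norm B +oo u = N%:E, Lp_norm B +oo (L u) = M%:E,
     {ae mu, forall x, B x -> `|L u x| <= M} & 0 <= M /\ N <= M * (r ^+ 2 / (2 * n%:R))].
Proof.
move=> [hu u0]; have [M [M0 eM hM]] := Lp_oo_lty (hinged_Lp_oo hu).
have NM := hinged_Lp_norm_le hu M0 hM; have N0 := Lp_norm_ge0 r +oo%E u.
have fN : Lp_norm B +oo u \is a fin_num.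
  by rewrite ge0_fin_numE//; exact: le_lt_trans NM (ltry _).
exists (fine (Lp_norm B +oo u)), M; split => //; last 1 first.
- by split => //; rewrite -lee_fin fineK.
- rewrite lt_neqAle fine_ge0// andbT; apply/eqP => e0; apply: u0 => /=.
  apply: filterS (Lp_norm_oo_ge r u) => x + Bx => /(_ Bx).
  by rewrite -(fineK fN) -e0 lee_fin normr_le0 => /eqP.
- by rewrite fineK.
Qed.

Lemma hinged_quotientE u M N : 0 < N -> Lp_norm B +oo u = N%:E -> Lp_norm B +oo (L u) = M%:E ->
  hinged_quotient B u = (M / N)%:E.
Proof. by move=> N0 eN eM; rewrite /hinged_quotient eN eM inver gt_eqF. Qed.

Lemma u_infty_gt0 d x : 0 <= d <= r -> eball n d x -> (r ^+ 2 - d ^+ 2) / (2 * n%:R) < U x.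
Proof.
move=> /andP[d0 dr] /eballE -/(_ d0) h; rewrite u_inftyE mulrC ltr_pM2l ?invr_gt0//; lra.
Qed.

Lemma u_infty_le_out d x : 0 <= d -> ~ eball n d x -> U x <= (r ^+ 2 - d ^+ 2) / (2 * n%:R).
Proof.
move=> d0 /eballE -/(_ d0) /negP; rewrite -leNgt => h.
by rewrite u_inftyE mulrC ler_pM2r ?invr_gt0//; lra.
Qed.

(** If the norm K were below the value of [U] at the centre, U > K would hold on the ball of radius
    sqrt(r^2 - 2 n K), which has positive measure. *)
Lemma u_infty_Lp_norm_ge : ((r ^+ 2 / (2 * n%:R))%:E <= Lp_norm B +oo U)%E.
Proof.
have N0 := Lp_norm_ge0 r +oo%E U.
have [fN|] := boolP (Lp_norm B +oo U \is a fin_num); last first.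
  by rewrite ge0_fin_numE// -leNgt leye_eq => /eqP ->; rewrite leey.
have := Lp_norm_oo_ge r U; rewrite -(fineK fN) lee_fin; set K := fine _ => hK.
have K0 : 0 <= K by exact: fine_ge0.
rewrite leNgt; apply/negP => Klt.
pose e := r ^+ 2 - K * (2 * n%:R).
have e0 : 0 < e by rewrite subr_gt0 -ltr_pdivlMr.
have er : e <= r ^+ 2 by rewrite gerBl mulr_ge0// ltW.
pose d := Num.sqrt e; have d0 : 0 < d by rewrite sqrtr_gt0.
have de : d ^+ 2 = e by rewrite sqr_sqrtr// ltW.
have dr : d <= r by rewrite -(ler_pXn2r (_ : 0 < 2)%N) ?nnegrE ?de// ltW.
have [A [mA A0 sA]] := hK.
have : (mu (eball n d) <= mu A)%E.
  apply: le_measure; rewrite ?inE//; first exact: measurable_eball (ltW d0).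
  move=> x dx; apply: sA => /= h; have /h := eball_sub dr dx; rewrite lee_fin.
  have := u_infty_gt0 (d := d) (x := x); rewrite dr (ltW d0) => /(_ isT dx).
  rewrite de (_ : (r ^+ 2 - e) / _ = K); last by rewrite /e subKr mulfK// gt_eqF.
  by move=> KU; rewrite leNgt (lt_le_trans KU)// ler_norm.
by rewrite A0 leNgt eball_gt0.
Qed.

Lemma u_infty_neq0 : W2oo_hinged_neq0 B U.
Proof.
split; first exact: u_infty_hinged.
move=> /= h; have := u_infty_Lp_norm_ge; apply/negP; rewrite -ltNge.
apply: (@le_lt_trans _ _ 0%:E); last by rewrite lte_fin divr_gt0// exprn_gt0.
by apply: Lp_norm_oo_le => //; apply: filterS h => x + Bx => /(_ Bx) ->; rewrite normr0.
Qed.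

Lemma Lambda_hinged_ball : Lambda_hinged B = (2 * n%:R / r ^+ 2)%:E.
Proof.
have q0 : 0 < r ^+ 2 / (2 * n%:R) by rewrite divr_gt0// exprn_gt0.
apply/eqP; rewrite eq_le; apply/andP; split.
  apply: le_trans (ereal_inf_lbound _) _; first by exists U; first exact: u_infty_neq0.
  have [N [M [N0 eN eM _ _]]] := hinged_neq0 u_infty_neq0.
  rewrite (hinged_quotientE N0 eN eM) lee_fin.
  have N1 : r ^+ 2 / (2 * n%:R) <= N by rewrite -lee_fin -eN u_infty_Lp_norm_ge.
  have M1 : M <= 1.
    rewrite -lee_fin -eM; apply: Lp_norm_oo_le => //.
    by apply: filterS (weak_laplacian_u_infty r0 n0) => x + Bx => /(_ Bx) ->; rewrite normrN1.
  rewrite ler_pdivrMr//; apply: le_trans M1 _.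
  by rewrite mulrC -ler_pdivrMr ?divr_gt0 ?exprn_gt0// mul1r invf_div.
apply/ereal_infP => _ [u hu <-]; have [N [M [N0 eN eM _ [M0 NM]]]] := hinged_neq0 hu.
rewrite (hinged_quotientE N0 eN eM) lee_fin ler_pdivlMr//.
by rewrite mulrC -ler_pdivlMr ?divr_gt0 ?exprn_gt0// invf_div.
Qed.

Lemma hinged_minimiserE u : hinged_minimiser B u ->
  exists2 c : R, c != 0 & u = (fun x => c * U x) %[ae mu in B].
Proof.
move=> [hu]; have [N [M [N0 eN eM hM [M0 NM]]]] := hinged_neq0 hu.
rewrite (hinged_quotientE N0 eN eM) Lambda_hinged_ball => -[] /eqP.
rewrite eqr_div ?(gt_eqF N0) ?(gt_eqF (exprn_gt0 2 r0))// => /eqP eq.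
(* For a minimiser the inequality N <= M r^2 / (2n) is an equality. *)
have NE : N = M * (r ^+ 2 / (2 * n%:R)).
  by rewrite mulrA eq [_ * N]mulrC mulfK// gt_eqF.
have Mgt0 : 0 < M.
  by rewrite lt_neqAle M0 andbT; apply/eqP => e; move: N0; rewrite NE -e mul0r ltxx.
have hU := hinged_le_u_infty hu.1 M0 hM.
(* A vanishing gap of sign (-1)^s reads u = (-1)^s M U, and M > 0 because N > 0. *)
have zero s : {ae mu, forall x, B x -> gap r u M ((-1) ^+ s) x = 0} ->
    exists2 c : R, c != 0 & u = (fun x => c * U x) %[ae mu in B].
  move=> h; exists ((-1) ^+ s * M); first by rewrite mulf_neq0 ?signr_eq0// gt_eqF.
  apply: filterS h => x + Bx => /(_ Bx) /eqP.
  by rewrite /gap subr_eq0 -mulrA => /eqP ->; rewrite signrMK.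
have dic (s : bool) := gap_dichotomy r0 n0 hu.1 M0 (lap_ge s hM).
have [[d1 [c1 [d10 c10 h1]]]|] := dic true; last exact: zero.
have [[d2 [c2 [d20 c20 h2]]]|] := dic false; last exact: zero.
exfalso; pose d := Num.min d1 (Num.min d2 r).
have d0 : 0 < d by rewrite !lt_min d10 d20.
have dr : d <= r by rewrite /d !ge_min lexx !orbT.
(* The last entry is the drop of M U below its maximum outside the ball of radius d; since d <= r it
   also makes N - c nonnegative. *)
pose c := Num.min c1 (Num.min c2 (M * (d ^+ 2 / (2 * n%:R)))).
have c0 : 0 < c by rewrite !lt_min c10 c20 mulr_gt0// divr_gt0// exprn_gt0.
have : (Lp_norm B +oo u <= (N - c)%:E)%E.
  apply: Lp_norm_oo_le.
    rewrite subr_ge0 NE /c !ge_min; apply/orP; right; apply/orP; right.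
    by rewrite ler_wpM2l// ler_wpM2r ?invr_ge0 ?(ltW n2)// ler_pXn2r// nnegrE ltW.
  near_simpl; apply: filterS3 h1 h2 hU => x g1 g2 hx Bx.
  have [dx|ndx] := pselect (eball n d x).
    have UN : M * U x <= N by rewrite NE ler_wpM2l// u_infty_le.
    have := g1 Bx (eball_sub _ dx); rewrite ge_min lexx => /(_ isT).
    have := g2 Bx (eball_sub _ dx); rewrite !ge_min lexx orbT => /(_ isT).
    have cc1 : c <= c1 by rewrite ge_min lexx.
    have cc2 : c <= c2 by rewrite !ge_min lexx orbT.
    by rewrite /gap expr0 expr1 ler_norml; lra.
  have cc : c <= M * (d ^+ 2 / (2 * n%:R)) by rewrite !ge_min lexx !orbT.
  apply: le_trans (hx Bx) _; apply: le_trans (ler_wpM2l M0 (u_infty_le_out (ltW d0) ndx)) _.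
  by rewrite mulrBl mulrBr -NE; lra.
by rewrite eN lee_fin lerBrDr gerDl leNgt c0.
Qed.
End hinged_ball.

Theorem corollary3p2 (R : realType) (n : nat) (r : R)
    (hn : (0 < n)%N) (hr : 0 < r) :
  (forall u : 'rV[R]_n -> R, hinged_minimiser (eball n r) u ->
     exists2 c : R, c != 0 &
       u = (fun x => c * u_infty r x) %[ae lebesgue_rV R n in eball n r]) /\
  Lambda_hinged (eball n r) = (2 * n%:R / r ^+ 2)%:E.
Proof.
by split; [move=> u; exact: hinged_minimiserE|exact: Lambda_hinged_ball].
Qed.
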